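(* Let $*$ be a star product on a Poisson manifold $(M,\{\cdot,\cdot\})$ and $\mathcal A=(C^\infty(M)[[\nu]],* )$. For every nonvanishing formal density $\rho$ on $M$ the operator $Q_\rho=(J_\rho^{-1})^t_\rho J_\rho$ is an automorphism of $\mathcal A$ (the modular automorphism corresponding to $\rho$). If $\rho$ and $\tilde\rho=\phi\,\rho$ are two nonvanishing formal densities on $M$ (with $\phi$ an invertible formal function) and $\psi=J_\rho^{-1}\phi$, then $$Q_\rho=Q_{\tilde\rho}\circ\mathrm{Ad}(\psi),\qquad \mathrm{Ad}(\psi)f=\psi*f*\psi^{-1},$$ where $\psi^{-1}$ is the inverse with respect to $*$. Hence the modular automorphisms $Q_\rho$, for all nonvanishing formal densities $\rho$, define a single outer automorphism of $\mathcal A$ (a class of automorphisms modulo inner automorphisms). This outer automorphism is an obstruction to the existence of a nonvanishing trace density: if there is a nonvanishing formal trace density of $*$ then all modular automorphisms $Q_\rho$ are inner; conversely, if for some nonvanishing formal density $\rho$ the automorphism $Q_\rho$ is inner, $Q_\rho=\mathrm{Ad}(\chi)$, then $\tilde\rho=(J_\rho\chi)\,\rho$ is a nonvanishing trace density of $*$.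
   Context: A star product $*$ on a Poisson manifold $(M,\{\cdot,\cdot\})$ is an associative $\nu$-linear product on $C^\infty(M)[[\nu]]$ given for $f,g\in C^\infty(M)$ by $f*g=\sum_{r\ge 0}\nu^rC_r(f,g)$, where the $C_r$ are bidifferential operators on $M$, $C_0(f,g)=fg$, $C_1(f,g)-C_1(g,f)=\{f,g\}$, and the constant $1$ is the unit. $L_f$ and $R_f$ denote left and right $*$-multiplication by $f$: $L_fg=f*g=R_gf$. $\mathcal D$ is the algebra of differential operators on $M$ and $\mathcal D[[\nu]]$ the algebra of formal differential operators. A formal density $\rho=\rho_0+\nu\rho_1+\dots$ on $M$ is nonvanishing if $\rho_0$ is a nonvanishing smooth density. For such $\rho$ and $A\in\mathcal D[[\nu]]$, $A^t_\rho\in\mathcal D[[\nu]]$ is the formal transpose: $\int_M Au\cdot v\,\rho=\int_M u\cdot A^t_\rho v\,\rho$ for $u\in C^\infty(M)[[\nu]]$, $v\in C_c^\infty(M)[[\nu]]$. $J_\rho\in\mathcal D[[\nu]]$ is the formal differential operator with $J_\rho f=(R_f)^t_\rho1$; since $J_\rho=1\pmod\nu$, it is invertible in $\mathcal D[[\nu]]$. A formal density $\rho$ is a trace density of $*$ if $\int_M u*v\,\rho=\int_M v*u\,\rho$ for all $u\in C^\infty(M)$, $v\in C_c^\infty(M)$. An automorphism of $\mathcal A$ is inner if it equals $\mathrm{Ad}(\chi)$ for some $*$-invertible $\chi\in C^\infty(M)[[\nu]]$. *)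

(* Defs.v *)
From HB Require Import structures.
From mathcomp Require Import all_boot all_order all_algebra.
From mathcomp Require Import all_classical all_reals all_analysis.

Set Implicit Arguments.
Unset Strict Implicit.
Unset Printing Implicit Defensive.

Import Order.TTheory GRing.Theory Num.Theory.
Import numFieldNormedType.Exports.

Local Open Scope classical_set_scope.
Local Open Scope ring_scope.

Section Calculus.
Variables (R : realType) (n : nat).
Implicit Types (U : set 'rV[R]_n) (f g : 'rV[R]_n -> R).

Definition pderiv (i : 'I_n) f : 'rV[R]_n -> R :=
  fun x => 'D_(delta_mx 0 i : 'rV[R]_n) f x.

(* [pderivs [:: i1; ...; ik] f] is d_{i1} ... d_{ik} f. *)
Definition pderivs (I : seq 'I_n) f : 'rV[R]_n -> R := foldr pderiv f I.

Fixpoint Ck (k : nat) U f : Prop :=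
  (forall x, U x -> {for x, continuous f}) /\
  (if k is k'.+1 then
     forall i, (forall x, U x -> derivable f x (delta_mx 0 i : 'rV[R]_n)) /\
               Ck k' U (pderiv i f)
   else True).

(* Only meaningful for open [U]: continuity and differentiability are those of
   [f] itself, not of its restriction to [U]. *)
Definition smooth_on U f : Prop := forall k, Ck k U f.

Definition jacobian_det (T : 'rV[R]_n -> 'rV[R]_n) (x : 'rV[R]_n) : R :=
  \det (\matrix_(i, j) pderiv i (fun y => T y 0 j) x).

Lemma Ck_eq k U f g : open U -> (forall x, U x -> f x = g x) ->
  Ck k U f -> Ck k U g.
Proof.
move=> oU; elim: k f g => [|k IH] f g fg [cf df].
all: have nfg x : U x -> \forall y \near x, f y = g y
  by move=> Ux; apply: (filterS fg); exact: open_nbhs_nbhs.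
all: have cg x : U x -> {for x, continuous g}
  by move=> Ux; rewrite /prop_for /continuous_at -(fg x Ux);
     exact: cvg_trans (@near_eq_cvg _ _ (nbhs x) _ f g (nfg x Ux)) (cf x Ux).
all: split => // i.
have [di ki] := df i.
split=> [x Ux|].
  exact: (@near_eq_derivable R _ R f g x _ (nfg x Ux) (di x Ux)).
apply: IH ki => x Ux.
exact: (@near_eq_derive R _ R f g x _ (nfg x Ux)).
Qed.

Lemma CkS k U f : Ck k.+1 U f -> Ck k U f.
Proof.
elim: k f => [|k IH] f [cf df]; split => // i.
by have [di /IH] := df i.
Qed.

Lemma Ck_cst k U (a : R) : open U -> Ck k U (fun=> a).
Proof.
move=> oU; elim: k a => [|k IH] a.
all: have ca x : U x -> {for x, continuous (fun=> a)} by move=> _; exact: cst_continuous.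
all: split => // i.
split=> [x _|]; first exact: (@derivable_cst R _ R a x).
by apply: (Ck_eq oU _ (IH 0)) => x _; exact: (esym (@derive_cst R _ R a x _)).
Qed.

Lemma CkB k U f g : open U -> Ck k U f -> Ck k U g -> Ck k U (f - g).
Proof.
move=> oU; elim: k f g => [|k IH] f g [cf df] [cg dg].
all: have cfg x : U x -> {for x, continuous (f - g)}
  by move=> Ux; exact: (@continuousB _ R _ f g x (cf x Ux) (cg x Ux)).
all: split => // i.
have [di ki] := df i; have [ei li] := dg i; split=> [x Ux|].
  exact: (@derivableB R _ R f g x _ (di x Ux) (ei x Ux)).
apply: (Ck_eq oU _ (IH _ _ ki li)) => x Ux.
exact: (esym (@deriveB R _ R f g x _ (di x Ux) (ei x Ux))).
Qed.

Lemma CkM k U f g : open U -> Ck k U f -> Ck k U g -> Ck k U (f * g).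
Proof.
move=> oU; elim: k f g => [|k IH] f g kf kg; have [cf df] := kf;
  have [cg dg] := kg.
all: have cfg x : U x -> {for x, continuous (f * g)}
  by move=> Ux; exact: (@continuousM R _ f g x (cf x Ux) (cg x Ux)).
all: split => // i.
have [di ki] := df i; have [ei li] := dg i; split=> [x Ux|].
  exact: (@derivableM R _ f g x _ (di x Ux) (ei x Ux)).
have k1 := IH _ _ (CkS kf) li; have k2 := IH _ _ (CkS kg) ki.
have k0 : Ck k U (- (g * pderiv i f)).
  by rewrite -sub0r; apply: CkB => //; exact: Ck_cst.
apply: (Ck_eq oU _ (CkB oU k1 k0)) => x Ux.
by rewrite /pderiv opprK (@deriveM R _ f g x _ (di x Ux) (ei x Ux)).
Qed.

End Calculus.

(* Iterated Lebesgue integral over R^n; it is only applied to continuous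
   functions with compact support. *)
Fixpoint integral_Rn (R : realType) (n : nat) : ('rV[R]_n -> R) -> R :=
  match n with
  | 0 => fun f => f 0
  | m.+1 => fun f => \int[@lebesgue_measure R]_t
      integral_Rn (fun y : 'rV[R]_m => f (row_mx (t%:M : 'rV[R]_1) y))
  end.

(* A smooth n-manifold given by an atlas (not required to be maximal).
   [coord c] is the chart on [dom c] and [param c] its inverse; both are total
   functions, irrelevant off [dom c] and off its image. *)
Record manifold (R : realType) (n : nat) := Manifold {
  mspace :> topologicalType;
  chart : Type;
  dom : chart -> set mspace;
  coord : chart -> mspace -> 'rV[R]_n;
  param : chart -> 'rV[R]_n -> mspace;
  manifold_hausdorff : hausdorff_space mspace;
  manifold_second_countable : @second_countable mspace;
  dom_open : forall c, open (dom c);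
  dom_cover : forall x, exists c, dom c x;
  img_open : forall c, open (coord c @` dom c);
  paramK : forall c x, dom c x -> param c (coord c x) = x;
  coord_cont : forall c x, dom c x -> {for x, continuous (coord c)};
  param_cont : forall c y, (coord c @` dom c) y -> {for y, continuous (param c)};
  transition_smooth : forall c d (j : 'I_n),
    smooth_on (coord c @` (dom c `&` dom d)) (fun y => coord d (param c y) 0 j)
}.

Section SmoothFunctions.
Variables (R : realType) (n : nat) (M : manifold R n).

Definition smooth_in (c : chart M) (g : M -> R) : Prop :=
  smooth_on (coord c @` dom c) (g \o param c).

Definition smooth (g : M -> R) : Prop := forall c, smooth_in c g.

Definition smooth_pred : {pred M -> R} := fun g => `[< smooth g >].

Lemma smoothP g : reflect (smooth g) (g \in smooth_pred).
Proof. exact: asboolP. Qed.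

Lemma smooth_subring : subring_closed smooth_pred.
Proof.
split.
- by apply/smoothP => c k; apply: Ck_cst; exact: img_open.
- move=> f g /smoothP hf /smoothP hg; apply/smoothP => c k.
  by apply: CkB; [exact: img_open|exact: hf|exact: hg].
- move=> f g /smoothP hf /smoothP hg; apply/smoothP => c k.
  by apply: CkM; [exact: img_open|exact: hf|exact: hg].
Qed.

HB.instance Definition _ :=
  GRing.isSubringClosed.Build (M -> R) smooth_pred smooth_subring.

Lemma smooth_scaler : scaler_closed smooth_pred.
Proof.
move=> a f /smoothP hf; apply/smoothP => c k.
apply: (@CkM _ _ k _ (fun=> a) (f \o param c)); first exact: img_open.
  by apply: Ck_cst; exact: img_open.
exact: hf.
Qed.

HB.instance Definition _ :=
  GRing.isScaleClosed.Build R (M -> R) smooth_pred smooth_scaler.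

(* The algebra C^oo(M) of real-valued smooth functions. *)
Record smoothFun := SmoothFun {
  sval_fun :> M -> R;
  _ : sval_fun \in smooth_pred
}.

HB.instance Definition _ := [isSub for sval_fun].
HB.instance Definition _ := [Choice of smoothFun by <:].
HB.instance Definition _ :=
  GRing.SubChoice_isSubComPzRing.Build (M -> R) smooth_pred smoothFun
    (subringClosedP smooth_pred).
HB.instance Definition _ := [SubZmodule_isSubLmodule of smoothFun by <:].

End SmoothFunctions.

Notation "'C^oo' ( M )" := (smoothFun M) (at level 0, M at level 100,
  format "'C^oo' ( M )") : type_scope.

Section Operators.
Variables (R : realType) (n : nat) (M : manifold R n).

Definition supp (f : C^oo(M)) : set M := closure [set x | f x != 0].

(* Iterated partial derivative in the coordinates of [c], at a point of M. *)
Definition chart_pderivs (c : chart M) (I : seq 'I_n) (f : M -> R) (x : M) : R :=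
  pderivs I (f \o param c) (coord c x).

(* Differential operators of finite order: in each chart,
   A f = sum_(k <= N) sum_(i1, ..., ik) a_(i1...ik) d_i1 ... d_ik f. *)
Definition diffop (A : C^oo(M) -> C^oo(M)) : Prop :=
  exists N : nat, forall c : chart M, exists a : seq 'I_n -> M -> R,
    (forall I, smooth_in c (a I)) /\
    forall (f : C^oo(M)) x, dom c x ->
      A f x = \sum_(k < N.+1) \sum_(I : k.-tuple 'I_n)
                a I x * chart_pderivs c I f x.

Definition bidiffop (B : C^oo(M) -> C^oo(M) -> C^oo(M)) : Prop :=
  exists N : nat, forall c : chart M, exists b : seq 'I_n -> seq 'I_n -> M -> R,
    (forall I J, smooth_in c (b I J)) /\
    forall (f g : C^oo(M)) x, dom c x ->
      B f g x = \sum_(k < N.+1) \sum_(I : k.-tuple 'I_n)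
                \sum_(l < N.+1) \sum_(J : l.-tuple 'I_n)
                  b I J x * chart_pderivs c I f x * chart_pderivs c J g x.

Definition poisson_bracket (P : C^oo(M) -> C^oo(M) -> C^oo(M)) : Prop :=
  [/\ forall (a : R) f g h, P (a *: f + g) h = a *: P f h + P g h,
      forall f g, P f g = - P g f,
      forall f g h, P f (g * h) = P f g * h + g * P f h &
      forall f g h, P f (P g h) + P g (P h f) + P h (P f g) = 0].

(* C^oo(M)[[nu]]: the series sum_r nu^r f_r is the sequence r |-> f_r. The
   addition is inherited from sequences; the product is [fmul] below. *)
Definition formal := nat -> C^oo(M).

HB.instance Definition _ := GRing.Zmodule.copy formal (nat -> C^oo(M)).

Definition fconst (f : C^oo(M)) : formal := fun r => if r == 0%N then f else 0.

Definition fone : formal := fconst 1.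

Definition fmul (u v : formal) : formal :=
  fun r => \sum_(i < r.+1) u i * v (r - i)%N.

(* Multiplication by a scalar of R[[nu]]. *)
Definition fscale (a : nat -> R) (u : formal) : formal :=
  fun r => \sum_(i < r.+1) a i *: u (r - i)%N.

Definition finvertible (u : formal) : Prop := exists v, fmul u v = fone.

Definition fcompact (u : formal) : Prop := forall r, compact (supp (u r)).

(* D[[nu]], as a set of operators on C^oo(M)[[nu]]. *)
Definition fdiffop (A : formal -> formal) : Prop :=
  exists2 a : nat -> C^oo(M) -> C^oo(M), (forall r, diffop (a r)) &
    forall f r, A f r = \sum_(i < r.+1) a i (f (r - i)%N).

(* The inverse of [A] in D[[nu]]. *)
Definition fdiffop_inv (A : formal -> formal) : formal -> formal :=
  xget (id : formal -> formal) [set B | [/\ fdiffop B, A \o B = id & B \o A = id]].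

End Operators.

Section Densities.
Variables (R : realType) (n : nat) (M : manifold R n).

(* A smooth density is given by its coefficient in each chart, seen as a
   function on M which is 0 off the domain of the chart (so that equality of
   densities is equality of functions). *)
Definition predensity := chart M -> M -> R.

Definition is_density (rho : predensity) : Prop :=
  [/\ forall c, smooth_in c (rho c),
      forall c x, ~ dom c x -> rho c x = 0 &
      forall c d x, dom c x -> dom d x ->
        rho c x = `|jacobian_det (coord d \o param c) (coord c x)| * rho d x].

(* Integral of [f rho] when the support of [f] is a compact subset of [dom c]. *)
Definition chart_integral (rho : predensity) (c : chart M) (f : C^oo(M)) : R :=
  integral_Rn (fun y => if y \in coord c @` dom c
                        then f (param c y) * rho c (param c y) else 0).

(* Integral of [f rho] over M for [f] with compact support: the sum of chart
   integrals for any decomposition of [f] into smooth functions with compact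
   support in chart domains, as given by a partition of unity. *)
Definition density_integral (rho : predensity) (f : C^oo(M)) : R :=
  xget 0 [set r | exists m (c : 'I_m -> chart M) (g : 'I_m -> C^oo(M)),
    [/\ forall i, compact (supp (g i)) /\ supp (g i) `<=` dom (c i),
        f = \sum_i g i &
        r = \sum_i chart_integral rho (c i) (g i)]].

Definition formal_density := nat -> predensity.

Definition nonvanishing_density (rho : formal_density) : Prop :=
  (forall r, is_density (rho r)) /\
  forall c x, dom c x -> rho 0%N c x != 0.

Definition density_scale (phi : formal M) (rho : formal_density) :
    formal_density :=
  fun r c x => \sum_(i < r.+1) phi i x * rho (r - i)%N c x.

(* The integral of [u rho], in R[[nu]], for [u] with compactly supported
   coefficients. *)
Definition fintegral (rho : formal_density) (u : formal M) : nat -> R :=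
  fun r => \sum_(i < r.+1) density_integral (rho (r - i)%N) (u i).

Definition transpose (rho : formal_density) (A : formal M -> formal M) :
    formal M -> formal M :=
  xget (id : formal M -> formal M) [set B | fdiffop B /\ forall u v, fcompact v ->
    fintegral rho (fmul (A u) v) = fintegral rho (fmul u (B v))].

End Densities.

Section StarProduct.
Variables (R : realType) (n : nat) (M : manifold R n).
Variable C : nat -> C^oo(M) -> C^oo(M) -> C^oo(M).

Definition star (u v : formal M) : formal M :=
  fun r => \sum_(i < r.+1) \sum_(j < (r - i).+1) C i (u j) (v (r - i - j)%N).

Definition star_product (P : C^oo(M) -> C^oo(M) -> C^oo(M)) : Prop :=
  [/\ forall r, bidiffop (C r),
      forall f g, C 0%N f g = f * g,
      forall f g, C 1%N f g - C 1%N g f = P f g,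
      forall u, star (fone M) u = u /\ star u (fone M) = u &
      forall u v w, star (star u v) w = star u (star v w)].

Definition star_inverse (u v : formal M) : Prop :=
  star u v = fone M /\ star v u = fone M.

Definition star_invertible (u : formal M) : Prop := exists v, star_inverse u v.

Definition star_inv (u : formal M) : formal M := xget u (star_inverse u).

Definition Ad (chi : formal M) : formal M -> formal M :=
  fun u => star (star chi u) (star_inv chi).

(* Automorphisms of the R[[nu]]-algebra (C^oo(M)[[nu]], * ). *)
Definition automorphism (T : formal M -> formal M) : Prop :=
  [/\ bijective T,
      {morph T : u v / u + v},
      forall a u, T (fscale a u) = fscale a (T u),
      forall u v, T (star u v) = star (T u) (T v) &
      T (fone M) = fone M].

Definition inner (T : formal M -> formal M) : Prop :=
  automorphism T /\ exists2 chi, star_invertible chi & T = Ad chi.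

(* The class of [T] modulo inner automorphisms. *)
Definition outer_class (T : formal M -> formal M) : set (formal M -> formal M) :=
  [set T \o S | S in inner].

(* J_rho f = (R_f)^t_rho 1. *)
Definition Jop (rho : formal_density M) : formal M -> formal M :=
  fun f => transpose rho (fun u => star u f) (fone M).

Definition Qop (rho : formal_density M) : formal M -> formal M :=
  transpose rho (fdiffop_inv (Jop rho)) \o Jop rho.

Definition trace_density (rho : formal_density M) : Prop :=
  forall u v : C^oo(M), compact (supp v) ->
    fintegral rho (star (fconst u) (fconst v)) =
    fintegral rho (star (fconst v) (fconst u)).

End StarProduct.

(* Main.v *)
Require Import Defs.
From HB Require Import structures.
From mathcomp Require Import all_boot all_order all_algebra.
From mathcomp Require Import all_classical all_reals all_analysis.
From mathcomp Require Import lra ring.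

Set Implicit Arguments.
Unset Strict Implicit.
Unset Printing Implicit Defensive.

Import Order.TTheory GRing.Theory Num.Theory.
Import numFieldNormedType.Exports.

Local Open Scope classical_set_scope.
Local Open Scope ring_scope.

(** The transpose A^t_rho is taken chart by chart, integrating by parts; the local formulas agree
    on overlaps because the pairing is nondegenerate.  Since J f is (R_f)^t_rho 1, one has
    int (u * f) rho = int u (J f) rho, and moving J across the pairing gives the modular property
    int (u * f) rho = int (Q f * u) rho.  The pairing int (f * u) rho is nondegenerate in f because
    J is invertible, so the modular property determines Q.  Comparing int (f * g) * u computed in
    one and in two steps shows that Q is multiplicative.  For rho' = phi rho one has
    int u rho' = int (u * psi) rho, and the modular properties of rho and rho' together give
    Q (f * psi) = Q psi * Q' f, that is Q = Q' o Ad psi.  Finally rho is a trace density iff Q = id.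

    Only continuous functions with compact support are integrated over R^n: Fubini follows by
    comparing primitives, and the change of variables by smearing the graph of the map with a
    bump function and integrating in both orders. *)

(** * Calculus in R^n *)

(** Transposes, inverse operators and integrals over [M] are chosen by [xget]; each acquires a
    meaning only once existence and uniqueness are known. For the integral, uniqueness is
    independence of the charts, whence the change of variables. For the transpose, it is tested on
    compactly supported functions and carried over to all arguments by locality.

    [J] is the delicate operator: [Jop C rho f] involves a different transpose for each [f], so that
    it is a differential operator in [f] is not visible. For this reason bidifferential operators
    [B u f] are transposed, moving only [u] and keeping the dependence on [f] bidifferential; an
    ordinary operator [A] is covered by [B u f = A u * f] at [f = 1].

    Formal densities bring no new analysis: dividing by the leading term gives [rho = theta * rho_0]
    with [theta] of leading coefficient 1, multiplication by [theta] is inverted order by order, and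
    only coefficients paired against [rho_0] remain. The integrals make sense as soon as one factor
    of the integrand has compact support, so the pairing formulas let either factor carry it. *)

Section RowVectors.
Variables (R : realType) (n : nat).
Implicit Types (x y z : 'rV[R]_n) (f : 'rV[R]_n -> R).

Lemma coord_le_norm x i : `|x 0 i| <= `|x|.
Proof.
rewrite [leRHS]mx_normrE.
exact: (@le_bigmax _ _ _ 0 (fun ij : 'I_1 * 'I_n => `|x ij.1 ij.2|) (0, i)).
Qed.

Lemma rv_norm_le x (a : R) : 0 <= a -> (forall i, `|x 0 i| <= a) -> `|x| <= a.
Proof.
move=> a0 xa; rewrite [leLHS]mx_normrE; apply/bigmax_leP; split => // -[i j] _ /=.
by rewrite (ord1 i).
Qed.

Lemma continuousP_rv (V W : normedModType R) (f : V -> W) (x : V) :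
  {for x, continuous f} <->
  forall e : R, 0 < e -> exists2 d : R, 0 < d & forall y : V, `|y - x| < d -> `|f y - f x| < e.
Proof.
split=> [cf e e0|H].
  have /(@cvgr_dist_lt _ _ _ _ _ f (f x))/(_ _ e0) := cf.
  move=> /nbhs_ballP[d d0 D]; exists d => // y yx.
  by rewrite distrC; apply: D; rewrite -ball_normE /= distrC.
apply/(@cvgrPdist_lt _ _ _ _ _ f (f x)) => e e0.
have [d d0 D] := H e e0.
apply/nbhs_ballP; exists d => // y; rewrite -ball_normE /= distrC => /D.
by rewrite distrC.
Qed.

Lemma open_ballP (V : normedModType R) (U : set V) (x : V) : open U -> U x ->
  exists2 d : R, 0 < d & forall y : V, `|y - x| < d -> U y.
Proof.
move=> oU Ux; have /nbhs_ballP[d d0 D] : nbhs x U by exact: open_nbhs_nbhs.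
by exists d => // y yx; apply: D; rewrite -ball_normE /= distrC.
Qed.

Lemma deltaE (i j : 'I_n) : (delta_mx 0 i : 'rV[R]_n) 0 j = (j == i)%:R.
Proof. by rewrite mxE eqxx. Qed.

Lemma is_derive_line f x (v : 'rV[R]_n) (t : R) : derivable f (x + t *: v) v ->
  is_derive t 1 (fun s : R => f (x + s *: v)) ('D_v f (x + t *: v)).
Proof.
move=> df.
have E : (fun h : R => h^-1 *: (((fun s : R => f (x + s *: v)) \o shift t) (h *: (1 : R)) -
           f (x + t *: v))) =
         (fun h : R => h^-1 *: ((f \o shift (x + t *: v)) (h *: v) - f (x + t *: v))).
  apply/funext => h /=; congr (_ *: (f _ - _)).
  by rewrite -[h *: 1]/(h * 1) mulr1 scalerDl addrCA.
by apply: DeriveDef; rewrite /derivable /derive E.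
Qed.

Lemma mvt_line f x (v : 'rV[R]_n) (t : R) :
  (forall s : R, 0 <= s <= 1 -> derivable f (x + (s * t) *: v) v) ->
  exists2 s : R, 0 <= s <= 1 & f (x + t *: v) - f x = t * 'D_v f (x + (s * t) *: v).
Proof.
move=> df.
pose g := fun s : R => f (x + (s * t) *: v).
have dg (s : R) : 0 <= s <= 1 -> is_derive s 1 g (t * 'D_v f (x + (s * t) *: v)).
  move=> s01; have -> : g = (fun s : R => f (x + s *: v)) \o (fun s : R => t * s).
    by apply/funext => r; rewrite /g /= mulrC.
  rewrite mulrC; apply: is_derive1_comp.
    by rewrite [t * s]mulrC; apply: is_derive_line; exact: df.
  have -> : (fun s : R => t * s) = t \*: id by apply/funext.
  by rewrite -[t in is_derive _ _ _ t]mulr1; exact: is_deriveZ.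
have [|||s s01] := @MVT_segment _ g (fun s => t * 'D_v f (x + (s * t) *: v)) 0 1.
- by [].
- by move=> s; rewrite in_itv /= => /andP[s0 s1]; apply: dg; rewrite !ltW.
- apply: derivable_within_continuous => s; rewrite in_itv /= => s01.
  by have [] := dg s s01.
rewrite /g mul1r mul0r scale0r addr0 subr0 mulr1 => E.
by exists s => //; move: s01; rewrite in_itv.
Qed.

(* The coordinate box with opposite corners [x] and [y]. *)
Definition inbox x y z := forall i, `|z 0 i - x 0 i| <= `|y 0 i - x 0 i|
  /\ `|z 0 i - y 0 i| <= `|y 0 i - x 0 i|.

Lemma inbox_dist x y z : inbox x y z -> `|z - x| <= `|y - x|.
Proof.
move=> B; apply: rv_norm_le => // i; rewrite !mxE.
apply: le_trans (B i).1 _.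
by have := coord_le_norm (y - x) i; rewrite !mxE.
Qed.

(** The norm is the sup norm, and the two bounds in [inbox] put each [z 0 i] between [x 0 i] and
    [y 0 i]; intervals are convex. *)
Lemma inbox_ball x y z c (r : R) : inbox x y z -> `|x - c| <= r -> `|y - c| <= r ->
  `|z - c| <= r.
Proof.
move=> B xc yc; apply: rv_norm_le => [|i]; first exact: le_trans xc.
have [B1 B2] := B i.
have := le_trans (coord_le_norm (x - c) i) xc.
have := le_trans (coord_le_norm (y - c) i) yc.
rewrite !mxE; move: B1 B2.
move: (z 0 i) (x 0 i) (y 0 i) (c 0 i) => a b d e.
by rewrite !ler_norml; case: (lerP 0 (d - b)) => h; [rewrite (ger0_norm h)|rewrite (ltr0_norm h)]; move=> *; lra.
Qed.

(** Going from [x] to [y] one coordinate at a time needs only partial derivatives, at the price of a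
    separate intermediate point for each coordinate. *)
Lemma mean_value f x y :
  (forall z, inbox x y z -> forall i, derivable f z (delta_mx 0 i)) ->
  exists2 xi : 'I_n -> 'rV[R]_n, (forall i, inbox x y (xi i)) &
    f y - f x = \sum_i (y 0 i - x 0 i) * pderiv i f (xi i).
Proof.
move=> df.
(* [z k] has the first [k] coordinates of [y] and the others of [x], so the increments telescope
   from [z 0 = x] to [z n = y]. *)
pose z k : 'rV[R]_n := \row_j (if (j < k)%N then y 0 j else x 0 j).
have step (i : 'I_n) : exists2 xi, inbox x y xi &
    f (z i.+1) - f (z i) = (y 0 i - x 0 i) * pderiv i f xi.
  pose t := y 0 i - x 0 i.
  have B (s : R) : 0 <= s <= 1 -> inbox x y (z i + (s * t) *: delta_mx 0 i).
    move=> /andP[s0 s1] j; rewrite !mxE eqxx /=.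
    have [->|ji] := eqVneq j i.
      rewrite ltnn mulr1 addrAC subrr add0r -/t; split.
        by rewrite normrM (ger0_norm s0) ler_piMl.
      have -> : x 0 i + s * t - y 0 i = (s - 1) * t by rewrite /t; ring.
      by rewrite normrM ler_piMl // ler_norml; lra.
    rewrite mulr0 addr0; case: ifP => _; rewrite !subrr !normr0 ?lexx.
      by split.
    by split => //; rewrite distrC.
  have [s s01] := @mvt_line f (z i) (delta_mx 0 i) t (fun s h => df _ (B s h) i).
  have -> : z i + t *: delta_mx 0 i = z i.+1.
    apply/rowP => j; rewrite !mxE eqxx /= ltnS.
    have [->|ji] := eqVneq j i.
      by rewrite ltnn leqnn mulr1 /t addrC subrK.
    by rewrite mulr0 addr0 [in RHS]leq_eqVlt -val_eqE /= in ji *; rewrite (negbTE ji).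
  by exists (z i + (s * t) *: delta_mx 0 i); [exact: B|].
have /choice[xi xiP] : forall i : 'I_n, exists xi, inbox x y xi /\
    f (z i.+1) - f (z i) = (y 0 i - x 0 i) * pderiv i f xi.
  by move=> i; have [w w1 w2] := step i; exists w.
exists xi => [i|]; first exact: (xiP i).1.
have -> : f y - f x = \sum_(0 <= i < n) (f (z i.+1) - f (z i)).
  rewrite (telescope_sumr (f \o z)) //=; congr (f _ - f _); apply/rowP => j; rewrite mxE.
    by rewrite ltn_ord.
  by rewrite ltn0.
by rewrite big_mkord; apply: eq_bigr => i _; exact: (xiP i).2.
Qed.

Lemma continuous_rv (V : normedModType R) (T : V -> 'rV[R]_n) (a : V) :
  (forall j, {for a, continuous (fun y : V => T y 0 j)}) -> {for a, continuous T}.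
Proof.
move=> cT; apply/(@continuousP_rv V) => e e0.
have /choice[d dP] : forall j, exists d : R, 0 < d /\
    forall y : V, `|y - a| < d -> `|T y 0 j - T a 0 j| < e / 2.
  move=> j; have /(@continuousP_rv V R) H := cT j.
  by have [|d d0 dP] := H (e / 2); [rewrite divr_gt0|exists d].
exists (\big[Order.min/1]_j d j).
  by apply/bigmin_gtP; split => // j _; exact: (dP j).1.
move=> y /bigmin_gtP[_ ya].
rewrite (@le_lt_trans _ _ (e / 2)) //; last by lra.
apply: rv_norm_le => [|j]; first by lra.
by rewrite !mxE; apply/ltW/(dP j).2/ya.
Qed.

End RowVectors.

(** * The chain rule from continuous partial derivatives *)

Section Chain.
Variables (R : realType) (m n : nat).

Lemma cvg_big_sum (I : finType) (T : Type) (F : set_system T) {FF : Filter F}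
    (f : I -> T -> R) (l : I -> R) :
  (forall i, f i x @[x --> F] --> l i) ->
  (\sum_i f i x) @[x --> F] --> \sum_i l i.
Proof.
move=> fl; elim: (index_enum I) => [|i s IH].
  rewrite big_nil; under eq_fun do rewrite big_nil; exact: cvg_cst.
rewrite big_cons; under eq_fun do rewrite big_cons.
by apply: cvgD; [exact: fl|exact: IH].
Qed.

(** No total differential is involved: the increment of [f] is expanded by [mean_value], and the
    intermediate points tend to [T x], where the partial derivatives of [f] are continuous. *)
Lemma chain_rule (T : 'rV[R]_m -> 'rV[R]_n) (f : 'rV[R]_n -> R) (x v : 'rV[R]_m) (d : R) :
  0 < d ->
  (forall y, `|y - T x| < d -> forall j, derivable f y (delta_mx 0 j)) ->
  (forall j, {for T x, continuous (pderiv j f)}) ->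
  {for x, continuous T} ->
  (forall j, derivable (fun y => T y 0 j) x v) ->
  is_derive x v (f \o T) (\sum_j 'D_v (fun y => T y 0 j) x * pderiv j f (T x)).
Proof.
move=> d0 df cdf cT dT.
pose p h := T (h *: v + x).
have px : p h @[h --> (0:R)^'] --> T x.
  apply: cvg_within_filter.
  have -> : T x = p 0 by rewrite /p scale0r add0r.
  apply: (@continuous_comp _ _ _ (fun h : R => h *: v + x) T).
    apply: cvgD; last exact: cvg_cst.
    exact: scalel_continuous.
  by rewrite scale0r add0r.
have near : \forall h \near (0:R)^', `|p h - T x| < d.
  have : \forall h \near (0:R)^', `|T x - p h| < d by apply: (@cvgr_dist_lt _ _ _ (0:R)^' _ p (T x) px d d0).
  by apply: filterS => h; rewrite distrC.
have /choice[xi xiP] : forall h : R, exists xi : 'I_n -> 'rV[R]_n, `|p h - T x| < d ->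
    (forall j, `|xi j - T x| <= `|p h - T x|) /\
    f (p h) - f (T x) = \sum_i (p h 0 i - T x 0 i) * pderiv i f (xi i).
  move=> h; have [hd|] := boolP (`|p h - T x| < d); last by exists (fun=> 0).
  have [|xi B E] := @mean_value R n f (T x) (p h).
    by move=> z /inbox_dist zB; apply: df; exact: le_lt_trans zB hd.
  by exists xi => _; split => // j; exact: inbox_dist.
have xic j : pderiv j f (xi h j) @[h --> (0:R)^'] --> pderiv j f (T x).
  apply: (@cvg_comp _ _ _ (fun h => xi h j) (pderiv j f) _ (nbhs (T x))); last exact: cdf.
  apply/cvgrPdist_lt => e e0.
  have : \forall h \near (0:R)^', `|T x - p h| < e by apply: (@cvgr_dist_lt _ _ _ (0:R)^' _ p (T x) px e e0).
  apply: filterS2 near => h /xiP[H _] he; rewrite distrC.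
  by apply: le_lt_trans (H j) _; rewrite distrC.
have main : h^-1 *: (((f \o T) \o shift x) (h *: v) - (f \o T) x) @[h --> (0:R)^'] -->
    (\sum_j 'D_v (fun y => T y 0 j) x * pderiv j f (T x)).
  pose G h := \sum_j (h^-1 *: (((fun y => T y 0 j) \o shift x) (h *: v) - T x 0 j)) * pderiv j f (xi h j).
  have GE : {near (0:R)^', G =1 (fun h => h^-1 *: (((f \o T) \o shift x) (h *: v) - (f \o T) x))}.
    near=> h; have /xiP[_ E] : `|p h - T x| < d by near: h.
    rewrite /= -/(p h) E scaler_sumr; apply: eq_bigr => j _.
    by rewrite scalerAl.
  apply: cvg_trans (near_eq_cvg GE) _.
  apply: cvg_big_sum => j; apply: cvgM; last exact: xic.
  exact: dT.
apply: DeriveDef; first by apply/cvg_ex; eexists; exact: main.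
exact: (cvg_lim _ main).
Unshelve. all: by end_near. Qed.

End Chain.

(** * Closure properties of C^k functions, flat functions and bumps *)

Section SmoothCalculus.
Variables (R : realType).
Implicit Types n m : nat.

Lemma is_derive_of_line n (h : 'rV[R]_n -> R) x (v : 'rV[R]_n) (d : R) :
  is_derive (0 : R) 1 (fun s : R => h (x + s *: v)) d -> is_derive x v h d.
Proof.
move=> [D E].
have EE : (fun r : R => r^-1 *: (((fun s : R => h (x + s *: v)) \o shift 0) (r *: (1 : R)) -
           h (x + 0 *: v))) =
         (fun r : R => r^-1 *: ((h \o shift x) (r *: v) - h x)).
  apply/funext => r /=; rewrite -[r *: 1]/(r * 1) mulr1 addr0 scale0r addr0.
  by rewrite [x + _]addrC.
by apply: DeriveDef; [move: D; rewrite /derivable EE | move: E; rewrite /derive EE].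
Qed.

Lemma chain_rule1 n (e : R -> R) (f : 'rV[R]_n -> R) x (v : 'rV[R]_n) (d : R) :
  is_derive (f x) 1 e d -> derivable f x v -> is_derive x v (e \o f) (d * 'D_v f x).
Proof.
move=> de df; apply: is_derive_of_line.
apply: (@is_derive1_comp _ e (fun s => f (x + s *: v))).
  by rewrite scale0r addr0.
by have := @is_derive_line R n f x v 0; rewrite scale0r addr0; exact.
Qed.

Lemma Ck_cont n k U (f : 'rV[R]_n -> R) : Ck k U f -> forall x, U x -> {for x, continuous f}.
Proof. by case: k => [|k] []. Qed.

Lemma Ck_sub n k U V (f : 'rV[R]_n -> R) : V `<=` U -> Ck k U f -> Ck k V f.
Proof.
move=> VU; elim: k f => [|k IH] f [cf df]; first by split=> // x /VU; exact: cf.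
split=> [x /VU|i]; first exact: cf.
by have [di ki] := df i; split=> [x /VU|]; [exact: di|exact: IH].
Qed.

(** The sets [V] are arbitrary, not only open ones: [Ck] speaks of [f] itself near each point, not
    of a restriction. *)
Lemma Ck_local n k U (f : 'rV[R]_n -> R) :
  (forall x, U x -> exists2 V, V x & Ck k V f) -> Ck k U f.
Proof.
elim: k f => [|k IH] f H.
  by split=> // x /H[V Vx [cf _]]; exact: cf.
split=> [x /H[V Vx [cf _]]|i]; first exact: cf.
split=> [x /H[V Vx [_ /(_ i)[df _]]]|]; first exact: df.
by apply: IH => x /H[V Vx [_ /(_ i)[_ ?]]]; exists V.
Qed.

Lemma CkD n k U (f g : 'rV[R]_n -> R) : open U -> Ck k U f -> Ck k U g -> Ck k U (f + g).
Proof.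
move=> oU kf kg; rewrite -[g]opprK -[- g]sub0r; apply: CkB => //.
by apply: CkB => //; exact: (@Ck_cst _ _ _ _ 0).
Qed.

Lemma Ck_sum n k U (I : Type) (s : seq I) (F : I -> 'rV[R]_n -> R) : open U ->
  (forall i, Ck k U (F i)) -> Ck k U (fun x => \sum_(i <- s) F i x).
Proof.
move=> oU kF; elim: s => [|i s IH].
  by under eq_fun do rewrite big_nil; exact: Ck_cst.
by under eq_fun do rewrite big_cons; exact: CkD.
Qed.

Lemma Ck_prod n k U (I : Type) (s : seq I) (F : I -> 'rV[R]_n -> R) : open U ->
  (forall i, Ck k U (F i)) -> Ck k U (fun x => \prod_(i <- s) F i x).
Proof.
move=> oU kF; elim: s => [|i s IH].
  by under eq_fun do rewrite big_nil; exact: Ck_cst.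
by under eq_fun do rewrite big_cons; exact: CkM.
Qed.

Lemma is_derive_pderiv n (f : 'rV[R]_n -> R) x i d :
  is_derive x (delta_mx 0 i) f d -> pderiv i f x = d.
Proof. by case. Qed.

Lemma Ck_coord n k U (i : 'I_n) : open U -> Ck k U (fun y : 'rV[R]_n => y 0 i).
Proof.
move=> oU.
have D (x : 'rV[R]_n) j : is_derive x (delta_mx 0 j) (fun y : 'rV[R]_n => y 0 i) (i == j)%:R.
  apply: is_derive_of_line; under eq_fun do rewrite !mxE eqxx /=.
  have -> : (fun s : R => x 0 i + s * (i == j)%:R) = cst (x 0 i) + (i == j)%:R \*: id.
    by apply/funext => s /=; rewrite mulrC.
  by apply: is_derive_eq; rewrite add0r -[_ *: _]/(_ * _) mulr1.
case: k => [|k]; first by split=> // x _; exact: coord_continuous.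
split=> [x _|j]; first exact: coord_continuous.
split=> [x _|]; first by have [] := D x j.
apply: (@Ck_eq _ _ _ _ (fun=> (i == j)%:R)) => // [x _|]; last exact: Ck_cst.
by rewrite (is_derive_pderiv (D x j)).
Qed.

(** In the induction [T] stays fixed and [f] varies: a partial derivative of [f \o T] is a sum of
    derivatives of [T] times [pderiv j f \o T], and the latter falls under the induction
    hypothesis. *)
Lemma Ck_comp m n k U V (T : 'rV[R]_m -> 'rV[R]_n) (f : 'rV[R]_n -> R) :
  open U -> open V -> (forall x, U x -> V (T x)) ->
  (forall j, Ck k U (fun y => T y 0 j)) -> Ck k V f -> Ck k U (f \o T).
Proof.
move=> oU oV TUV; elim: k f => [|k IH] f kT kf.
all: have cT x : U x -> {for x, continuous T}
  by move=> Ux; apply: continuous_rv => j; exact: (Ck_cont (kT j)).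
all: have cfT x : U x -> {for x, continuous (f \o T)}
  by move=> Ux; apply: continuous_comp; [exact: cT|exact: Ck_cont kf _ (TUV _ Ux)].
all: split => // i.
have D x : U x -> is_derive x (delta_mx 0 i) (f \o T)
    (\sum_j pderiv i (fun y => T y 0 j) x * pderiv j f (T x)).
  move=> Ux; have [d d0 dV] := open_ballP oV (TUV _ Ux).
  apply: (chain_rule d0).
  - by move=> y /dV Vy j; have [_ /(_ j)[dj _]] := kf; exact: dj.
  - by move=> j; have [_ /(_ j)[_ kj]] := kf; exact: Ck_cont kj _ (TUV _ Ux).
  - exact: cT.
  - by move=> j; have [_ /(_ i)[di _]] := kT j; exact: di.
split=> [x /D[]//|].
apply: (@Ck_eq _ _ _ _ (fun x => \sum_j pderiv i (fun y => T y 0 j) x * pderiv j f (T x))) => //.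
  by move=> x Ux; rewrite (is_derive_pderiv (D x Ux)).
apply: Ck_sum => // j; apply: CkM => //.
  by have [_ /(_ i)[]] := kT j.
apply: IH; first by move=> l; exact: CkS.
by have [_ /(_ j)[]] := kf.
Qed.

(** The derivative [- f' / f ^+ 2] contains [1 / f] undifferentiated, so one more derivative of [f]
    gives one more of [1 / f]. *)
Lemma Ck_inv n k U (f : 'rV[R]_n -> R) : open U -> (forall x, U x -> f x != 0) ->
  Ck k U f -> Ck k U (fun x => (f x)^-1).
Proof.
move=> oU f0; elim: k => [|k IH] kf.
all: have cV x : U x -> {for x, continuous (fun x => (f x)^-1)}
  by move=> Ux; apply: continuousV; [exact: f0|exact: (Ck_cont kf)].
all: split => // i.
have [_ /(_ i)[di ki]] := kf.
split=> [x Ux|]; first by apply: derivableV; [exact: f0|exact: di].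
have kV := IH (CkS kf).
apply: (@Ck_eq _ _ _ _ ((fun=> -1) * ((fun x => (f x)^-1) * (fun x => (f x)^-1) * pderiv i f))) => //.
  move=> x Ux; rewrite [RHS]/pderiv deriveV; [|exact: f0|exact: di].
  rewrite -[_ *: _]/(_ * _) !mulrfctE mulN1r mulNr; congr (- (_ * _)).
  by rewrite expr2 invfM.
by apply: CkM => //; [exact: Ck_cst|apply: CkM => //; exact: CkM].
Qed.

Lemma smooth_pderiv n U (f : 'rV[R]_n -> R) i : smooth_on U f -> smooth_on U (pderiv i f).
Proof. by move=> sf k; have [_ /(_ i)[]] := sf k.+1. Qed.

(* [flat 0] is the usual flat function exp(-1/t); the family is closed under derivation. *)
Definition flat (m : nat) (t : R) : R :=
  if 0 < t then t^-1 ^+ m * expR (- t^-1) else 0.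

(** From exp s >= s^(m+2) / (m+2)! at [s = t^-1]. The exponent exceeds [m] by 2 to leave a factor
    [t ^+ 2], which makes the derivative at 0 vanish. *)
Lemma flat_le m (t : R) : `|flat m t| <= (m.+2)`!%:R * t ^+ 2.
Proof.
rewrite /flat; case: ifPn => t0; last by rewrite normr0 mulr_ge0 ?sqr_ge0.
have tV : 0 < t^-1 by rewrite invr_gt0.
rewrite ger0_norm; last by rewrite mulr_ge0 ?expR_ge0 ?exprn_ge0 ?ltW.
have f0 : 0 < (m.+2)`!%:R :> R by rewrite ltr0n fact_gt0.
have := @expR_ge1Dxn R t^-1 m.+1 (ltW tV).
set E := expR _ => h.
have E0 : 0 < E by exact: expR_gt0.
have {}h : t^-1 ^+ m.+2 <= (m.+2)`!%:R * E.
  rewrite mulrC -ler_pdivrMr //; apply: le_trans h; lra.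
rewrite expRN -/E.
have -> : (m.+2)`!%:R * t ^+ 2 = ((m.+2)`!%:R * E) * t^+2 * E^-1.
  by rewrite mulrAC mulrK // unitfE gt_eqF.
rewrite ler_pM2r ?invr_gt0 //.
rewrite (_ : t^-1 ^+ m = t^-1 ^+ m.+2 * t ^+ 2); last first.
  by rewrite -addn2 exprD -mulrA -exprMn mulVf ?gt_eqF // expr1n mulr1.
by rewrite ler_pM2r // exprn_gt0.
Qed.

Lemma flat_derive m (t : R) : is_derive t 1 (flat m) (flat m.+2 t - m%:R * flat m.+1 t).
Proof.
have [t0|t0|->] := ltgtP t 0.
- apply: (@near_eq_is_derive _ _ _ (cst 0)).
    near=> s; rewrite /flat ifF //; apply/negbTE; rewrite -leNgt; apply: ltW.
    by near: s; apply: open_nbhs_nbhs; split; [exact: open_lt|].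
  by rewrite /flat !(lt_gtF t0) mulr0 subr0; exact: is_derive_cst.
- apply: (@near_eq_is_derive _ _ _ ((fun s => s^-1) ^+ m * (expR \o (fun s => - s^-1)))).
    near=> s; rewrite /flat ifT //.
      by rewrite mulrfctE /= fctE.
    by near: s; apply: open_nbhs_nbhs; split; [exact: open_gt|].
  have dV : is_derive t 1 (fun s : R => s^-1) (- t ^- 2).
    have := @is_deriveV R id t 1 1 (lt0r_neq0 t0) (is_derive_id _ _).
    by rewrite -[_ *: _]/(_ * _) mulr1.
  have dE : is_derive t 1 (expR \o (fun s : R => - s^-1)) (expR (- t^-1) * t ^- 2).
    have dN : is_derive t 1 (fun s : R => - s^-1) (t ^- 2).
      by rewrite -[t ^- 2]opprK; exact: is_deriveN.
    exact: (@is_derive1_comp _ expR (fun s : R => - s^-1) t _ _ (is_derive_expR _) dN).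
  have dX := is_deriveX m dV.
  have [dM eM] := is_deriveM dX dE; apply: DeriveDef; first exact: dM.
  rewrite {}eM {dM}.
  rewrite /flat t0 -![_ *: _]/(_ * _) !fctE /=.
  rewrite -!exprVn !mulrA; case: m {dX} => [|m] /=; rewrite ?exprSr; ring.
- rewrite /flat ltxx mulr0 subr0.
  have main : h^-1 *: ((flat m \o shift 0) (h *: (1 : R)) - flat m 0) @[h --> (0:R)^'] --> (0 : R).
    apply: (@cvg_to_0_linear _ _ (m.+2)`!%:R 1) => // h /andP[h0 _].
    rewrite /= -[h *: 1]/(h * 1) mulr1 addr0 {2}/flat ltxx subr0 -[_ *: _]/(_ * _).
    rewrite normrM normfV mulrC ler_pdivrMr // -mulrA -expr2 real_normK ?num_real //.
    exact: flat_le.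
  apply: DeriveDef; first by apply/cvg_ex; eexists; exact: main.
  exact: (cvg_lim _ main).
Unshelve. all: by end_near. Qed.

Lemma flat_gt0 m (t : R) : 0 < t -> 0 < flat m t.
Proof. by move=> t0; rewrite /flat t0 mulr_gt0 ?expR_gt0 // exprn_gt0 // invr_gt0. Qed.

Lemma flat_ge0 m (t : R) : 0 <= flat m t.
Proof.
have [/flat_gt0/ltW//|t0] := ltP 0 t.
by rewrite /flat ltNge t0.
Qed.

Lemma flat_le0 m (t : R) : t <= 0 -> flat m t = 0.
Proof. by move=> t0; rewrite /flat ltNge t0. Qed.

Lemma flat_cont m : continuous (flat m).
Proof.
move=> t; apply: differentiable_continuous; apply/derivable1_diffP.
by have [] := flat_derive m t.
Qed.

Lemma Ck_flat n k m U (f : 'rV[R]_n -> R) : open U -> Ck k U f -> Ck k U (flat m \o f).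
Proof.
move=> oU; elim: k m => [|k IH] m kf.
all: have cf x : U x -> {for x, continuous (flat m \o f)}
  by move=> Ux; apply: continuous_comp; [exact: (Ck_cont kf)|exact: flat_cont].
all: split => // i.
have [_ /(_ i)[di ki]] := kf.
have D x (Ux : U x) := chain_rule1 (flat_derive m (f x)) (di x Ux).
split=> [x /D[]//|].
apply: (@Ck_eq _ _ _ _ ((flat m.+2 \o f - (fun=> m%:R) * (flat m.+1 \o f)) * pderiv i f)) => //.
  by move=> x Ux; rewrite (is_derive_pderiv (D x Ux)).
apply: CkM => //; apply: CkB => //; first exact: IH (CkS kf).
by apply: CkM => //; [exact: Ck_cst|exact: IH (CkS kf)].
Qed.

(** A smooth transition from 0 on [t <= 0] to 1 on [t >= 1]; the denominator is positive because [t]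
    and [1 - t] are never both nonpositive. *)
Definition step (t : R) : R := flat 0 t / (flat 0 t + flat 0 (1 - t)).

(* Each factor is 1 where [|x_i - c_i| <= r / sqrt 2] and 0 where [|x_i - c_i| >= r]; squaring
   keeps the argument smooth. *)
Definition bump n (c : 'rV[R]_n) (r : R) (x : 'rV[R]_n) : R :=
  \prod_(i < n) step ((r ^+ 2 - (x 0 i - c 0 i) ^+ 2) * 2 / r ^+ 2).

Lemma step_den_gt0 (t : R) : 0 < flat 0 t + flat 0 (1 - t).
Proof.
have [t0|t0] := ltP 0 t; first by rewrite ltr_wpDr ?flat_ge0 ?flat_gt0.
by rewrite ltr_wpDl ?flat_ge0 ?flat_gt0 //; lra.
Qed.

Lemma step_ge0 (t : R) : 0 <= step t.
Proof. by rewrite divr_ge0 ?flat_ge0 // ltW // step_den_gt0. Qed.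

Lemma step_eq1 (t : R) : 1 <= t -> step t = 1.
Proof.
move=> t1; rewrite /step [X in _ + X]flat_le0 ?addr0 ?divff //; last by lra.
by rewrite gt_eqF // flat_gt0 //; lra.
Qed.

Lemma step_eq0 (t : R) : t <= 0 -> step t = 0.
Proof. by move=> t0; rewrite /step flat_le0 // mul0r. Qed.

Lemma bump_smooth n (c : 'rV[R]_n) (r : R) U : open U -> smooth_on U (bump c r).
Proof.
move=> oU k; apply: Ck_prod => // i.
set f := (fun x : 'rV[R]_n => (r ^+ 2 - (x 0 i - c 0 i) ^+ 2) * 2 / r ^+ 2).
have kf : Ck k U f.
  have k1 : Ck k U ((fun x : 'rV[R]_n => x 0 i) - (fun=> c 0 i)).
    by apply: CkB => //; [exact: Ck_coord|exact: Ck_cst].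
  have := CkM oU (CkB oU (@Ck_cst _ _ k U (r ^+ 2) oU) (CkM oU k1 k1))
             (@Ck_cst _ _ k U (2 / r ^+ 2) oU).
  by apply: Ck_eq => // x _; rewrite /f /= expr2 mulrA.
apply: (@Ck_eq _ _ _ _ ((flat 0 \o f) * (fun x => (flat 0 (f x) + flat 0 (1 - f x))^-1))) => //.
apply: CkM => //; first exact: Ck_flat.
apply: Ck_inv => // [x _|]; first by rewrite gt_eqF // step_den_gt0.
apply: (@CkD _ _ _ (flat 0 \o f) (flat 0 \o ((fun=> 1) - f))) => //; first exact: Ck_flat.
by apply: Ck_flat => //; apply: CkB => //; exact: Ck_cst.
Qed.

Lemma bump_ge0 n (c : 'rV[R]_n) (r : R) x : 0 <= bump c r x.
Proof. by rewrite prodr_ge0 // => i _; exact: step_ge0. Qed.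

Lemma bump_eq1 n (c : 'rV[R]_n) (r : R) x : 0 < r -> `|x - c| <= r / 2 -> bump c r x = 1.
Proof.
move=> r0 xc; rewrite /bump big1 // => i _; apply: step_eq1.
rewrite ler_pdivlMr ?exprn_gt0 // mul1r.
have : `|x 0 i - c 0 i| <= r / 2.
  by have := le_trans (coord_le_norm (x - c) i) xc; rewrite !mxE.
rewrite ler_norml; set a := _ - _ => /andP[h1 h2]; nra.
Qed.

Lemma bump_eq0 n (c : 'rV[R]_n) (r : R) x : 0 < r -> r <= `|x - c| -> bump c r x = 0.
Proof.
move=> r0 xc; have [i ri] : exists i, r <= `|x 0 i - c 0 i|.
  apply: contrapT => H; suff : `|x - c| < r by rewrite ltNge xc.
  rewrite [ltLHS]mx_normrE; apply/bigmax_ltP; split => // -[i j] _ /=.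
  by rewrite (ord1 i) !mxE ltNge; apply/negP => h; apply: H; exists j.
rewrite /bump (bigD1 i) //= step_eq0 ?mul0r //.
rewrite pmulr_lle0 ?invr_gt0 ?exprn_gt0 // pmulr_lle0 // subr_le0.
rewrite -[leRHS]real_normK ?num_real // lerXn2r // nnegrE //.
exact: ltW.
Qed.

End SmoothCalculus.

(** * Integration in R^n *)

Section Integral1.
Variable R : realType.
Implicit Types (f g F G : R -> R) (L t : R).
Local Notation mu := (@lebesgue_measure R).

Definition int1 f : R := \int[mu]_t f t.

Lemma is_derive_contR f d t : is_derive t 1 f d -> {for t, continuous f}.
Proof. by move=> [D _]; apply: differentiable_continuous; apply/derivable1_diffP. Qed.

Lemma mvt_bound F f (M a b : R) : (forall t, is_derive t 1 F (f t)) ->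
  (forall t, Num.min a b <= t <= Num.max a b -> `|f t| <= M) -> `|F b - F a| <= M * `|b - a|.
Proof.
move=> dF.
have H x y : x <= y -> (forall t, x <= t <= y -> `|f t| <= M) -> `|F y - F x| <= M * `|y - x|.
  move=> xy fM.
  have cF : {within `[x, y], continuous F}.
    by apply: continuous_subspaceT => t; exact: is_derive_contR (dF t).
  have [c] := @MVT_segment _ F f x y xy (fun t _ => dF t) cF.
  by rewrite in_itv /= => /fM cM ->; rewrite normrM ler_wpM2r.
by have [ab|/ltW ba] := leP a b => fM; [|rewrite distrC [`|b - a|]distrC]; apply: H.
Qed.

Lemma compact_support_integrable f L : continuous f -> (forall t, L < `|t| -> f t = 0) ->
  mu.-integrable setT (EFin \o f).
Proof.
move=> cf f0.
have -> : EFin \o f = (EFin \o f) \_ `[- L, L].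
  apply/funext => t; rewrite patchE; case: ifPn => // /negP tL /=.
  rewrite f0 //; rewrite ltNge ler_norml; apply/negP => h; apply: tL.
  by rewrite inE /= in_itv.
have I : mu.-integrable `[- L, L] (EFin \o f).
  apply: continuous_compact_integrable; first exact: segment_compact.
  exact: continuous_subspaceT.
have mI : measurable (`[- L, L]%classic : set (measurableTypeR R)) by exact: measurable_itv.
have [H _] := @integrable_mkcond _ _ R mu `[- L, L]%classic (EFin \o f) mI.
exact: H I.
Qed.

(** Most later facts about [int1] (bounds, translation, scaling, strict positivity) are read off
    such a primitive instead of being derived from measure theory. *)
Lemma primitive_exists f L : continuous f -> (forall t, L < `|t| -> f t = 0) ->
  exists G, [/\ forall t, is_derive t 1 G (f t), forall t, t <= - L -> G t = 0 &
    forall t, L <= t -> G t = int1 f].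
Proof.
move=> cf f0; have fi := compact_support_integrable cf f0.
have ltrNr_norm s : s < - L -> L < `|s|.
  by rewrite ltrNr => /lt_le_trans; apply; rewrite -normrN ler_norm.
(* Vanishing is assumed only for [L < |t|]; continuity adds the endpoint, so [f] is zero on the
   whole closed half line. *)
have fL : f (- L) = 0.
  apply/eqP; apply: contrapT => /negP; rewrite -normr_gt0 => fLn.
  have /(@continuousP_rv _ R R)/(_ _ fLn)[d d0 H] := cf (- L).
  have := H (- L - d / 2); rewrite f0; last by apply: ltrNr_norm; lra.
  rewrite addrAC subrr sub0r !normrN gtr0_norm ?sub0r ?normrN ?ltxx; last by lra.
  by move=> h; have /h : d / 2 < d by lra.
have fiy (y : R) : mu.-integrable `]-oo, y] (EFin \o f).
  by apply: integrableS fi => //; exact: measurable_itv.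
exists (fun x => \int[mu]_(t in `]-oo, x]) f t); split.
- move=> t; have tu : t < t + 1 by rewrite ltrDl.
  have /(_ (ltNyr _) (cf t))[D E] := continuous_FTC1 tu (fiy _).
  by apply: DeriveDef; [exact: D|rewrite -derive1E E].
- move=> t tL; rewrite -(Rintegral_set0 mu f) Rintegral_mkcond [RHS]Rintegral_mkcond.
  apply: eq_Rintegral => s _; rewrite !patchE !in_set0.
  case: ifPn => //; rewrite inE /= in_itv /= => /le_trans/(_ tL).
  by rewrite le_eqVlt => /predU1P[->//|sL]; rewrite f0 // ltrNr_norm.
- move=> t Lt; rewrite /int1 Rintegral_mkcond; apply: eq_Rintegral => s _.
  rewrite patchE; case: ifPn => // /negP st; rewrite f0 //.
  apply: le_lt_trans Lt _; apply: lt_le_trans (ler_norm s).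
  rewrite ltNge; apply/negP => h; apply: st.
  by rewrite inE /= in_itv.
Qed.

Lemma int1_primitive f F L a b : continuous f -> (forall t, L < `|t| -> f t = 0) ->
  (forall t, is_derive t 1 F (f t)) -> a <= - L -> L <= b -> int1 f = F b - F a.
Proof.
move=> cf f0 dF aL Lb; have [G [dG G0 GL]] := primitive_exists cf f0.
have : F b - G b = F a - G a.
  apply: (@is_derive_0_is_cst _ (F - G)) => t.
  by rewrite -(subrr (f t)); exact: is_deriveB.
rewrite (G0 a) // (GL b) // => /eqP; rewrite subr0 subr_eq => /eqP ->.
by rewrite addrAC subrr add0r.
Qed.

Lemma int1_bound f L M : continuous f -> 0 <= L -> (forall t, L < `|t| -> f t = 0) ->
  (forall t, `|f t| <= M) -> `|int1 f| <= 2 * L * M.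
Proof.
move=> cf L0 f0 fM; have [G [dG G0 GL]] := primitive_exists cf f0.
rewrite -(GL L) // -[G L]subr0 -(G0 (- L)) //.
apply: le_trans (mvt_bound dG _) _; first by move=> t _; exact: fM.
rewrite opprK ger0_norm ?addr_ge0 // mulrC.
by rewrite -mulr2n mulr_natl.
Qed.

Lemma int1_lin f g c Lf Lg : continuous f -> (forall t, Lf < `|t| -> f t = 0) ->
  continuous g -> (forall t, Lg < `|t| -> g t = 0) ->
  int1 (fun t => f t + c * g t) = int1 f + c * int1 g.
Proof.
move=> cf f0 cg g0.
have fi := compact_support_integrable cf f0; have gi := compact_support_integrable cg g0.
have -> : int1 (fun t => f t + c * g t) = int1 f + int1 (fun t => c * g t).
  by rewrite /int1 RintegralD //; exact: (@integrableZl _ _ _ mu setT measurableT c (EFin \o g)).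
by rewrite /int1 RintegralZl.
Qed.

Lemma int1_shift f L s : continuous f -> (forall t, L < `|t| -> f t = 0) ->
  int1 (fun t => f (t + s)) = int1 f.
Proof.
move=> cf f0; have [G [dG G0 GL]] := primitive_exists cf f0.
have Ls : [/\ L <= `|L|, - L <= `|L|, s <= `|s| & - s <= `|s|].
  by split; rewrite ?ler_norm // -normrN ler_norm.
have [L1 L2 s1 s2] := Ls.
have cs : continuous (fun t => f (t + s)).
  move=> t; apply: (@continuous_comp _ _ _ (fun t => t + s) f); last exact: cf.
  by apply: cvgD; [exact: cvg_id|exact: cvg_cst].
have vs t : L + `|s| < `|t| -> f (t + s) = 0.
  by move=> h; rewrite f0 //; have := ler_normB (t + s) s; rewrite addrK; lra.
have ds t : is_derive t 1 (fun t => G (t + s)) (f (t + s)).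
  have d1 : is_derive t 1 (fun t : R => t + s) 1.
    by rewrite -[X in is_derive _ _ _ X]addr0; exact: is_deriveD.
  have := @is_derive1_comp _ G (fun t => t + s) t _ _ (dG _) d1.
  by rewrite mulr1.
have := @int1_primitive _ _ (L + `|s|) (- `|L| - `|s|) (`|L| + `|s|) cs vs ds.
by move=> ->; [rewrite GL ?G0 ?subr0 //; lra|lra|lra].
Qed.

(** A primitive is [a^-1 * G (a * t)]. For negative [a] the two ends are exchanged, and the
    resulting sign turns [a] into its absolute value. *)
Lemma int1_scale f L a : a != 0 -> continuous f -> (forall t, L < `|t| -> f t = 0) ->
  `|a| * int1 (fun t => f (a * t)) = int1 f.
Proof.
move=> a0 cf f0; have [G [dG G0 GL]] := primitive_exists cf f0.
have na : 0 < `|a| by rewrite normr_gt0.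
(* [b] is so large that [a * b] and [- (a * b)] lie beyond the support on either side; the added 1
   keeps it positive. *)
pose b := (`|L| + 1) / `|a|.
have b0 : 0 < b by rewrite divr_gt0 // ltr_wpDl.
have bL : L <= `|a| * b by rewrite /b mulrC divfK ?gt_eqF // ler_wpDr // ler_norm.
have bL' : - (`|a| * b) <= - L by rewrite lerN2.
have cs : continuous (fun t => f (a * t)).
  move=> t; apply: (@continuous_comp _ _ _ (fun t => a * t) f); last exact: cf.
  by apply: cvgM; [exact: cvg_cst|exact: cvg_id].
have vs t : `|L| / `|a| < `|t| -> f (a * t) = 0.
  rewrite ltr_pdivrMr // => h; rewrite f0 // normrM mulrC.
  exact: le_lt_trans (ler_norm _) h.
have ds t : is_derive t 1 (fun t => a^-1 * G (a * t)) (f (a * t)).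
  have dm : is_derive t 1 (fun t => a * t) a.
    by rewrite -[X in is_derive _ _ _ X]mulr1; exact: is_deriveZ.
  have dc := @is_derive1_comp _ G (fun t => a * t) t _ _ (dG _) dm.
  have -> : f (a * t) = a^-1 * (f (a * t) * a) by rewrite mulrCA mulVf ?mulr1.
  exact: is_deriveZ.
have := @int1_primitive _ _ (`|L| / `|a|) (- b) b cs vs ds.
have La : `|L| / `|a| <= b by rewrite ler_pM2r ?invr_gt0 // lerDl.
rewrite lerN2 => /(_ La La) ->.
case: (ltrgtP 0 a) => [a1|a1|/esym/eqP]; last by rewrite (negbTE a0).
  rewrite gtr0_norm // in bL bL' *.
  by rewrite mulrN (GL _ bL) (G0 _ bL') mulr0 subr0 mulrA divff // mul1r.
rewrite ltr0_norm // in bL bL' *.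
rewrite mulNr opprK in bL'; rewrite mulNr in bL.
by rewrite mulrN (G0 (a * b)) // GL // mulr0 sub0r mulrNN mulrA divff // mul1r.
Qed.

Lemma int1_ge0 f : (forall t, 0 <= f t) -> 0 <= int1 f.
Proof. by move=> f0; apply: Rintegral_ge0. Qed.

(** With integral 0 the monotone primitive would run from 0 to 0, hence be constant, and its
    derivative [f t0] would vanish. *)
Lemma int1_gt0 f L t0 : continuous f -> (forall t, L < `|t| -> f t = 0) ->
  (forall t, 0 <= f t) -> 0 < f t0 -> 0 < int1 f.
Proof.
move=> cf f0 fge ft0; rewrite lt_neqAle int1_ge0 // andbT; apply/eqP => I0.
have [G [dG G0 GL]] := primitive_exists cf f0.
have Gmono x y : x <= y -> G x <= G y.
  move=> xy.
  have cG : {within `[x, y], continuous G}.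
    by apply: continuous_subspaceT => t; exact: is_derive_contR (dG t).
  have [c _ E] := @MVT_segment _ G f x y xy (fun t _ => dG t) cG.
  by rewrite -subr_ge0 E mulr_ge0 // subr_ge0.
have Gz t : G t = 0.
  apply/eqP; rewrite eq_le; apply/andP; split.
    rewrite (le_trans (Gmono t (Num.max t L) _)) ?le_max ?lexx //.
    by rewrite GL ?le_max ?lexx ?orbT // -I0.
  rewrite (le_trans _ (Gmono (Num.min t (- L)) t _)) ?ge_min ?lexx //.
  by rewrite G0 ?ge_min ?lexx ?orbT.
have [_ E] := dG t0; move: ft0; rewrite -E.
have -> : G = cst 0 by apply/funext.
by rewrite derive_cst ltxx.
Qed.

Lemma is_derive_eps F (a d : R) :
  (forall e : R, 0 < e -> exists2 r : R, 0 < r & forall h, `|h| < r ->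
     `|F (a + h) - F a - h * d| <= e * `|h|) -> is_derive a 1 F d.
Proof.
move=> H.
have main : h^-1 *: ((F \o shift a) (h *: (1 : R)) - F a) @[h --> (0:R)^'] --> d.
  apply/cvgrPdist_le => e e0; have [r r0 hr] := H e e0.
  exists r => // h /=; rewrite sub0r normrN => /hr hh h0.
  rewrite -[h *: 1]/(h * 1) mulr1 [h + a]addrC -[_ *: _]/(_ * _).
  have nh : 0 < `|h| by rewrite normr_gt0.
  rewrite -(ler_pM2r nh) -normrM; apply: le_trans hh.
  have -> : (d - h^-1 * (F (a + h) - F a)) * h = - (F (a + h) - F a - h * d) by field.
  by rewrite normrN.
apply: DeriveDef; first by apply/cvg_ex; eexists; exact: main.
exact: (cvg_lim _ main).
Qed.

End Integral1.

(** * Iterated integrals: linearity, bounds and exchange of the first coordinate *)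

Section IntegralRn.
Variable R : realType.
Implicit Types (m n : nat) (L M e : R).

Definition vcons m (t : R) (y : 'rV[R]_m) : 'rV[R]_m.+1 := row_mx (t%:M : 'rV[R]_1) y.

Lemma vcons0 m t (y : 'rV[R]_m) : vcons t y 0 ord0 = t.
Proof.
have -> : (ord0 : 'I_m.+1) = lshift m (0 : 'I_1) by apply/val_inj.
by rewrite [LHS]row_mxEl mxE eqxx.
Qed.

Lemma vconsS m t (y : 'rV[R]_m) j : vcons t y 0 (lift ord0 j) = y 0 j.
Proof.
have -> : lift ord0 j = rshift 1 j :> 'I_m.+1 by apply/val_inj.
by rewrite [LHS]row_mxEr.
Qed.

Lemma vconsP m (P : 'rV[R]_m.+1 -> Prop) : (forall t y, P (vcons t y)) -> forall x, P x.
Proof.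
move=> H x; have -> : x = vcons (x 0 ord0) (\row_j x 0 (lift ord0 j)) by
  apply/rowP => i; case: (unliftP ord0 i) => [j|] ->; rewrite ?vcons0 ?vconsS ?mxE.
exact: H.
Qed.

Lemma vcons_sub m t s (y z : 'rV[R]_m) : vcons t y - vcons s z = vcons (t - s) (y - z).
Proof.
apply/rowP => i; rewrite [LHS]mxE [X in _ + X]mxE; case: (unliftP ord0 i) => [j|] ->.
  by rewrite !vconsS [RHS]mxE [X in _ = _ + X]mxE.
by rewrite !vcons0.
Qed.

Lemma vcons_add m t s (y z : 'rV[R]_m) : vcons t y + vcons s z = vcons (t + s) (y + z).
Proof.
apply/rowP => i; rewrite [LHS]mxE; case: (unliftP ord0 i) => [j|] ->.
  by rewrite !vconsS [RHS]mxE.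
by rewrite !vcons0.
Qed.

Lemma vcons_norm_le m t (y : 'rV[R]_m) (a : R) : `|t| <= a -> `|y| <= a -> `|vcons t y| <= a.
Proof.
move=> ta ya; apply: rv_norm_le => [|i]; first exact: le_trans ta.
by case: (unliftP ord0 i) => [j|] ->; rewrite ?vcons0 ?vconsS // (le_trans (coord_le_norm _ _)).
Qed.

Lemma vcons_norm_lt m t (y : 'rV[R]_m) (a : R) : `|t| < a -> `|y| < a -> `|vcons t y| < a.
Proof.
move=> ta ya; apply: le_lt_trans (vcons_norm_le _ _) (_ : Num.max `|t| `|y| < a).
- by rewrite le_max lexx.
- by rewrite le_max lexx orbT.
- by rewrite gt_max ta.
Qed.

Lemma vcons_norm_ge0 m t (y : 'rV[R]_m) : `|t| <= `|vcons t y|.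
Proof. by have := coord_le_norm (vcons t y) ord0; rewrite vcons0. Qed.

Lemma vcons_norm_geS m t (y : 'rV[R]_m) : `|y| <= `|vcons t y|.
Proof.
apply: rv_norm_le => // j; have := coord_le_norm (vcons t y) (lift ord0 j).
by rewrite vconsS.
Qed.

Lemma compact_ball_rv n (c : 'rV[R]_n) (r : R) : compact [set x | `|x - c| <= r].
Proof.
apply: bounded_closed_compact.
  exists (r + `|c|); split; first exact: num_real.
  move=> M rM x /= xr; apply: ltW; apply: le_lt_trans rM.
  by rewrite -[x in `|x|](subrK c) (le_trans (ler_normD _ _)) // lerD2r.
have -> : [set x : 'rV[R]_n | `|x - c| <= r] = (fun x => `|x - c|) @^-1` [set t | t <= r] by [].
have cN : continuous (fun x : 'rV[R]_n => `|x - c|).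
  move=> x; apply/(@continuousP_rv _ _ R) => e e0; exists e => // y; apply: le_lt_trans.
  by apply: le_trans (ler_dist_dist _ _) _; rewrite opprB addrA subrK.
apply: closed_comp; last exact: closed_le.
by move=> x _; exact: cN.
Qed.

Lemma compact_ucont n (K : set 'rV[R]_n) (f : 'rV[R]_n -> R) : compact K ->
  (forall x, K x -> {for x, continuous f}) -> forall e, 0 < e ->
  exists2 d : R, 0 < d & forall x y, K x -> `|y - x| < d -> `|f y - f x| < e.
Proof.
move=> /compact_near_coveringP cK cf e e0.
have : \forall d \near (0:R)^'+, K `<=` (fun x => forall y, `|y - x| < d -> `|f y - f x| < e).
  apply: cK => x Kx.
  have /(@continuousP_rv _ _ R)/(_ (e / 2))[|d d0 H] := cf x Kx; first by rewrite divr_gt0.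
  exists ([set x' | `|x' - x| < d / 2], [set r | r < d / 2]).
    split; last by apply: nbhs_right_lt; rewrite divr_gt0.
    apply/nbhs_ballP; exists (d / 2) => /=; first by rewrite divr_gt0.
    by move=> y; rewrite -ball_normE /= distrC.
  move=> [x' r] /= [x'x rd] y yx'.
  have h1 : `|f x' - f x| < e / 2 by apply: H; rewrite (lt_trans x'x) // ltr_pdivrMr // ltr_pMr // ltr1n.
  have h2 : `|f y - f x| < e / 2.
    apply: H; rewrite -[y - x](subrKA x') (le_lt_trans (ler_normD _ _)) //.
    rewrite [d]splitr ltrD // (lt_trans yx') //.
  rewrite -[f y - f x'](subrKA (f x)) (le_lt_trans (ler_normD _ _)) //.
  by rewrite [e]splitr ltrD // distrC.
move=> H; near (0:R)^'+ => d.
exists d; first by near: d; exact: nbhs_right_gt.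
have S : K `<=` (fun x => forall y, `|y - x| < d -> `|f y - f x| < e) by near: d.
by move=> x y Kx; exact: S.
Unshelve. all: by end_near. Qed.

Lemma compact_bounded_fun n (K : set 'rV[R]_n) (f : 'rV[R]_n -> R) : compact K ->
  (forall x, K x -> {for x, continuous f}) ->
  exists2 M : R, 0 < M & forall x, K x -> `|f x| <= M.
Proof.
move=> /compact_near_coveringP cK cf.
have : \forall M \near (pinfty_nbhs R), K `<=` (fun x => `|f x| <= M).
  apply: cK => x Kx.
  have /(@continuousP_rv _ _ R)/(_ 1)[//|d d0 H] := cf x Kx.
  exists ([set x' | `|x' - x| < d], [set M | `|f x| + 1 < M]).
    split; last by apply: nbhs_pinfty_gt; exact: num_real.
    apply/nbhs_ballP; exists d => //= y.
    by rewrite -ball_normE /= distrC.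
  move=> [x' M] /= [/H x'x hM]; apply: ltW; apply: lt_trans hM.
  by rewrite -[f x'](subrK (f x)) (le_lt_trans (ler_normD _ _)) // addrC ltrD2l.
move=> H; near (pinfty_nbhs R) => M.
exists M; first by near: M; apply: nbhs_pinfty_gt; exact: num_real.
have S : K `<=` (fun x => `|f x| <= M) by near: M.
by move=> x; exact: S.
Unshelve. all: by end_near. Qed.

Definition vanish n L (F : 'rV[R]_n -> R) := forall x, L < `|x| -> F x = 0.
Definition cc n (F : 'rV[R]_n -> R) := continuous F /\ exists2 L, 0 <= L & vanish L F.

Lemma cc_ucont n (F : 'rV[R]_n -> R) : cc F -> forall e, 0 < e ->
  exists2 d : R, 0 < d & forall x y, `|y - x| < d -> `|F y - F x| < e.
Proof.
move=> [cF [L L0 v]] e e0.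
have [d d0 H] := @compact_ucont n _ F (@compact_ball_rv n 0 L) (fun x _ => cF x) e e0.
exists d => // x y yx.
have [xL|xL] := leP `|x| L; first by apply: H => //=; rewrite subr0.
have [yL|yL] := leP `|y| L; first by rewrite distrC; apply: H; rewrite /= ?subr0 // distrC.
by rewrite !v // subrr normr0.
Qed.

Lemma cc_bounded n (F : 'rV[R]_n -> R) : cc F -> exists2 M : R, 0 < M & forall x, `|F x| <= M.
Proof.
move=> [cF [L L0 v]].
have [M M0 H] := @compact_bounded_fun n _ F (@compact_ball_rv n 0 L) (fun x _ => cF x).
exists M => // x; have [xL|xL] := leP `|x| L; first by apply: H; rewrite /= subr0.
by rewrite v // normr0 ltW.
Qed.

Lemma vanish_slice n L (F : 'rV[R]_n.+1 -> R) t : vanish L F -> vanish L (fun y => F (vcons t y)).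
Proof. by move=> v y h; apply: v; apply: lt_le_trans h (vcons_norm_geS _ _). Qed.

Lemma cc_slice n (F : 'rV[R]_n.+1 -> R) t : cc F -> cc (fun y => F (vcons t y)).
Proof.
move=> ccF; have [cF [L L0 v]] := ccF; split; last by exists L => //; exact: vanish_slice.
move=> y; apply/continuousP_rv => e e0; have [d d0 H] := cc_ucont ccF e0.
exists d => // z zy; apply: H; rewrite vcons_sub subrr.
by apply: vcons_norm_lt; rewrite // normr0.
Qed.

Lemma cc_lin n (F G : 'rV[R]_n -> R) c : cc F -> cc G -> cc (fun x => F x + c * G x).
Proof.
move=> [cF [L L0 v]] [cG [L' L0' v']]; split.
  move=> x; apply: (@continuousD _ R _ F (fun x => c * G x) x (cF x)).
  by apply: (@continuousM R _ (fun=> c) G x); [exact: cst_continuous|exact: cG].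
exists (Num.max L L'); first by rewrite le_max L0.
by move=> x; rewrite gt_max => /andP[/v-> /v'->]; rewrite mulr0 addr0.
Qed.

Lemma cc0 n : cc (fun _ : 'rV[R]_n => 0).
Proof. by split; [exact: cst_continuous|exists 0]. Qed.

Local Notation I := (@integral_Rn R _).

Lemma integral_RnS n (F : 'rV[R]_n.+1 -> R) :
  I F = int1 (fun t => I (fun y => F (vcons t y))).
Proof. by []. Qed.

(** Linearity and the size bound go through one induction: together they make the integrals of the
    slices of the next dimension continuous, and this continuity is required by the one-variable
    results. *)
Let I_spec n :=
  (forall (F G : 'rV[R]_n -> R) c, cc F -> cc G -> I (fun x => F x + c * G x) = I F + c * I G) /\
  (forall (F : 'rV[R]_n -> R) L M, 0 <= L -> continuous F -> vanish L F ->
     (forall x, `|F x| <= M) -> `|I F| <= (2 * L) ^+ n * M).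

Let slice_cont n (F : 'rV[R]_n.+1 -> R) : I_spec n -> cc F ->
  continuous (fun t => I (fun y => F (vcons t y))).
Proof.
move=> [lin bd] ccF t; have [cF [L L0 v]] := ccF.
apply/(@continuousP_rv R R R) => e e0.
(* The added 1 permits the division when [L = 0]. *)
have C0 : 0 < (2 * L) ^+ n + 1 by rewrite ltr_wpDl // exprn_ge0 // mulr_ge0.
have [d d0 H] := cc_ucont ccF (divr_gt0 e0 C0).
exists d => // s st.
have cl := cc_lin (- 1) (cc_slice s ccF) (cc_slice t ccF).
have := lin _ _ (- 1) (cc_slice s ccF) (cc_slice t ccF).
rewrite mulN1r => <-; apply: le_lt_trans (bd _ L (e / ((2 * L) ^+ n + 1)) L0 cl.1 _ _) _.
- by move=> y yL; rewrite !(vanish_slice _ v) // mulr0 addr0.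
- move=> y; rewrite mulN1r; apply: ltW; apply: H; rewrite vcons_sub subrr.
  by apply: vcons_norm_lt; rewrite // normr0.
- by rewrite mulrCA gtr_pMr // ltr_pdivrMr // mul1r ltrDl.
Qed.

Let slice_vanish n L (F : 'rV[R]_n.+1 -> R) : I_spec n -> vanish L F ->
  forall t, L < `|t| -> I (fun y => F (vcons t y)) = 0.
Proof.
move=> [lin _] v t Lt.
have -> : (fun y => F (vcons t y)) = (fun=> 0 + (-1) * 0).
  apply/funext => y; rewrite mulr0 addr0; apply: v.
  exact: lt_le_trans Lt (vcons_norm_ge0 _ _).
by rewrite (lin (fun=> 0) (fun=> 0)); [rewrite mulN1r subrr|exact: cc0..].
Qed.

Let I_specP n : I_spec n.
Proof.
elim: n => [|n IH].
  split=> [//|F L M L0 _ _ FM].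
  by rewrite expr0 mul1r; exact: FM.
split=> [F G c ccF ccG|F L M L0 cF v FM].
  rewrite !integral_RnS; have [cF [L L0 v]] := ccF; have [cG [L' L0' v']] := ccG.
  rewrite -(int1_lin c (slice_cont IH ccF) (slice_vanish IH v)
     (slice_cont IH ccG) (slice_vanish IH v')).
  by congr int1; apply/funext => t; rewrite -IH.1 //; exact: cc_slice.
have ccF : cc F by split => //; exists L.
rewrite integral_RnS exprS -mulrA.
apply: (int1_bound (slice_cont IH ccF) L0 (slice_vanish IH v)) => t.
apply: IH.2 => //; first by have [] := cc_slice t ccF.
exact: vanish_slice.
Qed.

Lemma cc_slice_cont n (F : 'rV[R]_n.+1 -> R) : cc F ->
  continuous (fun t => I (fun y => F (vcons t y))).
Proof. exact/slice_cont/I_specP. Qed.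

Lemma vanish_slice_int n L (F : 'rV[R]_n.+1 -> R) : vanish L F ->
  forall t, L < `|t| -> I (fun y => F (vcons t y)) = 0.
Proof. exact/slice_vanish/I_specP. Qed.

Lemma integral_lin n (F G : 'rV[R]_n -> R) c : cc F -> cc G ->
  I (fun x => F x + c * G x) = I F + c * I G.
Proof. by have [H _] := I_specP n; exact: H. Qed.

Lemma integral_bound n (F : 'rV[R]_n -> R) L M : 0 <= L -> continuous F -> vanish L F ->
  (forall x, `|F x| <= M) -> `|I F| <= (2 * L) ^+ n * M.
Proof. by have [_ H] := I_specP n; exact: H. Qed.

Lemma integral_dist n (F G : 'rV[R]_n -> R) L M : 0 <= L ->
  continuous F -> continuous G -> vanish L F -> vanish L G ->
  (forall x, `|F x - G x| <= M) -> `|I F - I G| <= (2 * L) ^+ n * M.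
Proof.
move=> L0 cF cG vF vG FG.
have ccF : cc F by split => //; exists L.
have ccG : cc G by split => //; exists L.
rewrite -[- I G]mulN1r -integral_lin //.
apply: integral_bound => //; first by have [] := cc_lin (-1) ccF ccG.
  by move=> x h; rewrite vF // vG // mulr0 addr0.
by move=> x; rewrite mulN1r.
Qed.

Lemma integral_0 n : I (fun _ : 'rV[R]_n => 0) = 0.
Proof.
have -> : (fun _ : 'rV[R]_n => 0) = (fun=> 0 + (-1) * 0) :> (_ -> R).
  by apply/funext => y; rewrite mulr0 addr0.
by rewrite (@integral_lin n (fun=> 0) (fun=> 0)); [rewrite mulN1r subrr|exact: cc0..].
Qed.

Lemma integral_Z n (F : 'rV[R]_n -> R) c : cc F -> I (fun x => c * F x) = c * I F.
Proof.
move=> ccF; have := integral_lin c (@cc0 n) ccF.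
by rewrite integral_0 add0r => <-; congr integral_Rn; apply/funext => x; rewrite add0r.
Qed.

Lemma integral_D n (F G : 'rV[R]_n -> R) : cc F -> cc G ->
  I (fun x => F x + G x) = I F + I G.
Proof.
move=> ccF ccG; rewrite -[I G]mul1r -integral_lin //.
by congr integral_Rn; apply/funext => x; rewrite mul1r.
Qed.

Lemma integral_ge0 n (F : 'rV[R]_n -> R) : (forall x, 0 <= F x) -> 0 <= I F.
Proof.
elim: n F => [|n IH] F F0; first exact: F0.
by rewrite integral_RnS; apply: int1_ge0 => t; exact: IH.
Qed.

Lemma integral_gt0 n (F : 'rV[R]_n -> R) x : cc F -> (forall x, 0 <= F x) -> 0 < F x -> 0 < I F.
Proof.
elim: n F x => [|n IH] F x ccF F0; first by rewrite (_ : x = 0) //; apply/rowP => -[].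
elim/vconsP: x => t y Fty.
have [cF [L L0 v]] := ccF.
rewrite integral_RnS; apply: (int1_gt0 (t0 := t) (cc_slice_cont ccF) (vanish_slice_int v)).
  by move=> s; exact: integral_ge0.
exact: IH (cc_slice t ccF) _ Fty.
Qed.

(* Fubini for the first coordinate against the others: [a |-> I (y |-> G y a)], with
   [G y] the primitive of [F(-, y)], is a primitive of [a |-> I F(a, -)]. *)
Section Swap.
Variables (n : nat) (F : 'rV[R]_n.+1 -> R).
Hypothesis ccF : cc F.

Lemma continuous_first (y : 'rV[R]_n) : continuous (fun s => F (vcons s y)).
Proof.
move=> s; apply/(@continuousP_rv R R R) => e e0; have [d d0 H] := cc_ucont ccF e0.
exists d => // t ts; apply: H; rewrite vcons_sub subrr.
by apply: vcons_norm_lt; rewrite // normr0.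
Qed.

Lemma vanish_first L (y : 'rV[R]_n) : vanish L F -> forall s, L < `|s| -> F (vcons s y) = 0.
Proof. by move=> v s h; apply: v; exact: lt_le_trans h (vcons_norm_ge0 _ _). Qed.

Let primitives : exists L, exists G : 'rV[R]_n -> R -> R, [/\ 0 <= L, vanish L F &
  forall y : 'rV[R]_n, [/\ forall t : R, is_derive t 1 (G y) (F (vcons t y)), forall t, t <= - L -> G y t = 0 &
    forall t, L <= t -> G y t = int1 (fun s => F (vcons s y))]].
Proof.
have [cF [L L0 v]] := ccF; exists L.
have /choice[G GP] : forall y : 'rV[R]_n, exists G : R -> R,
    [/\ forall t : R, is_derive t 1 G (F (vcons t y)), forall t, t <= - L -> G t = 0 &
    forall t, L <= t -> G t = int1 (fun s => F (vcons s y))].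
  by move=> y; apply: primitive_exists; [exact: continuous_first|exact: vanish_first].
by exists G; split.
Qed.

(** Continuity in [y]: the difference of two primitives vanishes at [- L] and its derivative is
    uniformly small. For [y] beyond the support the primitive is constant, hence equal to its value
    0 at [- L]. *)
Let primitive_cc L (G : 'rV[R]_n -> R -> R) : 0 <= L -> vanish L F ->
  (forall y : 'rV[R]_n, [/\ forall t : R, is_derive t 1 (G y) (F (vcons t y)), forall t, t <= - L -> G y t = 0 &
    forall t, L <= t -> G y t = int1 (fun s => F (vcons s y))]) ->
  forall a, continuous (fun y => G y a) /\ vanish L (fun y => G y a).
Proof.
move=> L0 v GP a; split.
  move=> y; apply/continuousP_rv => e e0.
  have C0 : 0 < `|a + L| + 1 by rewrite ltr_wpDl.
  have [d d0 H] := cc_ucont ccF (divr_gt0 e0 C0).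
  exists d => // z zy.
  have dD (t : R) : is_derive t 1 (fun s => G z s - G y s) (F (vcons t z) - F (vcons t y)).
    by have [dz _ _] := GP z; have [dy _ _] := GP y; exact: is_deriveB.
  have := @mvt_bound _ _ _ (e / (`|a + L| + 1)) (- L) a dD.
  have [_ zL _] := GP z; have [_ yL _] := GP y; rewrite (zL (- L)) // (yL (- L)) // subrr subr0 opprK => B.
  apply: le_lt_trans (B _) _; last by rewrite -mulrA gtr_pMr // mulrC ltr_pdivrMr // mul1r ltrDl.
  move=> t _; apply: ltW; apply: H; rewrite vcons_sub subrr.
  by apply: vcons_norm_lt; rewrite // normr0.
move=> y yL; have [dy GyL _] := GP y.
rewrite -(GyL (- L)) //; apply: is_derive_0_is_cst => t.
have <- : F (vcons t y) = 0 by apply: v; exact: lt_le_trans yL (vcons_norm_geS _ _).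
exact: dy.
Qed.

Lemma integral_swap : I (fun y => int1 (fun s => F (vcons s y))) =
  int1 (fun s => I (fun y => F (vcons s y))).
Proof.
have [L [G [L0 v GP]]] := primitives.
pose Phi a := I (fun y => G y a).
have ccG a : cc (fun y => G y a).
  by have [c vG] := primitive_cc L0 v GP a; split => //; exists L.
have dPhi (a : R) : is_derive a 1 Phi (I (fun y => F (vcons a y))).
  apply: is_derive_eps => e e0.
  have C0 : 0 < (2 * L) ^+ n + 1 by rewrite ltr_wpDl // exprn_ge0 // mulr_ge0.
  have [d d0 H] := cc_ucont ccF (divr_gt0 e0 C0).
  exists d => // h hd.
  have cl := cc_lin (-1) (ccG (a + h)) (ccG a).
  have E : Phi (a + h) - Phi a - h * I (fun y => F (vcons a y)) =
      I (fun y => (G y (a + h) + (-1) * G y a) + (- h) * F (vcons a y)).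
    rewrite integral_lin //; last exact: cc_slice.
    by rewrite integral_lin // mulN1r mulNr.
  rewrite {}E; apply: le_trans (integral_bound (L := L) (M := e / ((2 * L) ^+ n + 1) * `|h|) L0 _ _ _) _.
  - by have [] := cc_lin (- h) cl (cc_slice a ccF).
  - move=> y yL; have vG b : G y b = 0 by have [_] := primitive_cc L0 v GP b; apply.
    by rewrite !vG (vanish_slice _ v) // !mulr0 !addr0.
  - move=> y; have [dy _ _] := GP y.
    have dl (t : R) : is_derive t 1 (fun t : R => t * F (vcons a y)) (F (vcons a y)).
      have -> : (fun t : R => t * F (vcons a y)) = F (vcons a y) \*: (id : R -> R).
        by apply/funext => s /=; rewrite mulrC.
      by rewrite -[X in is_derive _ _ _ X]mulr1; exact: is_deriveZ.
    (* Subtracting the linear function leaves a derivative that is small near [a] uniformly in [y];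
       the mean value bound then controls the remainder before it is integrated. *)
    have dD (t : R) : is_derive t 1 (fun t => G y t - t * F (vcons a y)) (F (vcons t y) - F (vcons a y)).
      exact: is_deriveB.
    have := @mvt_bound _ _ _ (e / ((2 * L) ^+ n + 1)) a (a + h) dD.
    rewrite [a + h - a]addrAC subrr add0r => B.
    have -> : G y (a + h) + -1 * G y a + - h * F (vcons a y) =
      G y (a + h) - (a + h) * F (vcons a y) - (G y a - a * F (vcons a y)) by ring.
    apply: B => t /andP[t1 t2]; apply: ltW; apply: H; rewrite vcons_sub subrr.
    apply: vcons_norm_lt; rewrite ?normr0 //; apply: le_lt_trans hd.
    by move: t1 t2; rewrite ler_norml; case: (leP a (a + h)) => ?;
      case: (lerP 0 h) => [h0|h0]; rewrite ?(ger0_norm h0) ?(ltr0_norm h0); lra.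
  - rewrite mulrA ler_wpM2r // mulrCA ger_pMr // ler_pdivrMr // mul1r lerDl //.
have [cF _] := ccF.
rewrite (int1_primitive (cc_slice_cont ccF) (vanish_slice_int v) dPhi (lexx _) (lexx _)).
have -> : Phi (- L) = 0.
  rewrite /Phi -(integral_0 n); congr integral_Rn; apply/funext => y; have [_ + _] := GP y; exact.
by rewrite subr0; congr integral_Rn; apply/funext => y; have [_ _ /(_ L (lexx _)) <-] := GP y.
Qed.

End Swap.

End IntegralRn.

(** * Linear change of variables and vanishing integrals of derivatives *)

Section LinearChange.
Variable R : realType.
Implicit Types (m n : nat).
Local Notation I := (@integral_Rn R _).

Lemma mulmx_bound m n (A : 'M[R]_(m, n)) :
  exists2 K : R, 0 < K & forall x : 'rV[R]_m, `|x *m A| <= K * `|x|.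
Proof.
exists (\sum_i \sum_j `|A i j| + 1).
  by rewrite ltr_wpDl // sumr_ge0 // => i _; rewrite sumr_ge0.
move=> x; apply: rv_norm_le => [|j].
  by rewrite mulr_ge0 // addr_ge0 // sumr_ge0 // => i _; rewrite sumr_ge0.
rewrite mxE mulrDl mul1r; apply: (@le_trans _ _ (\sum_i \sum_j `|A i j| * `|x|)); last first.
  by rewrite ler_wpDr // le_eqVlt mulr_suml; apply/orP; left; apply/eqP;
     apply: eq_bigr => i _; rewrite mulr_suml.
apply: le_trans (ler_norm_sum _ _ _) _; apply: ler_sum => i _.
rewrite (bigD1 j) //= normrM mulrC; apply: ler_wpDr; last by rewrite ler_wpM2l // coord_le_norm.
by rewrite sumr_ge0 // => k _; rewrite mulr_ge0.
Qed.

(** The inequality makes [g] proper, so that the composite still vanishes outside a ball. *)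
Lemma cc_comp m n (g : 'rV[R]_m -> 'rV[R]_n) (F : 'rV[R]_n -> R) (a b : R) :
  continuous g -> 0 <= a -> 0 <= b -> (forall x, `|x| <= a * `|g x| + b) -> cc F -> cc (F \o g).
Proof.
move=> cg a0 b0 gx [cF [L L0 v]]; split.
  by move=> x; apply: continuous_comp; [exact: cg|exact: cF].
exists (a * L + b); first by rewrite addr_ge0 // mulr_ge0.
move=> x h; apply: v; rewrite ltNge; apply/negP => gL.
move: h; rewrite ltNge => /negP; apply.
by apply: le_trans (gx x) _; rewrite lerD2r ler_wpM2l.
Qed.

Lemma shift_continuous n (v : 'rV[R]_n) : continuous (fun x : 'rV[R]_n => x + v).
Proof.
move=> x; apply/continuousP_rv => e e0; exists e => // y.
by rewrite opprD addrACA subrr addr0.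
Qed.

Lemma cc_shift n (F : 'rV[R]_n -> R) v : cc F -> cc (fun x => F (x + v)).
Proof.
apply: (@cc_comp _ _ (fun x => x + v) F 1 `|v|) => //; first exact: shift_continuous.
by move=> x; rewrite mul1r -{1}(addrK v x) (le_trans (ler_normB _ _)).
Qed.

Lemma mulmx_continuous m n (A : 'M[R]_(m, n)) : continuous (fun x : 'rV[R]_m => x *m A).
Proof.
have [K K0 H] := mulmx_bound A.
move=> x; apply/continuousP_rv => e e0; exists (e / K); first exact: divr_gt0.
by move=> y; rewrite ltr_pdivlMr // mulrC -mulmxBl; apply: le_lt_trans.
Qed.

Lemma cc_mulmx n (A : 'M[R]_n) (F : 'rV[R]_n -> R) : \det A != 0 -> cc F -> cc (fun x => F (x *m A)).
Proof.
move=> dA; have [K K0 H] := mulmx_bound (invmx A).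
apply: (@cc_comp _ _ (fun x => x *m A) F K 0) => //; [exact: mulmx_continuous|exact: ltW|].
by move=> x; rewrite addr0; have := H (x *m A); rewrite mulmxK // unitmxE unitfE.
Qed.

Lemma integral_shift n (F : 'rV[R]_n -> R) v : cc F -> I (fun x => F (x + v)) = I F.
Proof.
elim: n F v => [|n IH] F v ccF.
  by congr (F _); apply/rowP => -[].
elim/vconsP: v => s w; rewrite !integral_RnS; have [cF [L L0 vF]] := ccF.
rewrite -(int1_shift s (cc_slice_cont ccF) (vanish_slice_int vF)).
congr int1; apply/funext => t; rewrite -(IH _ w (cc_slice _ ccF)).
by congr integral_Rn; apply/funext => y; rewrite vcons_add.
Qed.

(* The linear change of variables is proved by induction on the dimension: a matrix with nonzero
   pivot is a product of block triangular ones through its Schur complement. *)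
Definition change_ok n (A : 'M[R]_n) := forall F : 'rV[R]_n -> R, cc F ->
  `|\det A| * I (fun x => F (x *m A)) = I F.

Lemma change_ok_mul n (A B : 'M[R]_n) : \det B != 0 -> change_ok A -> change_ok B ->
  change_ok (A *m B).
Proof.
move=> dB hA hB F ccF; rewrite det_mulmx normrM -(hB F ccF) -(hA _ (cc_mulmx dB ccF)).
rewrite mulrCA mulrA; congr (_ * _).
by congr integral_Rn; apply/funext => x; rewrite mulmxA.
Qed.

Lemma vcons_mul_block n t (y : 'rV[R]_n) (a : 'M[R]_1) b c (D : 'M[R]_n) :
  vcons t y *m (block_mx a b c D : 'M[R]_(1 + n)) =
  vcons (t * a 0 0 + (y *m c) 0 0) (t *: b + y *m D).
Proof.
rewrite /vcons (@mul_row_block _ 1 1 n 1 n) mul_scalar_mx; congr row_mx.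
  by apply/rowP => i; rewrite (ord1 i) !mxE eqxx mulr1n.
by rewrite mul_scalar_mx.
Qed.

(** For a fixed first coordinate [t] the other coordinates undergo [S] and then the translation by
    [t *: b]; what remains is the scaling by [a] in one variable. *)
Lemma change_ok_upper n (a : 'M[R]_1) b (S : 'M[R]_n) : a 0 0 != 0 -> \det S != 0 ->
  change_ok S -> change_ok (block_mx a b 0 S : 'M[R]_(1 + n)).
Proof.
move=> a0 dS hS F ccF; have [cF [L L0 vF]] := ccF.
rewrite (det_ublock a) det_mx11 normrM -mulrA.
rewrite !integral_RnS -(int1_scale a0 (cc_slice_cont ccF) (vanish_slice_int vF)).
congr (_ * _).
have E t : `|\det S| * I (fun y => F (vcons t y *m (block_mx a b 0 S : 'M[R]_(1 + n)))) =
    I (fun y => F (vcons (a 0 0 * t) y)).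
  rewrite -(integral_shift (t *: b) (cc_slice _ ccF)) -(hS _ (cc_shift _ (cc_slice _ ccF))).
  congr (_ * _); congr integral_Rn; apply/funext => y.
  by rewrite vcons_mul_block mulmx0 mxE addr0 mulrC [_ + t *: b]addrC.
have dB : \det (block_mx a b 0 S : 'M[R]_(1 + n)) != 0.
  by rewrite (det_ublock a) det_mx11 mulf_neq0.
have [cG [L' L0' vG]] := cc_mulmx dB ccF.
(* The scalar factor enters the outer integral through [int1_lin] with the zero function as first
   summand. *)
rewrite -[LHS]add0r -[0](@integral_0 R n.+1) integral_RnS.
rewrite -(int1_lin _ (cc_slice_cont (@cc0 R n.+1)) (vanish_slice_int (fun x (_ : 0 < `|x|) => erefl))
   (cc_slice_cont (cc_mulmx dB ccF)) (vanish_slice_int vG)).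
by congr int1; apply/funext => t; rewrite E integral_0 add0r.
Qed.

(** This shear translates the first coordinate by an amount depending on the others, so the first
    coordinate must be integrated innermost, which [integral_swap] arranges on both sides. *)
Lemma change_ok_lower n (c : 'M[R]_(n, 1)) : change_ok (block_mx 1%:M 0 c 1%:M : 'M[R]_(1 + n)).
Proof.
move=> F ccF; have [cF [L L0 vF]] := ccF.
have dB : \det (block_mx 1%:M 0 c 1%:M : 'M[R]_(1 + n)) = 1.
  by rewrite (det_lblock (1%:M : 'M[R]_1)) !det1 mulr1.
have dB0 : \det (block_mx 1%:M 0 c 1%:M : 'M[R]_(1 + n)) != 0 by rewrite dB oner_neq0.
rewrite dB normr1 mul1r !integral_RnS.
rewrite -(integral_swap ccF) -(integral_swap (cc_mulmx dB0 ccF)).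
congr integral_Rn; apply/funext => y.
rewrite -(int1_shift ((y *m c) 0 0) (@continuous_first R n F ccF y) (vanish_first y vF)).
congr int1; apply/funext => t; rewrite vcons_mul_block mulmx1 scaler0 add0r.
by rewrite mxE eqxx mulr1.
Qed.

Lemma integral_mulmx n (A : 'M[R]_n) (F : 'rV[R]_n -> R) : \det A != 0 -> cc F ->
  `|\det A| * I (fun x => F (x *m A)) = I F.
Proof.
move=> dA ccF; move: F ccF; rewrite -/(change_ok A).
elim: n A dA => [|n IH] A dA.
  by move=> F _; rewrite det_mx00 normr1 mul1r; congr (F _); apply/rowP => -[].
have pivot (B : 'M[R]_(1 + n)) : \det B != 0 -> B 0 0 != 0 -> change_ok B.
  move=> dB B0.
  pose a := ulsubmx B; pose b := ursubmx B; pose c := dlsubmx B; pose D := drsubmx B.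
  have aE : a = (B 0 0)%:M.
    apply/matrixP => i j; rewrite (ord1 i) (ord1 j) !mxE eqxx mulr1n.
    by congr (B _ _); apply/val_inj.
  pose c' := (B 0 0)^-1 *: c; pose S := D - c' *m b.
  have BE : B = block_mx 1%:M 0 c' 1%:M *m block_mx a b 0 S.
    rewrite mulmx_block !mul1mx !mul0mx ?mulmx0 !addr0 -[LHS]submxK; congr block_mx.
      by rewrite aE mul_mx_scalar /c' scalerA divff // scale1r.
    by rewrite /S addrC subrK.
  have dBE : \det B = B 0 0 * \det S.
    rewrite {1}BE det_mulmx (det_lblock (1%:M : 'M[R]_1)) !det1 !mul1r (det_ublock a) aE.
    by rewrite det_scalar1.
  have dS : \det S != 0 by apply: contra_neq dB => h; rewrite dBE h mulr0.
  rewrite BE; apply: change_ok_mul.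
  - by rewrite (det_ublock a) aE det_scalar1 mulf_neq0.
  - exact: change_ok_lower.
  - by apply: change_ok_upper; [rewrite aE mxE eqxx mulr1n|exact: dS|exact: IH].
have [A0|A0] := eqVneq ((A : 'M[R]_(1 + n)) 0 0) 0; last exact: pivot.
have [i Ai] : exists i : 'I_n, (A : 'M[R]_(1 + n)) (rshift 1 i) 0 != 0.
  apply: contrapT => H; move/eqP: dA; apply.
  rewrite (expand_det_col (A : 'M[R]_(1 + n)) 0) big1 // => i _.
  suff -> : (A : 'M[R]_(1 + n)) i 0 = 0 by rewrite mul0r.
  case: (split_ordP i) => [j ->|j ->].
    by rewrite (ord1 j); rewrite (_ : lshift n 0 = 0) //; apply/val_inj.
  by apply: contrapT => /eqP h; apply: H; exists j.
(* Left multiplication by [E 1] adds to the first row a row whose first entry is nonzero and so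
   creates a nonzero pivot; [E (-1)] undoes it. *)
pose E (s : R) : 'M[R]_(1 + n) := block_mx 1%:M (s *: delta_mx 0 i) 0 1%:M.
have dE s : \det (E s) = 1 by rewrite (det_ublock (1%:M : 'M[R]_1)) !det1 mulr1.
have okE s : change_ok (E s).
  apply: change_ok_upper; first by rewrite mxE eqxx oner_neq0.
    by rewrite det1 oner_neq0.
  by move=> F _; rewrite det1 normr1 mul1r; congr integral_Rn; apply/funext => x; rewrite mulmx1.
have EE : E (-1) *m E 1 = 1%:M.
  rewrite /E mulmx_block ?mul1mx ?mulmx0 ?mul0mx ?addr0 ?add0r ?mulmx1.
  by rewrite scaleN1r scale1r subrr -scalar_mx_block.
have -> : A = E (-1) *m (E 1 *m (A : 'M[R]_(1 + n))) by rewrite mulmxA EE mul1mx.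
have dEA : \det (E 1 *m (A : 'M[R]_(1 + n))) != 0 by rewrite det_mulmx dE mul1r.
apply: change_ok_mul => //; apply: pivot => //.
rewrite -[A in _ *m A](@submxK _ 1 n 1 n) /E mulmx_block.
have -> : (0 : 'I_(1 + n)) = lshift n 0 by apply/val_inj.
rewrite block_mxEul mul1mx mxE scale1r -rowE !mxE.
have -> : lshift n (0 : 'I_1) = 0 by apply/val_inj.
by rewrite A0 add0r.
Qed.

Lemma vanish_pderiv n L (F : 'rV[R]_n -> R) i : vanish L F -> vanish L (pderiv i F).
Proof.
move=> v x Lx; rewrite /pderiv -(@derive_cst R _ R 0 x (delta_mx 0 i)).
apply: near_eq_derive; apply/nbhs_ballP; exists (`|x| - L) => /=; first by rewrite subr_gt0.
move=> y; rewrite -ball_normE /= => xy; apply: v.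
have := ler_dist_dist x y; rewrite ler_norml => /andP[_]; lra.
Qed.

(** Later coordinates are handled slice by slice by induction. For the first one the order of
    integration is exchanged, and the inner integral is that of the derivative of a function
    vanishing at both ends. *)
Lemma integral_pderiv n (F : 'rV[R]_n -> R) i : cc F ->
  (forall x, derivable F x (delta_mx 0 i)) -> continuous (pderiv i F) ->
  I (pderiv i F) = 0.
Proof.
elim: n F i => [|n IH] F i ccF dF cdF; first by case: i dF cdF.
have [cF [L L0 v]] := ccF.
have ccd : cc (pderiv i F) by split => //; exists L => //; exact: vanish_pderiv.
have [j|] := unliftP ord0 i => iE.
  rewrite -[RHS](@integral_0 R n.+1) !integral_RnS; congr int1; apply/funext => t.
  have L1 y (s : R) : vcons t y + s *: delta_mx 0 i = vcons t (y + s *: delta_mx 0 j).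
    apply/rowP => k; rewrite [LHS]mxE [X in _ + X]mxE deltaE iE.
    case: (unliftP ord0 k) => [l|] ->; rewrite ?vcons0 ?vconsS.
      by rewrite [RHS]mxE [X in _ = _ + X]mxE deltaE (inj_eq lift_inj).
    by rewrite eq_liftF mulr0 addr0.
  have D y : is_derive y (delta_mx 0 j) (fun y => F (vcons t y)) (pderiv i F (vcons t y)).
    apply: is_derive_of_line.
    have -> : (fun s : R => F (vcons t (y + s *: delta_mx 0 j))) =
      (fun s => F (vcons t y + s *: delta_mx 0 i)) by apply/funext => s; rewrite L1.
    by have := @is_derive_line R _ F (vcons t y) (delta_mx 0 i) 0; rewrite scale0r addr0; exact.
  have E : pderiv j (fun y => F (vcons t y)) = (fun y => pderiv i F (vcons t y)).
    by apply/funext => y; exact: is_derive_pderiv (D y).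
  rewrite integral_0 -E; apply: IH.
  - exact: cc_slice.
  - by move=> y; have [] := D y.
  - by rewrite E; have [] := cc_slice t ccd.
rewrite integral_RnS -(integral_swap ccd) -[RHS](@integral_0 R n); congr integral_Rn.
apply/funext => y.
have D (s : R) : is_derive s 1 (fun s : R => F (vcons s y)) (pderiv i F (vcons s y)).
  have L1 (r : R) : vcons r y = vcons 0 y + r *: delta_mx 0 i.
    apply/rowP => k; rewrite [RHS]mxE [X in _ = _ + X]mxE deltaE iE.
    case: (unliftP ord0 k) => [l|] ->; rewrite ?vcons0 ?vconsS ?eqxx ?mulr1 ?add0r //.
    by rewrite eq_sym eq_liftF mulr0 addr0.
  have -> : (fun s => F (vcons s y)) = (fun s : R => F (vcons 0 y + s *: delta_mx 0 i)).
    by apply/funext => r; rewrite L1.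
  by rewrite (L1 s); exact: (is_derive_line (dF _)).
have vd := @vanish_pderiv _ _ _ i v.
have := @int1_primitive R _ _ L (- L - 1) (L + 1) (@continuous_first R n _ ccd y) (vanish_first y vd) D.
move=> ->; [|lra|lra].
rewrite !(vanish_first y v) ?subrr //; last by rewrite ger0_norm; lra.
by rewrite -opprD normrN ger0_norm; lra.
Qed.

End LinearChange.

(** * Exchange of integrals over two blocks of coordinates *)

Section Fubini.
Variable R : realType.
Implicit Types (m n : nat).
Local Notation I := (@integral_Rn R _).

(** Continuous compactly supported functions on a product, in curried form; uniform continuity is
    built in because it is what makes slices and partial integrals continuous. *)
Definition ucc2 m n (H : 'rV[R]_m -> 'rV[R]_n -> R) :=
  (forall e : R, 0 < e -> exists2 d : R, 0 < d & forall x x' y y',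
     `|x' - x| < d -> `|y' - y| < d -> `|H x' y' - H x y| < e) /\
  exists2 L : R, 0 <= L & forall x y, L < `|x| \/ L < `|y| -> H x y = 0.

Lemma cc_Z n (F : 'rV[R]_n -> R) c : cc F -> cc (fun x => c * F x).
Proof.
move=> ccF; have := cc_lin c (@cc0 R n) ccF.
by congr cc; apply/funext => x; rewrite add0r.
Qed.

Lemma ucc2_sym m n (H : 'rV[R]_m -> 'rV[R]_n -> R) : ucc2 H -> ucc2 (fun y x => H x y).
Proof.
move=> [u [L L0 v]]; split; last by exists L => // y x h; apply: v; case: h; [right|left].
by move=> e /u[d d0 h]; exists d => // y y' x x' *; exact: h.
Qed.

Lemma row_mx_norm_le m n (x : 'rV[R]_m) (y : 'rV[R]_n) (a : R) : `|x| <= a -> `|y| <= a ->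
  `|row_mx x y| <= a.
Proof.
move=> xa ya; apply: rv_norm_le => [|i]; first exact: le_trans xa.
by case: (split_ordP i) => j ->; rewrite ?row_mxEl ?row_mxEr (le_trans (coord_le_norm _ _)).
Qed.

Lemma row_mx_norm_ge m n (x : 'rV[R]_m) (y : 'rV[R]_n) :
  `|x| <= `|row_mx x y| /\ `|y| <= `|row_mx x y|.
Proof.
split; apply: rv_norm_le => // j.
  by have := coord_le_norm (row_mx x y) (lshift n j); rewrite row_mxEl.
by have := coord_le_norm (row_mx x y) (rshift m j); rewrite row_mxEr.
Qed.

Lemma cc_ucc2 m n (G : 'rV[R]_(m + n) -> R) : cc G -> ucc2 (fun x y => G (row_mx x y)).
Proof.
move=> ccG; have [_ [L L0 v]] := ccG; split.
  move=> e e0; have [d d0 h] := cc_ucont ccG e0.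
  exists (d / 2) => [|x x' y y' hx hy]; first by rewrite divr_gt0.
  apply: h; rewrite opp_row_mx add_row_mx.
  by apply: le_lt_trans (row_mx_norm_le (ltW hx) (ltW hy)) _; rewrite ltr_pdivrMr // ltr_pMr // ltr1n.
exists L => // x y h; apply: v; have [h1 h2] := row_mx_norm_ge x y.
by case: h => h; [exact: lt_le_trans h1|exact: lt_le_trans h2].
Qed.

Lemma ucc2_slice m n (H : 'rV[R]_m -> 'rV[R]_n -> R) x : ucc2 H -> cc (H x).
Proof.
move=> [u [L L0 v]]; split; last by exists L => // y h; apply: v; right.
move=> y; apply/continuousP_rv => e /u[d d0 h]; exists d => // y' yy'.
by apply: h => //; rewrite subrr normr0.
Qed.

Lemma ucc2_int m n (H : 'rV[R]_m -> 'rV[R]_n -> R) : ucc2 H -> cc (fun x => I (H x)).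
Proof.
move=> uH; have [u [L L0 v]] := uH; split; last first.
  exists L => // x h; rewrite (_ : H x = fun=> 0) ?integral_0 //.
  by apply/funext => y; apply: v; left.
move=> x; apply/continuousP_rv => e e0.
have C0 : 0 < (2 * L) ^+ n + 1 by rewrite ltr_wpDl // exprn_ge0 // mulr_ge0.
have [d d0 h] := u _ (divr_gt0 e0 C0).
exists d => // x' xx'.
apply: le_lt_trans (integral_dist (L := L) (M := e / ((2 * L) ^+ n + 1)) L0 _ _ _ _ _) _.
- by have [] := ucc2_slice x' uH.
- by have [] := ucc2_slice x uH.
- by move=> y h'; apply: v; right.
- by move=> y h'; apply: v; right.
- by move=> y; apply: ltW; apply: h => //; rewrite subrr normr0.
- by rewrite mulrCA gtr_pMr // ltr_pdivrMr // mul1r ltrDl.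
Qed.

(** Induction on the coordinates of [x]: for each fixed first coordinate the remaining ones pass
    through [y] by the induction hypothesis, and the first one then crosses [y] by the
    one-coordinate exchange. *)
Lemma integral_swap2 m n (H : 'rV[R]_m -> 'rV[R]_n -> R) : ucc2 H ->
  I (fun x => I (H x)) = I (fun y => I (fun x => H x y)).
Proof.
elim: m H => [|m IH] H uH; first by [].
have [u [L L0 v]] := uH.
pose hd (z : 'rV[R]_n.+1) := z 0 ord0; pose tl (z : 'rV[R]_n.+1) := \row_j z 0 (lift ord0 j).
(* [K] joins the first coordinate of [x] and [y] in one vector, so that the integral over the
   remaining coordinates becomes a function on R^(n+1) to which [integral_swap] applies. *)
pose K (z : 'rV[R]_n.+1) (x : 'rV[R]_m) := H (vcons (hd z) x) (tl z).
have hdE t y : hd (vcons t y) = t by exact: vcons0.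
have tlE t y : tl (vcons t y) = y by apply/rowP => j; rewrite mxE vconsS.
have hd_sub z z' : `|hd z' - hd z| <= `|z' - z|.
  by have := coord_le_norm (z' - z) ord0; rewrite !mxE.
have tl_sub z z' : `|tl z' - tl z| <= `|z' - z|.
  apply: rv_norm_le => // j.
  by have := coord_le_norm (z' - z) (lift ord0 j); rewrite !mxE.
have uK : ucc2 K.
  split.
    move=> e /u[d d0 h]; exists d => // z z' x x' hz hx; apply: h.
      by rewrite vcons_sub; apply: vcons_norm_lt => //; exact: le_lt_trans hz.
    exact: le_lt_trans hz.
  exists L => // z x [h|h]; apply: v; last first.
    by left; apply: lt_le_trans h (vcons_norm_geS _ _).
  elim/vconsP: z h => t y h; rewrite hdE tlE.
  have [tL|tL] := leP `|t| L; last by left; apply: lt_le_trans tL (vcons_norm_ge0 _ _).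
  right; rewrite ltNge; apply/negP => yL; move: h.
  by rewrite ltNge => /negP; apply; exact: vcons_norm_le.
have uS t : ucc2 (fun x' => H (vcons t x')).
  split.
    move=> e /u[d d0 h]; exists d => // x x' y y' hx hy; apply: h => //.
    by rewrite vcons_sub subrr; apply: vcons_norm_lt; rewrite ?normr0.
  exists L => // x y [h|h]; apply: v; [left|by right].
  exact: lt_le_trans h (vcons_norm_geS _ _).
rewrite integral_RnS.
have -> : (fun t => I (fun x' => I (H (vcons t x')))) =
    (fun t => I (fun y => I (K (vcons t y)))).
  apply/funext => t; rewrite IH //; congr integral_Rn; apply/funext => y.
  by congr integral_Rn; apply/funext => x'; rewrite /K hdE tlE.
rewrite -(integral_swap (ucc2_int uK)); congr integral_Rn; apply/funext => y.
rewrite integral_RnS; congr int1; apply/funext => t; congr integral_Rn.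
by apply/funext => x'; rewrite /K hdE tlE.
Qed.

End Fubini.

(** * Retraction onto a closed ball *)

Section Clamp.
Variable R : realType.

Definition clamp1 (c r t : R) : R := Num.max (c - r) (Num.min (c + r) t).

Lemma clamp1_dist c r t : 0 < r -> `|clamp1 c r t - c| <= r.
Proof.
move=> r0; rewrite ler_norml /clamp1; case: (leP (c + r) t) => h.
  by case: (leP (c - r) (c + r)) => ?; lra.
by case: (leP (c - r) t) => ?; lra.
Qed.

Lemma clamp1_id c r t : 0 < r -> `|t - c| <= r -> clamp1 c r t = t.
Proof.
move=> r0; rewrite ler_norml /clamp1 => k; case: (leP (c + r) t) => h.
  by case: (leP (c - r) (c + r)) => ?; lra.
by case: (leP (c - r) t) => ?; lra.
Qed.

Lemma clamp1_interior c r t : 0 < r -> `|clamp1 c r t - c| < r -> clamp1 c r t = t.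
Proof.
move=> r0; rewrite ltr_norml /clamp1; case: (leP (c + r) t) => h.
  by case: (leP (c - r) (c + r)) => ?; lra.
by case: (leP (c - r) t) => ?; lra.
Qed.

Lemma clamp1_lip c r s t : 0 < r -> `|clamp1 c r s - clamp1 c r t| <= `|s - t|.
Proof.
move=> r0; wlog st : s t / s <= t.
  by move=> H; have [/H//|/ltW/H] := leP s t; rewrite distrC [`|t - s|]distrC.
rewrite distrC [`|s - t|]distrC [leRHS]ger0_norm ?subr_ge0 // ler_norml /clamp1.
have rr : c - r <= c + r by lra.
case: (leP (c + r) s) => h1; case: (leP (c + r) t) => h2; rewrite ?(max_r rr); try lra.
  by case: (leP (c - r) s) => h3; lra.
by case: (leP (c - r) s) => h3; case: (leP (c - r) t) => h4; lra.
Qed.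

Variables (n : nat) (c : 'rV[R]_n) (r : R).
Hypothesis r0 : 0 < r.

(** Continuous on the whole space and the identity on the closed ball; precomposing with it turns a
    map controlled only near [c] into a continuous total one. *)
Definition clamp (x : 'rV[R]_n) : 'rV[R]_n := \row_i clamp1 (c 0 i) r (x 0 i).

Lemma clamp_dist x : `|clamp x - c| <= r.
Proof.
apply: rv_norm_le => [|i]; first exact: ltW.
by rewrite !mxE; exact: clamp1_dist.
Qed.

Lemma clamp_id x : `|x - c| <= r -> clamp x = x.
Proof.
move=> h; apply/rowP => i; have := le_trans (coord_le_norm (x - c) i) h.
by rewrite !mxE; exact: clamp1_id.
Qed.

(** Whatever lies outside the ball is sent to its boundary, so a value in the open ball is its own
    only preimage. *)
Lemma clamp_interior x : `|clamp x - c| < r -> clamp x = x.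
Proof.
move=> h; apply/rowP => i; have := le_lt_trans (coord_le_norm (clamp x - c) i) h.
by rewrite !mxE; exact: clamp1_interior.
Qed.

Lemma clamp_cont : continuous clamp.
Proof.
move=> x; apply/continuousP_rv => e e0; exists e => // y; apply: le_lt_trans.
apply: rv_norm_le => // i; apply: (le_trans _ (coord_le_norm (y - x) i)); rewrite !mxE.
exact: clamp1_lip.
Qed.

End Clamp.

Lemma det_Ck (R : realType) n k U (A : 'rV[R]_n -> 'M[R]_n) : open U ->
  (forall i j, Ck k U (fun x => A x i j)) -> Ck k U (fun x => \det (A x)).
Proof.
move=> oU kA; rewrite /determinant; apply: Ck_sum => // s.
apply: (@CkM R n k U (fun=> (-1) ^+ perm.odd_perm s) _ oU); first exact: Ck_cst.
exact: Ck_prod.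
Qed.

(** * Change of variables *)

Section ChangeOfVariables.
Variables (R : realType) (n : nat).
Local Notation I := (@integral_Rn R _).
Local Notation rV := 'rV[R]_n.
Variables (U V : set rV) (T S : rV -> rV).
Hypotheses (oU : open U) (oV : open V).
Hypotheses (TUV : forall x, U x -> V (T x)) (SVU : forall y, V y -> U (S y)).
Hypotheses (TK : forall x, U x -> S (T x) = x) (SK : forall y, V y -> T (S y) = y).
Hypotheses (cT : forall j, Ck 1 U (fun x => T x 0 j)) (cS : forall j, Ck 1 V (fun y => S y 0 j)).

(** Row convention: row [i] holds the derivatives in direction [i], so the differential acts by
    [z *m jac W x] and the inner map comes first in the chain rule. *)
Let jac (W : rV -> rV) x : 'M[R]_n := \matrix_(i, j) pderiv i (fun y => W y 0 j) x.

Let jacM x : U x -> jac T x *m jac S (T x) = 1%:M.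
Proof.
move=> Ux; apply/matrixP => i k; rewrite !mxE.
have [d d0 dV] := open_ballP oV (TUV Ux).
have D : is_derive x (delta_mx 0 i) ((fun y => S y 0 k) \o T)
    (\sum_j 'D_(delta_mx 0 i) (fun y => T y 0 j) x * pderiv j (fun y => S y 0 k) (T x)).
  apply: (chain_rule d0).
  - by move=> y /dV Vy j; have [_ /(_ j)[dj _]] := cS k; exact: dj.
  - by move=> j; have [_ /(_ j)[_ [cj _]]] := cS k; exact: cj (TUV Ux).
  - by apply: continuous_rv => j; exact: Ck_cont (cT j) _ Ux.
  - by move=> j; have [_ /(_ i)[di _]] := cT j; exact: di.
under eq_bigr do rewrite !mxE.
have [_ <-] := D.
have -> : 'D_(delta_mx 0 i) ((fun y => S y 0 k) \o T) x = 'D_(delta_mx 0 i) (fun y : rV => y 0 k) x.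
  apply: near_eq_derive; apply: filterS (open_nbhs_nbhs (conj oU Ux)) => y Uy /=.
  by rewrite TK.
suff [_ ->] : is_derive x (delta_mx 0 i) (fun y : rV => y 0 k) (i == k)%:R by [].
apply: is_derive_of_line; under eq_fun do rewrite !mxE eqxx /=.
have -> : (fun s : R => x 0 k + s * (k == i)%:R) = cst (x 0 k) + (i == k)%:R \*: id.
  by apply/funext => s /=; rewrite mulrC eq_sym.
by apply: is_derive_eq; rewrite add0r -[_ *: _]/(_ * _) mulr1.
Qed.

Lemma cc_mulr (F g : rV -> R) : cc F -> continuous g -> cc (fun x => F x * g x).
Proof.
move=> [cF [L L0 v]] cg; split; last by exists L => // x /v ->; rewrite mul0r.
by move=> x; apply: (@continuousM R _ F g x); [exact: cF|exact: cg].
Qed.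

Lemma integral_affine (F : rV -> R) (w : rV) (a : R) : a != 0 -> cc F ->
  `|a| ^+ n * I (fun z => F (w + a *: z)) = I F.
Proof.
move=> a0 ccF; rewrite -(integral_shift w ccF).
have dA : \det (a%:M : 'M[R]_n) != 0 by rewrite det_scalar expf_neq0.
rewrite -(integral_mulmx dA (cc_shift w ccF)) det_scalar normrX; congr (_ * _).
by congr integral_Rn; apply/funext => z; rewrite mul_mx_scalar addrC.
Qed.

(* With [eta] a bump and [D d x y = F y * eta ((T x - y) / d) * |det DT x|], integrating
   [D d / d ^+ n] first in [y], respectively first in [x], and letting [d] tend to 0 gives
   [I eta] times the two sides of the formula.  [clamp] keeps the argument of [T]
   inside [U]. *)
Section Core.
Variables (y0 : rV) (rho r C : R).
Let x0 := S y0.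
Hypotheses (r0 : 0 < r) (C0 : 0 < C) (Crho : C * (2 * r) < rho).
Hypothesis BU : forall x, `|x - x0| <= rho -> U x.
Hypothesis BV : forall y, `|y - y0| <= 2 * r -> V y.
Hypothesis lipS : forall y y', `|y - y0| <= 2 * r -> `|y' - y0| <= 2 * r ->
  `|S y' - S y| <= C * `|y' - y|.
Hypothesis jacS_le : forall y (z : rV), `|y - y0| <= 2 * r -> `|z *m jac S y| <= C * `|z|.
Variable F : rV -> R.
Hypotheses (cF : continuous F) (vF : forall y, r < `|y - y0| -> F y = 0).

Let rho0 : 0 < rho. Proof. by apply: le_lt_trans Crho; rewrite !mulr_ge0 // ltW. Qed.

Let That x := T (clamp x0 rho x).
Let khat x := `|\det (jac T (clamp x0 rho x))|.
Let eta : rV -> R := bump 0 1.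
Let D (d : R) x y := F y * eta (d^-1 *: (That x - y)) * khat x.

Let B_y0 y : `|y - y0| <= r -> `|y - y0| <= 2 * r.
Proof. by have := r0; lra. Qed.

Let clampU x : U (clamp x0 rho x). Proof. exact/BU/clamp_dist. Qed.

Let That_cont : continuous That.
Proof.
move=> x; apply: (@continuous_comp _ _ _ (clamp x0 rho) T); first exact: clamp_cont.
by apply: continuous_rv => j; exact: (Ck_cont (cT j)).
Qed.

Let jac_cont x i j : U x -> {for x, continuous (fun x => jac T x i j)}.
Proof.
move=> Ux; rewrite (_ : (fun x => jac T x i j) = pderiv i (fun y => T y 0 j)).
  by have [_ /(_ i)[_ [c _]]] := cT j; exact: c.
by apply/funext => y; rewrite mxE.
Qed.

Let k_cont x : U x -> {for x, continuous (fun x => `|\det (jac T x)|)}.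
Proof.
move=> Ux; have : Ck 0 U (fun x => \det (jac T x)).
  by apply: det_Ck => // i j; split => // y; exact: jac_cont.
case=> cd _; apply: (@continuous_comp _ _ _ (fun x => \det (jac T x)) (fun t : R => `|t|)).
  exact: cd.
exact: norm_continuous.
Qed.

Let khat_cont : continuous khat.
Proof.
move=> x; apply: (@continuous_comp _ _ _ (clamp x0 rho) (fun x => `|\det (jac T x)|)).
  exact: clamp_cont.
exact: k_cont.
Qed.

Let khat_bounded : exists2 K : R, 0 < K & forall x, khat x <= K.
Proof.
have [K K0 h] := compact_bounded_fun (@compact_ball_rv R n x0 rho) (fun x h => k_cont (BU h)).
exists K => // x; have := h (clamp x0 rho x) (clamp_dist _ rho0 _).
by rewrite normr_id.
Qed.

Let ccF : cc F.
Proof.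
split => //; exists (`|y0| + r) => [|y h]; first by rewrite addr_ge0 // ltW.
by apply: vF; have := ler_distD y0 y 0; rewrite !subr0; lra.
Qed.

Let eta_cont : continuous eta.
Proof. by move=> x; have /(_ 0)[c _] := @bump_smooth R n 0 1 setT openT; exact: c. Qed.

Let eta_vanish : vanish 1 eta.
Proof. by move=> x h; rewrite /eta bump_eq0 // subr0 ltW. Qed.

Let cc_eta : cc eta. Proof. by split; [exact: eta_cont|exists 1]. Qed.

Let eta_int : 0 < I eta.
Proof.
apply: (@integral_gt0 R n eta 0 cc_eta) => [x|]; first exact: bump_ge0.
by rewrite /eta bump_eq1 // subrr normr0 divr_ge0.
Qed.

Let scale_cont (a : R) (f : rV -> rV) : continuous f -> continuous (fun x => a *: f x).
Proof.
move=> cf x; apply: (@continuous_comp _ _ _ f (fun z => a *: z)); first exact: cf.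
exact: scaler_continuous.
Qed.

(** The value of [T] at the clamped point lies within [r + d <= 2 * r] of [y0], so the Lipschitz map
    [S] brings it back strictly inside the ball of radius [rho]; by [clamp_interior] nothing was
    clamped. *)
Let locate d x y : d <= r -> `|y - y0| <= r -> `|That x - y| <= d ->
  [/\ clamp x0 rho x = x, `|x - S y| <= C * d & `|x - x0| <= rho].
Proof.
move=> dr yr xd; set p := clamp x0 rho x.
have Up : U p by exact: clampU.
have h1 : `|That x - y0| <= 2 * r.
  by apply: le_trans (ler_distD y _ _) _; rewrite mulr_natl mulr2n lerD // (le_trans xd).
have pE : p = S (That x) by rewrite /That TK.
have h2 : `|p - S y| <= C * d.
  by rewrite pE; apply: le_trans (lipS (B_y0 yr) h1) _; rewrite ler_pM2l.
have h3 : `|p - x0| < rho.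
  rewrite pE; apply: le_lt_trans Crho; apply: le_trans (lipS _ h1) _.
    by rewrite subrr normr0 mulr_ge0 // ltW.
  by rewrite ler_pM2l.
have px : p = x by exact: clamp_interior.
by rewrite -px {1}px; split => //; exact: ltW.
Qed.

Let D_neq0 d x y : 0 < d -> d <= r -> D d x y != 0 -> `|y - y0| <= r /\ `|That x - y| <= d.
Proof.
move=> d0 dr; rewrite /D !mulf_eq0 !negb_or => /andP[/andP[Fy ey] _]; split.
  by rewrite leNgt; apply/negP => /vF h; rewrite h eqxx in Fy.
rewrite leNgt; apply/negP => h; move: ey; rewrite eta_vanish ?eqxx //.
by rewrite normrZ normfV (gtr0_norm d0) mulrC ltr_pdivlMr // mul1r.
Qed.

Let L := `|x0| + rho + `|y0| + r.
Let L0 : 0 <= L. Proof. by rewrite !addr_ge0 // ltW. Qed.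

Let D_vanish d x y : 0 < d -> d <= r -> L < `|x| \/ L < `|y| -> D d x y = 0.
Proof.
move=> d0 dr h; apply: contrapT => /eqP /(D_neq0 d0 dr)[yr xd].
have [_ _ xr] := locate dr yr xd.
have := ler_distD x0 x 0; have := ler_distD y0 y 0; rewrite !subr0.
have := normr_ge0 x0; have := normr_ge0 y0; have := rho0.
by case: h; rewrite /L; lra.
Qed.

Let D_ucc2 d : 0 < d -> d <= r -> ucc2 (D d).
Proof.
move=> d0 dr.
pose G (z : 'rV[R]_(n + n)) := D d (lsubmx z) (rsubmx z).
have lc : continuous (fun z : 'rV[R]_(n + n) => lsubmx z).
  move=> z; apply/continuousP_rv => e e0; exists e => // z'; apply: le_lt_trans.
  by rewrite -linearB -[leRHS](congr1 Num.norm (hsubmxK (z' - z))); exact: (row_mx_norm_ge _ _).1.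
have rc : continuous (fun z : 'rV[R]_(n + n) => rsubmx z).
  move=> z; apply/continuousP_rv => e e0; exists e => // z'; apply: le_lt_trans.
  by rewrite -linearB -[leRHS](congr1 Num.norm (hsubmxK (z' - z))); exact: (row_mx_norm_ge _ _).2.
have ccG : cc G.
  split; last first.
    exists L => // z h; rewrite /G D_vanish //.
    have [lL|lL] := leP `|lsubmx z| L; last by left.
    right; rewrite ltNge; apply/negP => rL; move: h; rewrite ltNge => /negP; apply.
    by rewrite -[z]hsubmxK row_mx_norm_le.
  move=> z.
  have c1 : {for z, continuous (fun z => F (rsubmx z))}.
    by apply: (@continuous_comp _ _ _ (fun z => rsubmx z) F); [exact: rc|exact: cF].
  have c2 : {for z, continuous (fun z => khat (lsubmx z))}.
    by apply: (@continuous_comp _ _ _ (fun z => lsubmx z) khat); [exact: lc|exact: khat_cont].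
  have c3 : {for z, continuous (fun z => eta (d^-1 *: (That (lsubmx z) - rsubmx z)))}.
    apply: (@continuous_comp _ _ _ (fun z => d^-1 *: (That (lsubmx z) - rsubmx z)) eta);
      last exact: eta_cont.
    apply: (@continuous_comp _ _ _ (fun z => That (lsubmx z) - rsubmx z) (fun u : rV => d^-1 *: u));
      last exact: scaler_continuous.
    apply: (@continuousB _ _ _ (fun z => That (lsubmx z)) (fun z => rsubmx z)); last exact: rc.
    by apply: (@continuous_comp _ _ _ (fun z => lsubmx z) That); [exact: lc|exact: That_cont].
  by have := continuousM (continuousM c1 c3) c2.
have := cc_ucc2 ccG; congr ucc2; apply/funext => x; apply/funext => y.
by rewrite /G row_mxKl row_mxKr.
Qed.

(** After [y = That x - d *: z] the integrand is [F (That x - d *: z) * eta z] up to the factor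
    [khat x], and uniform continuity of [F] compares it with [F (That x) * eta z]. *)
Let inner_y (e : R) : 0 < e -> exists2 d0 : R, 0 < d0 & forall d x, 0 < d -> d < d0 ->
  `|I (D d x) - d ^+ n * (F (That x) * khat x * I eta)| <= d ^+ n * e.
Proof.
move=> e0; have [K K0 hK] := khat_bounded; have [E E0 hE] := cc_bounded cc_eta.
(* [K] bounds [khat], [E] bounds [eta], and [2 ^+ n] comes from the support of [eta] in the unit
   ball; with this tolerance for [F] the errors multiply to [e]. *)
have P0 : 0 < K * (2 ^+ n * E) by rewrite !mulr_gt0 // exprn_gt0.
have [d0 d00 h] := cc_ucont ccF (divr_gt0 e0 P0).
exists d0 => // d x dp dd0.
pose Phi y := F y * eta (d^-1 *: (That x - y)).
have cPhi : cc Phi.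
  apply: cc_mulr => //; move=> y.
  apply: (@continuous_comp _ _ _ (fun y : rV => d^-1 *: (That x - y)) eta); last exact: eta_cont.
  apply: (@scale_cont _ (fun y : rV => That x - y)) => y'.
  by apply: (@continuousB _ _ _ (fun=> That x) id); [exact: cst_continuous|exact: cvg_id].
have dn : - d != 0 by rewrite oppr_eq0 gt_eqF.
have -> : I (D d x) = d ^+ n * (khat x * I (fun z => F (That x - d *: z) * eta z)).
  have -> : D d x = (fun y => khat x * Phi y) by apply/funext => y; rewrite mulrC.
  rewrite integral_Z // -(integral_affine (That x) dn cPhi) normrN (gtr0_norm dp) mulrCA.
  congr (_ * (_ * _)); congr integral_Rn; apply/funext => z.
  rewrite /Phi scaleNr; congr (_ * eta _).
  by rewrite opprB addrC subrK scalerA mulVf ?scale1r // gt_eqF.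
rewrite -mulrBr normrM (ger0_norm (exprn_ge0 _ (ltW dp))) ler_wpM2l ?(exprn_ge0 _ (ltW dp)) //.
have -> : F (That x) * khat x * I eta = khat x * I (fun z => F (That x) * eta z).
  by rewrite integral_Z // mulrA [khat x * _]mulrC.
rewrite -mulrBr normrM (ger0_norm (normr_ge0 _)).
have B : `|I (fun z => F (That x - d *: z) * eta z) - I (fun z => F (That x) * eta z)| <=
    (2 * 1) ^+ n * (e / (K * (2 ^+ n * E)) * E).
  apply: integral_dist => //.
  - move=> z; apply: (@continuousM R _ (fun z : rV => F (That x - d *: z)) eta z); last exact: eta_cont.
    apply: (@continuous_comp _ _ _ (fun z : rV => That x - d *: z) F); last exact: cF.
    apply: (@continuousB _ _ _ (fun=> That x) (fun z : rV => d *: z)); first exact: cst_continuous.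
    exact: scaler_continuous.
  - move=> z; apply: (@continuousM R _ (fun=> F (That x)) eta z); last exact: eta_cont.
    exact: cst_continuous.
  - by move=> z hz; rewrite eta_vanish // mulr0.
  - by move=> z hz; rewrite eta_vanish // mulr0.
  - move=> z; rewrite -mulrBl normrM.
    have [z1|z1] := leP `|z| 1; last by rewrite eta_vanish // normr0 mulr0 ltW // mulr_gt0 // divr_gt0.
    apply: ler_pM => //; apply/ltW/h; rewrite addrAC subrr sub0r normrN normrZ (gtr0_norm dp).
    by apply: le_lt_trans dd0; rewrite ger_pMr.
have kx0 : 0 <= khat x by exact: normr_ge0.
apply: le_trans (ler_pM kx0 (normr_ge0 _) (hK x) B) _.
rewrite mulr1 le_eqVlt; apply/orP; left; apply/eqP.
have n1 : 2 ^+ n != 0 :> R by rewrite expf_neq0 // pnatr_eq0.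
by field; rewrite n1 !gt_eqF.
Qed.

Let jac_ucont (e : R) : 0 < e -> exists2 d : R, 0 < d & forall x x', `|x - x0| <= rho ->
  `|x' - x| < d -> forall i j, `|jac T x' i j - jac T x i j| < e.
Proof.
move=> e0.
have /choice[d dP] : forall ij : 'I_n * 'I_n, exists d : R, 0 < d /\
    forall x x', `|x - x0| <= rho -> `|x' - x| < d -> `|jac T x' ij.1 ij.2 - jac T x ij.1 ij.2| < e.
  move=> [i j]; have [d d0 h] := compact_ucont (@compact_ball_rv R n x0 rho)
    (fun x h => @jac_cont x i j (BU h)) e0.
  by exists d; split.
exists (\big[Order.min/1]_ij d ij).
  by apply/bigmin_gtP; split => // ij _; exact: (dP ij).1.
by move=> x x' xr /bigmin_gtP[_ h] i j; apply: (dP (i, j)).2 => //; exact: h.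
Qed.

(** After [x = S y + d *: z] the argument of [eta] tends to [z *m J], with [J] the Jacobian matrix
    of [T] at [S y], and the linear change of variables identifies the integral of
    [|det J| * eta (z *m J)] with that of [eta]. *)
Let inner_x (e : R) : 0 < e -> exists2 d0 : R, 0 < d0 & forall d y, 0 < d -> d <= r -> d < d0 ->
  `|I (fun x => D d x y) - d ^+ n * (F y * I eta)| <= d ^+ n * e.
Proof.
move=> e0; have [K K0 hK] := khat_bounded; have [E E0 hE] := cc_bounded cc_eta.
have [MF MF0 hF] := cc_bounded ccF.
have P0 : 0 < MF * (2 * C) ^+ n by rewrite !mulr_gt0 // exprn_gt0 // mulr_gt0.
(* Two errors of size [e1] will arise, from [eta] and from the determinant, over a ball of radius
   [C] and multiplied by the bound [MF] of [F]. *)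
pose e1 := e / (MF * (2 * C) ^+ n) / 2.
have e10 : 0 < e1 by rewrite !divr_gt0.
have [d1 d10 h1] := cc_ucont cc_eta (divr_gt0 e10 K0).
have N0 : 0 < n%:R * C + 1 by rewrite ltr_wpDl // mulr_ge0 // ltW.
have [d2 d20 h2] := jac_ucont (divr_gt0 d10 N0).
have [d3 d30 h3] := compact_ucont (@compact_ball_rv R n x0 rho) (fun x h => k_cont (BU h))
  (divr_gt0 e10 E0).
exists (Num.min d2 d3 / C) => [|d y dp dr]; first by rewrite divr_gt0 // lt_min d20.
rewrite ltr_pdivlMr // lt_min => /andP[dd2 dd3].
have [yr|yr] := leP `|y - y0| r; last first.
  have -> : (fun x => D d x y) = (fun=> 0) by apply/funext => x; rewrite /D vF // !mul0r.
  by rewrite integral_0 vF // mul0r mulr0 subrr normr0 mulr_ge0 ?exprn_ge0 // ltW.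
set w := S y; have yr2 := B_y0 yr.
have wx0 : `|w - x0| <= C * r.
  apply: le_trans (lipS _ yr2) _; first by rewrite subrr normr0 mulr_ge0 // ltW.
  by rewrite ler_pM2l.
have wr : `|w - x0| <= rho.
  by have := mulr_gt0 C0 r0; have := Crho; move: wx0; lra.
have Uw : U w by exact: BU.
have Vy : V y by exact: BV.
have Tw : T w = y by rewrite /w SK.
set J := jac T w.
have JS : J *m jac S y = 1%:M by rewrite -Tw; exact: jacM.
have dJ : \det J != 0.
  by apply/eqP => h; have := congr1 determinant JS; rewrite det_mulmx h mul0r det1 => /eqP;
     rewrite eq_sym oner_eq0.
pose Psi x := eta (d^-1 *: (That x - y)) * khat x.
have PsiC : continuous Psi.
  move=> x; apply: (@continuousM R _ (fun x => eta (d^-1 *: (That x - y))) khat x); last exact: khat_cont.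
  apply: (@continuous_comp _ _ _ (fun x => d^-1 *: (That x - y)) eta); last exact: eta_cont.
  apply: (@scale_cont _ (fun x => That x - y)) => x'.
  by apply: (@continuousB _ _ _ That (fun=> y)); [exact: That_cont|exact: cst_continuous].
have Psi_neq0 x : Psi x != 0 -> `|That x - y| <= d.
  rewrite mulf_eq0 negb_or => /andP[ey _].
  rewrite leNgt; apply/negP => h; move: ey; rewrite eta_vanish ?eqxx //.
  by rewrite normrZ normfV (gtr0_norm dp) mulrC ltr_pdivlMr // mul1r.
have ccPsi : cc Psi.
  split => //; exists (`|x0| + rho) => [|x h]; first by rewrite addr_ge0 // ltW.
  apply: contrapT => /eqP/Psi_neq0 xd; have [_ _ xr] := locate dr yr xd.
  by have := ler_distD x0 x 0; rewrite !subr0; lra.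
have -> : I (fun x => D d x y) = F y * I Psi.
  by rewrite -integral_Z //; congr integral_Rn; apply/funext => x; rewrite /D /Psi mulrA.
have dn : d != 0 by rewrite gt_eqF.
rewrite -(integral_affine w dn ccPsi) (gtr0_norm dp) mulrCA.
rewrite -mulrBr normrM (ger0_norm (exprn_ge0 _ (ltW dp))) ler_wpM2l ?(exprn_ge0 _ (ltW dp)) //.
rewrite -mulrBr normrM.
have -> : I eta = I (fun z => `|\det J| * eta (z *m J)).
  by rewrite integral_Z ?integral_mulmx //; exact: cc_mulmx.
have B : `|I (fun z => Psi (w + d *: z)) - I (fun z => `|\det J| * eta (z *m J))| <=
    (2 * C) ^+ n * (e1 + e1).
  apply: integral_dist; first exact: ltW.
  - move=> z; apply: (@continuous_comp _ _ _ (fun z : rV => w + d *: z) Psi); last exact: PsiC.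
    apply: (@continuousD _ _ _ (fun=> w) (fun z : rV => d *: z)); first exact: cst_continuous.
    exact: scaler_continuous.
  - by have [] := cc_Z `|\det J| (cc_mulmx dJ cc_eta).
  - move=> z Cz; apply: contrapT => /eqP/Psi_neq0 xd; have [_ h _] := locate dr yr xd.
    move: h; rewrite addrAC subrr add0r normrZ (gtr0_norm dp) mulrC ler_pM2r //.
    by rewrite leNgt Cz.
  - move=> z Cz; rewrite eta_vanish ?mulr0 // ltNge; apply/negP => z1.
    move: Cz; rewrite ltNge => /negP; apply.
    rewrite -[z]mulmx1 -JS mulmxA; apply: le_trans (jacS_le _ yr2) _.
    by rewrite ger_pMr.
  - move=> z; have [zC|zC] := leP `|z| C; last first.
      have -> : Psi (w + d *: z) = 0.
        apply: contrapT => /eqP/Psi_neq0 xd; have [_ h _] := locate dr yr xd.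
        move: h; rewrite addrAC subrr add0r normrZ (gtr0_norm dp) mulrC ler_pM2r //.
        by rewrite leNgt zC.
      rewrite eta_vanish ?mulr0 ?subrr ?normr0 ?addr_ge0 ?ltW // ltNge; apply/negP => z1.
      move: zC; rewrite ltNge => /negP; apply.
      rewrite -[z]mulmx1 -JS mulmxA; apply: le_trans (jacS_le _ yr2) _.
      by rewrite ger_pMr.
    set x := w + d *: z.
    have xw : `|x - w| <= d * C.
      by rewrite /x addrAC subrr add0r normrZ (gtr0_norm dp) ler_pM2l.
    have xr : `|x - x0| <= rho.
      apply: le_trans (ler_distD w _ _) _; apply: le_trans (ltW Crho).
      rewrite mulr_natl mulr2n mulrDr lerD //; apply: le_trans xw _.
      by rewrite mulrC ler_pM2l.
    have cx : clamp x0 rho x = x by exact: clamp_id.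
    have TE : That x = T x by rewrite /That cx.
    have kE : khat x = `|\det (jac T x)| by rewrite /khat cx.
    (* Each of the [n] terms of the mean value expansion is off by the variation of a Jacobian
       entry, below [d1 / (n C + 1)], times a coordinate of [z], which is at most [C]. *)
    have A1 : `|d^-1 *: (T x - y) - z *m J| < d1.
      apply: (@le_lt_trans _ _ (n%:R * C * (d1 / (n%:R * C + 1)))); last first.
        by rewrite mulrCA gtr_pMr // ltr_pdivrMr // mul1r ltrDl.
      apply: rv_norm_le => [|j].
        by rewrite !mulr_ge0 ?invr_ge0 // ?addr_ge0 ?mulr_ge0 // ltW.
      have [|xi B E'] := @mean_value R n (fun y => T y 0 j) w x.
        move=> v /inbox_ball/(_ wr xr)/BU Uv i.
        by have [_ /(_ i)[di _]] := cT j; exact: di.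
      rewrite !mxE -{1}Tw E' mulr_sumr -sumrB.
      apply: le_trans (ler_norm_sum _ _ _) _.
      rewrite -mulrA -[X in X%:R * _]card_ord mulr_natl -sumr_const; apply: ler_sum => i _.
      have -> : x 0 i - w 0 i = d * z 0 i by rewrite /x !mxE addrAC subrr add0r.
      rewrite -mulrA mulKf // -mulrBr normrM.
      apply: ler_pM => //; first exact: le_trans (coord_le_norm _ _) zC.
      have := h2 w (xi i) wr (le_lt_trans (le_trans (inbox_dist (B i)) xw) dd2) i j.
      by rewrite !mxE => /ltW.
    have A2 := h1 _ _ A1.
    have A3 : `| `|\det (jac T x)| - `|\det J| | < e1 / E.
      by apply: h3 => //; exact: le_lt_trans xw dd3.
    rewrite /Psi TE kE.
    have -> : eta (d^-1 *: (T x - y)) * `|\det (jac T x)| - `|\det J| * eta (z *m J) =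
      (eta (d^-1 *: (T x - y)) - eta (z *m J)) * `|\det (jac T x)| +
      eta (z *m J) * (`|\det (jac T x)| - `|\det J|) by ring.
    apply: le_trans (ler_normD _ _) _; rewrite !normrM normr_id; apply: lerD.
      rewrite -[leRHS](divfK (lt0r_neq0 K0)); apply: ler_pM => //; first exact: ltW.
      by rewrite -kE.
    rewrite mulrC -[leRHS](divfK (lt0r_neq0 E0)); apply: ler_pM => //; exact: ltW.
apply: le_trans (ler_pM (normr_ge0 _) (normr_ge0 _) (hF y) B) _.
rewrite -splitr mulrA le_eqVlt; apply/orP; left; apply/eqP.
have Q0 : 0 < (2 * C) ^+ n by rewrite exprn_gt0 // mulr_gt0.
by move: ((2 * C) ^+ n) Q0 => Q Q0; field; rewrite !gt_eqF.
Qed.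

Let ThatK x : `|That x - That x| <= r. Proof. by rewrite subrr normr0 ltW. Qed.

Lemma change_of_variables_core :
  I (fun x => if x \in U then F (T x) * `|jacobian_det T x| else 0) = I F.
Proof.
(* The clamped map and determinant agree with the original ones wherever either integrand is
   nonzero, so the globally continuous integrand may be used. *)
have -> : (fun x => if x \in U then F (T x) * `|jacobian_det T x| else 0) =
    (fun x => F (That x) * khat x).
  apply/funext => x; have [Fx|Fx] := eqVneq (F (That x)) 0; last first.
    have xr : `|That x - y0| <= r by rewrite leNgt; apply/negP => /vF h; rewrite h eqxx in Fx.
    have [cx _ xB] := locate (lexx r) xr (ThatK x).
    by rewrite (mem_set (BU xB)) /That /khat cx.
  rewrite Fx mul0r; case: ifPn => // /set_mem Ux.
  have [->|FT] := eqVneq (F (T x)) 0; first by rewrite mul0r.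
  have xr : `|T x - y0| <= r by rewrite leNgt; apply/negP => /vF h; rewrite h eqxx in FT.
  have xB : `|x - x0| <= rho.
    rewrite -[x]TK //; apply: le_trans (lipS _ (B_y0 xr)) _.
      by rewrite subrr normr0 mulr_ge0 // ltW.
    by apply: le_trans (ltW Crho); rewrite ler_pM2l //; exact: B_y0.
  by move: FT; rewrite -[x in T x](clamp_id rho0 xB) Fx eqxx.
have ccFT : cc (fun x => F (That x) * khat x).
  split.
    move=> x; apply: (@continuousM R _ (fun x => F (That x)) khat x); last exact: khat_cont.
    by apply: (@continuous_comp _ _ _ That F); [exact: That_cont|exact: cF].
  exists L => // x h; have [->|Fx] := eqVneq (F (That x)) 0; first by rewrite mul0r.
  have xr : `|That x - y0| <= r by rewrite leNgt; apply/negP => /vF h'; rewrite h' eqxx in Fx.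
  have [_ _ xB] := locate (lexx r) xr (ThatK x).
  have := ler_distD x0 x 0; rewrite !subr0; have := normr_ge0 x0; have := normr_ge0 y0.
  by move: h; rewrite /L; have := r0; lra.
set X := I _; set e1 := I eta.
(* Both inner estimates are applied to the same double integral; the common factor [d ^+ n]
   cancels. *)
have H (e : R) : 0 < e -> `|X * e1 - I F * e1| <= (2 * L) ^+ n * e * 2.
  move=> e0; have [d1 d10 h1] := inner_y e0; have [d2 d20 h2] := inner_x e0.
  pose d := Num.min r (Num.min d1 d2 / 2).
  have m0 : 0 < Num.min d1 d2 by rewrite lt_min d10.
  have dp : 0 < d by rewrite lt_min r0 divr_gt0.
  have dr : d <= r by rewrite ge_min lexx.
  have dm : d < Num.min d1 d2.
    by apply: (@le_lt_trans _ _ (Num.min d1 d2 / 2)); [rewrite ge_min lexx orbT|lra].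
  have [dd1 dd2] : d < d1 /\ d < d2 by move: dm; rewrite lt_min => /andP.
  have uD := D_ucc2 dp dr.
  have dn : 0 < d ^+ n by rewrite exprn_gt0.
  have vD : vanish L (fun x => I (D d x)).
    move=> x h; rewrite (_ : D d x = fun=> 0) ?integral_0 //.
    by apply/funext => y; apply: D_vanish => //; left.
  have vD' : vanish L (fun y => I (fun x => D d x y)).
    move=> y h; rewrite (_ : (fun x => D d x y) = fun=> 0) ?integral_0 //.
    by apply/funext => x; apply: D_vanish => //; right.
  have vFT : vanish L (fun x => F (That x) * khat x).
    move=> x h; have [->|Fx] := eqVneq (F (That x)) 0; first by rewrite mul0r.
    have xr : `|That x - y0| <= r by rewrite leNgt; apply/negP => /vF h'; rewrite h' eqxx in Fx.
    have [_ _ xB] := locate (lexx r) xr (ThatK x).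
    have := ler_distD x0 x 0; rewrite !subr0; have := normr_ge0 x0; have := normr_ge0 y0.
    by move: h; rewrite /L; have := r0; lra.
  have vF' : vanish L F.
    move=> y h; apply: vF; have := ler_distD y0 y 0; rewrite !subr0.
    by move: h; rewrite /L; have := rho0; have := normr_ge0 x0; lra.
  have B1 : `|I (fun x => I (D d x)) - d ^+ n * e1 * X| <= (2 * L) ^+ n * (d ^+ n * e).
    rewrite /X -integral_Z //; apply: integral_dist => //.
    - by have [] := ucc2_int uD.
    - by have [] := cc_Z (d ^+ n * e1) ccFT.
    - by move=> x h; rewrite vFT // mulr0.
    - move=> x; have := h1 d x dp dd1; congr (`|_ - _| <= _).
      by rewrite -/e1; ring.
  have B2 : `|I (fun x => I (D d x)) - d ^+ n * e1 * I F| <= (2 * L) ^+ n * (d ^+ n * e).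
    rewrite (integral_swap2 uD) -integral_Z //; apply: integral_dist => //.
    - by have [] := ucc2_int (ucc2_sym uD).
    - by have [] := cc_Z (d ^+ n * e1) ccF.
    - by move=> x h; rewrite vF' // mulr0.
    - move=> y; have := h2 d y dp dr dd2; congr (`|_ - _| <= _).
      by rewrite -/e1; ring.
  rewrite -(ler_pM2l dn) -[X in X * _ <= _](gtr0_norm dn) -normrM.
  have -> : d ^+ n * (X * e1 - I F * e1) =
    (I (fun x => I (D d x)) - d ^+ n * e1 * I F) - (I (fun x => I (D d x)) - d ^+ n * e1 * X) by ring.
  apply: le_trans (ler_normB _ _) _; apply: le_trans (lerD B2 B1) _.
  by rewrite le_eqVlt; apply/orP; left; apply/eqP; ring.
apply: (mulIf (lt0r_neq0 eta_int)); rewrite -/e1.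
apply/eqP; rewrite -subr_eq0; apply/negPn/negP; rewrite -normr_gt0.
set a := `|_| in H * => a0.
have C1 : 0 < (2 * L) ^+ n + 1 by rewrite ltr_wpDl // exprn_ge0 // mulr_ge0.
(* With [Q = (2 * L) ^+ n] and [e = a / ((Q + 1) * 4)] the bound [Q * e * 2] is less than [a]. *)
have := H _ (divr_gt0 a0 (mulr_gt0 C1 (_ : 0 < 4))).
rewrite ltr0n => /(_ isT); rewrite leNgt => /negP; apply.
move: ((2 * L) ^+ n) C1 => Q C1.
have E0 : 0 < a / ((Q + 1) * 4) by rewrite divr_gt0 // mulr_gt0.
have aE : a = a / ((Q + 1) * 4) * ((Q + 1) * 4) by rewrite divfK // gt_eqF // mulr_gt0.
rewrite [ltRHS]aE; move: (a / _) E0 => E E0; have := mulr_gt0 E0 C1; nra.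
Qed.

End Core.

Lemma change_of_variables_local y0 : V y0 -> exists2 r : R, 0 < r &
  forall F : rV -> R, continuous F -> (forall y, r < `|y - y0| -> F y = 0) ->
  I (fun x => if x \in U then F (T x) * `|jacobian_det T x| else 0) = I F.
Proof.
move=> Vy0; have [d dp dU] := open_ballP oU (SVU Vy0).
have [d' dp' dV] := open_ballP oV Vy0.
pose r1 := d' / 4; have r10 : 0 < r1 by rewrite divr_gt0.
have VB y : `|y - y0| <= 2 * r1 -> V y by move=> h; apply: dV; rewrite /r1 in h *; lra.
have cJ i j y : `|y - y0| <= 2 * r1 -> {for y, continuous (fun y => jac S y i j)}.
  move=> /VB Vy; rewrite (_ : (fun x => jac S x i j) = pderiv i (fun y => S y 0 j)).
    by have [_ /(_ i)[_ [c _]]] := cS j; exact: c.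
  by apply/funext => z; rewrite mxE.
have /choice[M MP] : forall ij : 'I_n * 'I_n, exists M : R, 0 < M /\
    forall y, `|y - y0| <= 2 * r1 -> `|jac S y ij.1 ij.2| <= M.
  move=> [i j]; have [M M0 h] := compact_bounded_fun (@compact_ball_rv R n y0 (2 * r1))
    (fun y h => cJ i j y h).
  by exists M; split.
pose N := \sum_ij M ij.
have MN ij : M ij <= N.
  by rewrite /N (bigD1 ij) //= lerDl sumr_ge0 // => kl _; apply/ltW/(MP kl).1.
have N0 : 0 <= N by rewrite sumr_ge0 // => kl _; apply/ltW/(MP kl).1.
have jN y i j : `|y - y0| <= 2 * r1 -> `|jac S y i j| <= N.
  by move=> h; apply: le_trans (MN (i, j)); exact: (MP (i, j)).2.
(* One constant serves as Lipschitz constant of [S] and as norm bound for its Jacobian matrix; the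
   added 1 keeps it positive. *)
pose C := n%:R * N + 1.
have C0 : 0 < C by rewrite ltr_wpDl // mulr_ge0.
(* The factor 8 gives [C * (2 * r) <= d / 4], strictly below the radius [d / 2] that plays the part
   of [rho]. *)
pose r := Num.min r1 (d / (8 * C)).
have r0 : 0 < r by rewrite lt_min r10 divr_gt0 // mulr_gt0.
have rr1 : r <= r1 by rewrite ge_min lexx.
have rC : C * (2 * r) < d / 2.
  apply: (@le_lt_trans _ _ (C * (2 * (d / (8 * C))))).
    by rewrite ler_pM2l // ler_pM2l // ge_min lexx orbT.
  have -> : C * (2 * (d / (8 * C))) = d / 4 by field; rewrite gt_eqF.
  lra.
have B2 y : `|y - y0| <= 2 * r -> `|y - y0| <= 2 * r1.
  by move=> h; apply: le_trans h _; rewrite ler_pM2l.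
exists r => // F cF vF; apply: (@change_of_variables_core y0 (d / 2) r C) => //.
- by move=> x h; apply: dU; apply: le_lt_trans h _; lra.
- by move=> y h; exact/VB/B2.
- move=> y y' hy hy'; apply: rv_norm_le => [|j]; first by rewrite mulr_ge0 // ltW.
  have [|xi B E] := @mean_value R n (fun y => S y 0 j) y y'.
    move=> v /inbox_ball/(_ hy hy')/B2/VB Vv i.
    by have [_ /(_ i)[di _]] := cS j; exact: di.
  rewrite !mxE E; apply: le_trans (ler_norm_sum _ _ _) _.
  apply: (@le_trans _ _ (\sum_(i < n) N * `|y' - y|)).
    apply: ler_sum => i _; rewrite normrM mulrC; apply: ler_pM => //.
      have := jN (xi i) i j (B2 _ (inbox_ball (B i) hy hy')).
      by rewrite mxE.
    by have := coord_le_norm (y' - y) i; rewrite !mxE.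
  by rewrite sumr_const card_ord -mulr_natl mulrA ler_wpM2r // lerDl.
- move=> y z hy; apply: rv_norm_le => [|j]; first by rewrite mulr_ge0 // ltW.
  rewrite mxE; apply: le_trans (ler_norm_sum _ _ _) _.
  apply: (@le_trans _ _ (\sum_(i < n) N * `|z|)).
    apply: ler_sum => i _; rewrite normrM mulrC; apply: ler_pM => //.
      by apply: jN; exact: B2.
    exact: coord_le_norm.
  by rewrite sumr_const card_ord -mulr_natl mulrA ler_wpM2r // lerDl.
Qed.

End ChangeOfVariables.

(** * Integration on manifolds *)

Section Topology.

(** If [Q K] failed, the sets whose complement in [K] satisfies [Q] would form a proper filter
    containing [K]; a cluster point in [K] contradicts the local hypothesis there. *)
Lemma compact_induction (T : topologicalType) (K : set T) (Q : set T -> Prop) :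
  compact K -> Q set0 -> (forall A B, A `<=` B -> Q B -> Q A) ->
  (forall A B, Q A -> Q B -> Q (A `|` B)) ->
  (forall x, K x -> exists2 W, nbhs x W & Q W) -> Q K.
Proof.
move=> cK Q0 Qsub QU Qloc; apply: contrapT => nQ.
pose F : set_system T := [set S | Q (K `\` S)].
have FF : ProperFilter F.
  split; first by rewrite /F /= setD0.
  split=> [|A B FA FB|A B AB FA].
  - by rewrite /F /= setDT.
  - by rewrite /F /= setDIr; exact: QU.
  - by apply: Qsub FA => x [Kx nB]; split => // /AB.
have FK : F K by rewrite /F /= setDv.
have [x [Kx clx]] := cK F FF FK.
have [W Wx QW] := Qloc x Kx.
have FW : F (~` W) by apply: Qsub QW => y [_ /contrapT].
by have [y []] := clx _ _ FW Wx.
Qed.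

End Topology.

(** * Smooth functions, partitions of unity and integrals of densities *)

Section Manifold.
Local Notation coord := Defs.coord.
Variables (R : realType) (n : nat) (M : manifold R n).
Implicit Types (c d : chart M) (f g h : C^oo(M)) (x y z : M) (K W : set M).

Lemma cooP f g : (forall x, f x = g x) -> f = g.
Proof. by move=> fg; apply/val_inj/funext. Qed.

Lemma cooD f g x : (f + g) x = f x + g x. Proof. by []. Qed.
Lemma cooM f g x : (f * g) x = f x * g x. Proof. by []. Qed.
Lemma cooN f x : (- f) x = - f x. Proof. by []. Qed.
Lemma coo0 x : (0 : C^oo(M)) x = 0. Proof. by []. Qed.
Lemma coo1 x : (1 : C^oo(M)) x = 1. Proof. by []. Qed.
Lemma coo_sum (I : Type) (s : seq I) (P : pred I) (F : I -> C^oo(M)) x :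
  (\sum_(i <- s | P i) F i) x = \sum_(i <- s | P i) F i x.
Proof. by elim/big_rec2: _ => // i a b _ <-. Qed.

Lemma coo_smooth f : smooth f.
Proof. by case: f => f fP; apply/smoothP. Qed.

Definition mkcoo (p : M -> R) (sp : smooth p) : C^oo(M) := SmoothFun (introT (smoothP p) sp).

Lemma img_coordK c u : (coord c @` dom c) u -> dom c (param c u) /\ coord c (param c u) = u.
Proof. by move=> [x cx <-]; rewrite paramK. Qed.

Lemma img_coord c x : dom c x -> (coord c @` dom c) (coord c x).
Proof. by move=> cx; exists x. Qed.

Lemma coord_img_open c W : open W -> W `<=` dom c -> open (coord c @` W).
Proof.
move=> oW Wc; rewrite openE => _ [x Wx <-] /=.
have cx := Wc _ Wx; have ix := img_coord cx.
have nW : nbhs (param c (coord c x)) W by rewrite paramK //; exact: open_nbhs_nbhs.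
have n1 : nbhs (coord c x) (param c @^-1` W) by exact: param_cont ix _ nW.
have n2 := open_nbhs_nbhs (conj (@img_open _ _ M c) ix).
apply: filterS2 n1 n2 => u /= Wu iu; exists (param c u) => //.
by have [] := img_coordK iu.
Qed.

Lemma smooth_local (p : M -> R) :
  (forall x, exists c, exists W, [/\ open W, W x, W `<=` dom c &
     smooth_on (coord c @` W) (p \o param c)]) -> smooth p.
Proof.
move=> H d k; apply: Ck_local => u iu; have [du uE] := img_coordK iu.
have [c [W [oW Wx Wc sp]]] := H (param d u).
have oD : open (W `&` dom d) by apply: openI => //; exact: dom_open.
have oV : open (coord d @` (W `&` dom d)) by apply: coord_img_open => // x [].
exists (coord d @` (W `&` dom d)); first by exists (param d u).
apply: (@Ck_eq _ _ _ _ ((p \o param c) \o (coord c \o param d))) => //.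
  by move=> _ [x [Wx' dx] <-] /=; rewrite [param d _]paramK // paramK //; exact: Wc.
apply: (Ck_comp oV (coord_img_open oW Wc)) => //.
  by move=> _ [x [Wx' dx] <-] /=; rewrite paramK //; exists x.
move=> j; apply: (Ck_sub _ (@transition_smooth R n M d c j k)).
by move=> _ [x [Wx' dx] <-]; exists x => //; split => //; exact: Wc.
Qed.

Lemma coo_chart c f : smooth_in c f. Proof. exact: coo_smooth. Qed.

Lemma smooth_in_eq c (p q : M -> R) : (forall x, dom c x -> p x = q x) ->
  smooth_in c p -> smooth_in c q.
Proof.
move=> pq sp k; apply: Ck_eq (sp k); first exact: img_open.
by move=> u /img_coordK[du _] /=; exact: pq.
Qed.

Lemma smooth_inM c (p q : M -> R) : smooth_in c p -> smooth_in c q ->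
  smooth_in c (fun x => p x * q x).
Proof. by move=> sp sq k; apply: CkM; [exact: img_open|exact: sp|exact: sq]. Qed.

Lemma smooth_inD c (p q : M -> R) : smooth_in c p -> smooth_in c q ->
  smooth_in c (fun x => p x + q x).
Proof. by move=> sp sq k; apply: CkD; [exact: img_open|exact: sp|exact: sq]. Qed.

Lemma smooth_in_cst c (a : R) : smooth_in c (fun=> a).
Proof. by move=> k; apply: Ck_cst; exact: img_open. Qed.

Lemma smooth_inN c (p : M -> R) : smooth_in c p -> smooth_in c (fun x => - p x).
Proof.
move=> sp; apply: (smooth_in_eq (p := fun x => -1 * p x)) => [x _|]; first by rewrite mulN1r.
by apply: smooth_inM => //; exact: smooth_in_cst.
Qed.

Lemma smooth_inV c (p : M -> R) : (forall x, dom c x -> p x != 0) -> smooth_in c p ->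
  smooth_in c (fun x => (p x)^-1).
Proof.
move=> p0 sp k; apply: (@Ck_inv _ _ _ _ (p \o param c)); [exact: img_open| |exact: sp].
by move=> u /img_coordK[du _]; exact: p0.
Qed.

Lemma compact_closedM K : compact K -> closed K.
Proof. by apply: compact_closed; exact: manifold_hausdorff. Qed.

(** Off the chart domain the function is zero near each point: compact sets of a Hausdorff space are
    closed, so the complement of [K] is open. *)
Lemma smooth_ext0 c K (p : M -> R) : compact K -> K `<=` dom c -> smooth_in c p ->
  (forall x, ~ K x -> p x = 0) -> smooth p.
Proof.
move=> cK Kc sp p0; apply: smooth_local => x.
have [cx|ncx] := pselect (dom c x).
  by exists c; exists (dom c); split => //; exact: dom_open.
have [d dx] := dom_cover x.
exists d; exists (dom d `&` ~` K).
have oW : open (dom d `&` ~` K).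
  by apply: openI; [exact: dom_open|apply: closed_openC; exact: compact_closedM].
have Wx : (dom d `&` ~` K) x by split => // /Kc.
have Wd : dom d `&` ~` K `<=` dom d by move=> y [].
split => //.
move=> k; have oV : open (coord d @` (dom d `&` ~` K)) by apply: coord_img_open => // y [].
apply: (@Ck_eq _ _ _ _ (fun=> 0)) => //; last exact: Ck_cst.
by move=> _ [y [dy nK] <-] /=; rewrite paramK // p0.
Qed.

Lemma supp_out f x : ~ supp f x -> f x = 0.
Proof.
move=> nx; apply: contrapT => /eqP fx; apply: nx.
exact: subset_closure.
Qed.

Lemma suppP K f : compact K -> (forall x, ~ K x -> f x = 0) -> compact (supp f) /\ supp f `<=` K.
Proof.
move=> cK f0; have cl := compact_closedM cK.
have sK : supp f `<=` K.
  rewrite /supp (closure_id K).1 //; apply: closureS => x /= fx.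
  by apply: contrapT => /f0 h; rewrite h eqxx in fx.
by split => //; apply: subclosed_compact cK sK; exact: closed_closure.
Qed.

Lemma suppM_l f g : compact (supp f) -> compact (supp (f * g)) /\ supp (f * g) `<=` supp f.
Proof. by move=> cf; apply: suppP => // x /supp_out fx; rewrite cooM fx mul0r. Qed.

Lemma suppM_r f g : compact (supp f) -> compact (supp (g * f)) /\ supp (g * f) `<=` supp f.
Proof. by move=> cf; apply: suppP => // x /supp_out fx; rewrite cooM fx mulr0. Qed.

Lemma supp_compactD f g : compact (supp f) -> compact (supp g) -> compact (supp (f + g)).
Proof.
move=> cf cg; apply: (suppP (compactU cf cg) _).1 => x h.
by rewrite cooD !supp_out ?addr0 // => h'; apply: h; [right|left].
Qed.

Lemma supp_compactN f : compact (supp f) -> compact (supp (- f)).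
Proof. by move=> cf; apply: (suppP cf _).1 => x /supp_out h; rewrite cooN h oppr0. Qed.

Lemma supp_compact0 : compact (supp (0 : C^oo(M))).
Proof. by apply: (suppP (@compact0 _) _).1 => x _. Qed.

Lemma supp_compact_sum (I : Type) (s : seq I) (P : pred I) (F : I -> C^oo(M)) :
  (forall i, P i -> compact (supp (F i))) -> compact (supp (\sum_(i <- s | P i) F i)).
Proof.
move=> cF; elim/big_rec: _ => [|i f Pi cf]; first exact: supp_compact0.
by apply: supp_compactD => //; exact: cF.
Qed.

Lemma cutoff x W : open W -> W x -> exists chi : C^oo(M),
  [/\ compact (supp chi), supp chi `<=` W & \forall z \near x, chi z = 1].
Proof.
move=> oW Wx; have [c cx] := dom_cover x.
have oD : open (W `&` dom c) by apply: openI => //; exact: dom_open.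
have oN : open (coord c @` (W `&` dom c)) by apply: coord_img_open => // z [].
have [d d0 dN] := open_ballP oN (ex_intro2 _ _ x (conj Wx cx) erefl).
pose u := coord c x; pose r := d / 2; have r0 : 0 < r by rewrite divr_gt0.
have bN v : `|v - u| <= r -> (coord c @` (W `&` dom c)) v.
  by move=> h; apply: dN; rewrite /r in h *; lra.
have bI v : `|v - u| <= r -> (coord c @` dom c) v by move=> /bN[z [_ cz] <-]; exists z.
pose p z := if z \in dom c then bump u r (coord c z) else 0.
pose K := param c @` [set v | `|v - u| <= r].
have cK : compact K.
  apply: continuous_compact; last exact: compact_ball_rv.
  apply: continuous_in_subspaceT => v; rewrite inE /= => /bI; exact: param_cont.
have KW : K `<=` W `&` dom c.
  by move=> _ [v /bN[z [Wz cz] <-] <-]; rewrite paramK.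
have p0 z : ~ K z -> p z = 0.
  rewrite /p; case: ifPn => // /set_mem cz nK; apply: bump_eq0 => //.
  rewrite leNgt; apply/negP => h; apply: nK; exists (coord c z); last by rewrite paramK.
  exact: ltW.
have sp : smooth p.
  apply: (@smooth_ext0 c K p cK _ _ p0); first by move=> z /KW[].
  move=> k; apply: (@Ck_eq _ _ _ _ (bump u r)); [exact: img_open| |exact/bump_smooth/img_open].
  by move=> v /img_coordK[cv vE] /=; rewrite /p mem_set // vE.
exists (mkcoo sp); have [h1 h2] := suppP (f := mkcoo sp) cK p0.
split => //; first by move=> z /h2/KW[].
have n1 : nbhs x (dom c) by apply: open_nbhs_nbhs; split => //; exact: dom_open.
have n2 : nbhs x (coord c @^-1` [set v | `|v - u| < r / 2]).
  apply: (coord_cont cx); apply/nbhs_ballP; exists (r / 2); first by rewrite /= divr_gt0.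
  by move=> v; rewrite -ball_normE /= distrC.
apply: filterS2 n1 n2 => z cz /= h; rewrite /p mem_set // bump_eq1 //; exact: ltW.
Qed.

(** [P] is a free label of open sets: lying in a chart domain when functions are decomposed, being a
    set on which two charts give the same integrals in [chart_integral_indep]. *)
Lemma partition_of_unity K (P : set M -> Prop) : compact K ->
  (forall x, K x -> exists W, [/\ open W, W x & P W]) ->
  exists m (chi : 'I_m -> C^oo(M)),
    (forall l, exists W, [/\ P W, compact (supp (chi l)) & supp (chi l) `<=` W]) /\
    (forall z, K z -> (\sum_l chi l) z = 1).
Proof.
move=> cK PK.
pose ok (chi : C^oo(M)) := exists W, [/\ P W, compact (supp chi) & supp chi `<=` W].
suff [s [sok s1]] : exists s : seq C^oo(M), (forall chi, chi \in s -> ok chi) /\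
    (forall z, K z -> (\sum_(chi <- s) chi) z = 1).
  exists (size s); exists (tnth (in_tuple s)); split=> [l|z /s1 <-].
    by apply: sok; exact: mem_tnth.
  by rewrite [in RHS]big_tnth.
apply: (compact_induction (Q := fun A => exists s : seq C^oo(M),
   (forall chi, chi \in s -> ok chi) /\ forall z, A z -> (\sum_(chi <- s) chi) z = 1)) => //.
- by exists [::].
- by move=> A B AB [s [sok s1]]; exists s; split => // z /AB; exact: s1.
- move=> A B [s [sok s1]] [t [tok t1]].
  (* If the two families have sums [a] and [b], the new total is [a + b * (1 - a)], which is 1
     wherever [a = 1] or [b = 1]; the products do not enlarge supports. *)
  exists (s ++ [seq chi * (1 - \sum_(xi <- s) xi) | chi <- t]); split.
    move=> chi; rewrite mem_cat => /orP[/sok//|/mapP[xi /tok[W [PW cxi sxi]] ->]].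
    have [h1 h2] := suppM_l (1 - \sum_(xi <- s) xi) cxi.
    by exists W; split => // z /h2/sxi.
  move=> z Az; rewrite big_cat big_map -mulr_suml cooD cooM (cooD 1) cooN coo1.
  by case: Az => [/s1 ->|/t1 ->]; ring.
- move=> x Kx; have [W [oW Wx PW]] := PK x Kx.
  have [chi [h1 h2 h3]] := cutoff oW Wx.
  exists [set z | chi z = 1] => //; exists [:: chi]; split.
    by move=> xi; rewrite inE => /eqP ->; exists W.
  by move=> z; rewrite big_seq1.
Qed.

Definition coord_integrand c (p : M -> R) (u : 'rV[R]_n) : R :=
  if u \in coord c @` dom c then p (param c u) else 0.

Definition coord_integral c (p : M -> R) : R := integral_Rn (coord_integrand c p).

(** Meant for plain functions on [M], since integrands contain coefficients such as [rho c] whose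
    smoothness is known in the chart [c] only. *)
Definition in_chart c (p : M -> R) :=
  smooth_in c p /\ exists K, [/\ compact K, K `<=` dom c & forall x, ~ K x -> p x = 0].

Lemma compact_coord_img c K : compact K -> K `<=` dom c -> compact (coord c @` K).
Proof.
move=> cK Kc; apply: continuous_compact cK.
by apply: continuous_in_subspaceT => x; rewrite inE => /Kc; exact: coord_cont.
Qed.

Lemma coord_integrand_out c K (p : M -> R) u : (forall x, ~ K x -> p x = 0) ->
  ~ (coord c @` K) u -> coord_integrand c p u = 0.
Proof.
move=> p0 nK; rewrite /coord_integrand; case: ifPn => // /set_mem/img_coordK[cu uE].
by apply: p0 => Kx; apply: nK; exists (param c u).
Qed.

Lemma coord_integrand_smooth c p : in_chart c p -> smooth_on setT (coord_integrand c p).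
Proof.
move=> [sp [K [cK Kc p0]]] k; apply: Ck_local => u _.
have [iu|iu] := pselect ((coord c @` dom c) u).
  exists (coord c @` dom c) => //; apply: Ck_eq (sp k); first exact: img_open.
  by move=> v iv; rewrite /coord_integrand mem_set.
have cl : closed (coord c @` K).
  by apply: compact_closed; [exact: norm_hausdorff|exact: compact_coord_img].
exists (~` (coord c @` K)); first by move=> [x /Kc cx xu]; apply: iu; exists x.
apply: (@Ck_eq _ _ _ _ (fun=> 0)); [exact: closed_openC| |exact/Ck_cst/closed_openC].
by move=> v nv; rewrite (coord_integrand_out p0 nv).
Qed.

Lemma coord_integrand_cc c p : in_chart c p -> cc (coord_integrand c p).
Proof.
move=> cp; split; first by move=> u; have [h _] := coord_integrand_smooth cp 0; exact: h.
have [sp [K [cK Kc p0]]] := cp.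
have [N [_ /(_ (`|N| + 1))]] := compact_bounded (compact_coord_img cK Kc).
rewrite (le_lt_trans (ler_norm N)) ?ltrDl // => /(_ isT) h.
exists (`|N| + 1); first by rewrite addr_ge0.
move=> u hu; apply: (coord_integrand_out p0) => Ku; move: hu.
by rewrite ltNge => /negP; apply; exact: h.
Qed.

Lemma coord_integralD c p q : in_chart c p -> in_chart c q ->
  coord_integral c (fun x => p x + q x) = coord_integral c p + coord_integral c q.
Proof.
move=> cp cq; rewrite /coord_integral -integral_D; [|exact: coord_integrand_cc..].
congr integral_Rn; apply/funext => u; rewrite /coord_integrand.
by case: ifPn; rewrite ?addr0.
Qed.

Lemma coord_integral0 c : coord_integral c (fun=> 0) = 0.
Proof.
rewrite /coord_integral -[RHS](@integral_0 R n); congr integral_Rn.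
by apply/funext => u; rewrite /coord_integrand if_same.
Qed.

Lemma eq_coord_integral c (p q : M -> R) : (forall x, dom c x -> p x = q x) ->
  coord_integral c p = coord_integral c q.
Proof.
move=> pq; congr integral_Rn; apply/funext => u; rewrite /coord_integrand.
by case: ifPn => // /set_mem/img_coordK[cu _]; exact: pq.
Qed.

Lemma in_chartD c p q : in_chart c p -> in_chart c q -> in_chart c (fun x => p x + q x).
Proof.
move=> [sp [K [cK Kc p0]]] [sq [K' [cK' Kc' q0]]]; split; first exact: smooth_inD.
exists (K `|` K'); split; first exact: compactU.
  by move=> x [/Kc|/Kc'].
by move=> x h; rewrite p0 ?q0 ?addr0 // => h'; apply: h; [right|left].
Qed.

Lemma in_chart_mul c p q : in_chart c p -> smooth_in c q -> in_chart c (fun x => p x * q x).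
Proof.
move=> [sp [K [cK Kc p0]]] sq; split; first exact: smooth_inM.
by exists K; split => // x /p0 ->; rewrite mul0r.
Qed.

Lemma in_chart_coo c f : compact (supp f) -> supp f `<=` dom c -> in_chart c f.
Proof.
move=> cf fc; split; first exact: coo_chart.
by exists (supp f); split => // x; exact: supp_out.
Qed.

Lemma chart_integralE (rho : predensity M) c f :
  chart_integral rho c f = coord_integral c (fun x => f x * rho c x).
Proof. by []. Qed.

Section Density.
Variable rho : predensity M.
Hypothesis rhoP : is_density rho.

Let rho_smooth c : smooth_in c (rho c). Proof. by have [h _ _] := rhoP; exact: h. Qed.

Definition chart_supported c f := compact (supp f) /\ supp f `<=` dom c.

Lemma chart_integralD c f g : chart_supported c f -> chart_supported c g ->
  chart_integral rho c (f + g) = chart_integral rho c f + chart_integral rho c g.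
Proof.
move=> [cf fc] [cg gc]; rewrite !chart_integralE -coord_integralD.
- by congr coord_integral; apply/funext => x; rewrite cooD mulrDl.
- by apply: in_chart_mul => //; exact: in_chart_coo.
- by apply: in_chart_mul => //; exact: in_chart_coo.
Qed.

Lemma chart_supported0 c : chart_supported c 0.
Proof. by split=> [|x]; [exact: supp_compact0|have [_ h] := @suppP set0 0 (@compact0 _) (fun _ _ => erefl); move=> /h]. Qed.

Lemma chart_integral0 c : chart_integral rho c 0 = 0.
Proof.
by rewrite chart_integralE -(coord_integral0 c); apply: eq_coord_integral => x _; rewrite mul0r.
Qed.

Lemma chart_supportedM c f g : chart_supported c f -> chart_supported c (f * g).
Proof. by move=> [cf fc]; have [h1 h2] := suppM_l g cf; split => // x /h2/fc. Qed.

Lemma chart_supportedD c f g : chart_supported c f -> chart_supported c g ->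
  chart_supported c (f + g).
Proof.
move=> [cf fc] [cg gc]; split; first exact: supp_compactD.
have [_ h] : compact (supp (f + g)) /\ supp (f + g) `<=` supp f `|` supp g.
  apply: suppP (compactU cf cg) _ => x h.
  by rewrite cooD !supp_out ?addr0 // => h'; apply: h; [right|left].
by move=> x /h[/fc|/gc].
Qed.

Lemma chart_integral_sum c (I : Type) (s : seq I) (F : I -> C^oo(M)) :
  (forall i, chart_supported c (F i)) ->
  chart_supported c (\sum_(i <- s) F i) /\
  chart_integral rho c (\sum_(i <- s) F i) = \sum_(i <- s) chart_integral rho c (F i).
Proof.
move=> cF; elim: s => [|i s [IH1 IH2]].
  by rewrite !big_nil chart_integral0; split => //; exact: chart_supported0.
rewrite !big_cons -IH2; split; first exact: chart_supportedD.
exact: chart_integralD.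
Qed.

(** The change of variables is applied to the transition map near [coord d x], and the
    transformation law of densities supplies its Jacobian factor. [W] is cut down so that the
    coordinate supports lie in the ball obtained there. *)
Let chart_indep_local c d x : dom c x -> dom d x -> exists W, [/\ open W, W x &
  forall g, compact (supp g) -> supp g `<=` W -> chart_integral rho c g = chart_integral rho d g].
Proof.
move=> cx dx; pose O := dom c `&` dom d.
have oO : open O by apply: openI; exact: dom_open.
have oU : open (coord c @` O) by apply: coord_img_open => // z [].
have oV : open (coord d @` O) by apply: coord_img_open => // z [].
have [r r0 H] := @change_of_variables_local R n (coord c @` O) (coord d @` O)
  (coord d \o param c) (coord c \o param d) oU oV
  ltac:(by move=> _ [z [cz dz] <-] /=; rewrite paramK //; exists z)
  ltac:(by move=> _ [z [cz dz] <-] /=; rewrite paramK //; exists z)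
  ltac:(by move=> _ [z [cz dz] <-] /=; rewrite [param c _]paramK // paramK)
  ltac:(by move=> _ [z [cz dz] <-] /=; rewrite [param d _]paramK // paramK)
  (fun j => @transition_smooth _ _ M c d j 1)
  ltac:(by move=> j; have := @transition_smooth _ _ M d c j 1; rewrite /O setIC)
  (coord d x) (ex_intro2 _ _ x (conj cx dx) erefl).
exists [set z | O z /\ `|coord d z - coord d x| < r]; split.
- rewrite openE => z [Oz zr] /=; have [cz dz] := Oz.
  have n1 := open_nbhs_nbhs (conj oO Oz).
  have n2 : nbhs z (coord d @^-1` [set v | `|v - coord d x| < r]).
    apply: (coord_cont dz); apply/nbhs_ballP; exists (r - `|coord d z - coord d x|).
      by rewrite /= subr_gt0.
    move=> v; rewrite -ball_normE /= distrC => vz.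
    by have := ler_distD (coord d z) v (coord d x); lra.
  by apply: filterS2 n1 n2.
- by split => //; rewrite subrr normr0.
move=> g cg gW.
have gc : supp g `<=` dom c by move=> z /gW[[]].
have gd : supp g `<=` dom d by move=> z /gW[[]].
pose F := coord_integrand d (fun z => g z * rho d z).
have inF : in_chart d (fun z => g z * rho d z) by apply: in_chart_mul => //; exact: in_chart_coo.
have [cF _] := coord_integrand_cc inF.
have vF (y : 'rV[R]_n) : r < `|y - coord d x| -> F y = 0.
  move=> h; apply: (@coord_integrand_out d (supp g)).
    by move=> z /supp_out ->; rewrite mul0r.
  by move=> [z /gW[_ zr] zy]; rewrite -zy in h; have := lt_trans h zr; rewrite ltxx.
rewrite !chart_integralE [RHS](esym (H F cF vF)) /coord_integral; congr integral_Rn.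
have [_ _ tr] := rhoP.
apply/funext => u; rewrite /coord_integrand.
case: ifPn => [/set_mem iu|niu].
  have [cu uE] := img_coordK iu.
  case: ifPn => [/set_mem[z [cz dz] zu]|nu].
    rewrite -zu /= paramK // /F /coord_integrand mem_set; last by exists z.
    rewrite paramK // (tr c d z cz dz); ring.
  rewrite supp_out ?mul0r // => /gW[[_ du] _]; move: nu; rewrite mem_set //.
  by exists (param c u).
rewrite ifF //; apply/negbTE; apply: contra niu => /set_mem[z [cz _] <-].
by rewrite mem_set //; exact: img_coord.
Qed.

Lemma chart_integral_indep c d g : chart_supported c g -> chart_supported d g ->
  chart_integral rho c g = chart_integral rho d g.
Proof.
move=> [cg gc] [_ gd].
have [m [chi [chiP chi1]]] := partition_of_unity cg
  (fun x gx => chart_indep_local (gc x gx) (gd x gx)).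
have gE : g = \sum_l (g * chi l).
  rewrite -mulr_sumr; apply: cooP => x; rewrite cooM.
  have [gx|gx] := pselect (supp g x); first by rewrite chi1 // mulr1.
  by rewrite supp_out // mul0r.
have cgl e l : chart_supported e g -> chart_supported e (g * chi l) by exact: chart_supportedM.
rewrite gE (chart_integral_sum _ (fun l => cgl c l (conj cg gc))).2.
rewrite (chart_integral_sum _ (fun l => cgl d l (conj cg gd))).2.
apply: eq_bigr => l _; have [W [HW cl lW]] := chiP l.
have [h1 h2] := suppM_r g cl; apply: HW => //.
by move=> x /h2/lW.
Qed.

Lemma decomposition f : compact (supp f) ->
  exists m (c : 'I_m -> chart M) (g : 'I_m -> C^oo(M)),
    (forall i, chart_supported (c i) (g i)) /\ f = \sum_i g i.
Proof.
move=> cf.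
have [m [chi [chiP chi1]]] := @partition_of_unity (supp f) (fun W => exists c, W `<=` dom c) cf
  ltac:(by move=> x _; have [c cx] := dom_cover x; exists (dom c); split; [exact: dom_open| |exists c]).
have /choice[c cP] : forall l, exists c, chart_supported c (chi l).
  by move=> l; have [W [[c Wc] cl lW]] := chiP l; exists c; split => // x /lW/Wc.
exists m; exists c; exists (fun l => chi l * f); split; first by move=> l; exact: chart_supportedM.
rewrite -mulr_suml; apply: cooP => x; rewrite cooM.
have [gx|gx] := pselect (supp f x); first by rewrite chi1 // mul1r.
by rewrite supp_out // mulr0.
Qed.

(** Splitting every [g i] by the [chi l] and regrouping gives an expression in the total
    [\sum_i g i] alone. *)
Let refine_sum m (c : 'I_m -> chart M) (g : 'I_m -> C^oo(M)) m' (e : 'I_m' -> chart M)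
    (chi : 'I_m' -> C^oo(M)) :
  (forall i, chart_supported (c i) (g i)) -> (forall l, chart_supported (e l) (chi l)) ->
  (forall i x, supp (g i) x -> (\sum_l chi l) x = 1) ->
  \sum_i chart_integral rho (c i) (g i) = \sum_l chart_integral rho (e l) (chi l * \sum_i g i).
Proof.
move=> cg ce chi1.
have gE i : g i = \sum_l (g i * chi l).
  rewrite -mulr_sumr; apply: cooP => x; rewrite cooM.
  have [gx|gx] := pselect (supp (g i) x); first by rewrite (chi1 i) // mulr1.
  by rewrite supp_out // mul0r.
transitivity (\sum_i \sum_l chart_integral rho (e l) (chi l * g i)).
  apply: eq_bigr => i _; rewrite {1}[g i]gE.
  rewrite (chart_integral_sum _ (fun l => chart_supportedM (chi l) (cg i))).2.
  apply: eq_bigr => l _; rewrite [chi l * _]mulrC; apply: chart_integral_indep.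
    exact: chart_supportedM.
  by rewrite mulrC; exact: chart_supportedM.
rewrite exchange_big; apply: eq_bigr => l _; rewrite mulr_sumr.
by rewrite (chart_integral_sum _ (fun i => chart_supportedM (g i) (ce l))).2.
Qed.

(** The set in [density_integral] has a single element: two decompositions of one function are
    compared through a partition of unity on the union of all supports. *)
Lemma density_integralE m (c : 'I_m -> chart M) (g : 'I_m -> C^oo(M)) :
  (forall i, chart_supported (c i) (g i)) ->
  density_integral rho (\sum_i g i) = \sum_i chart_integral rho (c i) (g i).
Proof.
move=> cg; apply: xget_unique; first by exists m; exists c; exists g.
move=> _ [m' [c' [g' [cg' gE ->]]]].
have cK : compact (\big[setU/set0]_(i < m) supp (g i) `|` \big[setU/set0]_(i < m') supp (g' i)).
  by apply: compactU; apply: bigsetU_compact => i _; [have [] := cg i|have [] := cg' i].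
have [k [chi [chiP chi1]]] := @partition_of_unity _ (fun W => exists c, W `<=` dom c) cK
  ltac:(by move=> x _; have [e ex] := dom_cover x; exists (dom e); split; [exact: dom_open| |exists e]).
have /choice[e eP] : forall l, exists e, chart_supported e (chi l).
  by move=> l; have [W [[e We] cl lW]] := chiP l; exists e; split => // x /lW/We.
rewrite (refine_sum cg' eP); last first.
  by move=> i x gx; apply: chi1; right; rewrite (bigD1 i) //; left.
rewrite (refine_sum cg eP) ?gE // => i x gx; apply: chi1; left.
by rewrite (bigD1 i) //; left.
Qed.

End Density.
End Manifold.

(** * Linearity and nondegeneracy of integration against a density *)

Section DensityIntegral.
Variables (R : realType) (n : nat) (M : manifold R n).
Local Notation coord := Defs.coord.
Implicit Types (c d : chart M) (f g h u v : C^oo(M)) (x y z : M) (K W : set M).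

Lemma coord_integral_sum c (I : Type) (s : seq I) (p : I -> M -> R) :
  (forall i, in_chart c (p i)) ->
  in_chart c (fun x => \sum_(i <- s) p i x) /\
  coord_integral c (fun x => \sum_(i <- s) p i x) = \sum_(i <- s) coord_integral c (p i).
Proof.
move=> cp; elim: s => [|i s [IH1 IH2]].
  under eq_fun do rewrite big_nil; rewrite big_nil coord_integral0; split => //.
  split; first exact: smooth_in_cst.
  by exists set0; split => //; exact: compact0.
under eq_fun do rewrite big_cons; rewrite big_cons -IH2; split; first exact: in_chartD.
exact: coord_integralD.
Qed.

Section OneDensity.
Variable rho : predensity M.
Hypothesis rhoP : is_density rho.
Local Notation dint := (density_integral rho).

Lemma dint_chart c f : chart_supported c f -> dint f = chart_integral rho c f.
Proof.
move=> cf; have := density_integralE rhoP (m := 1) (c := fun=> c) (g := fun=> f) (fun=> cf).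
by rewrite !big_ord1.
Qed.

Lemma dintD f g : compact (supp f) -> compact (supp g) -> dint (f + g) = dint f + dint g.
Proof.
move=> /decomposition[m [c [F [cF ->]]]] /decomposition[m' [c' [G [cG ->]]]].
pose c'' (i : 'I_(m + m')) := match fintype.split i with inl j => c j | inr j => c' j end.
pose H (i : 'I_(m + m')) := match fintype.split i with inl j => F j | inr j => G j end.
have cH i : chart_supported (c'' i) (H i).
  by rewrite /c'' /H; case: fintype.split => j; [exact: cF|exact: cG].
have := density_integralE rhoP cH.
rewrite !big_split_ord /= (density_integralE rhoP cF) (density_integralE rhoP cG).
have sl (j : 'I_m) : fintype.split (lshift m' j) = inl j by exact: (unsplitK (inl j)).
have sr (j : 'I_m') : fintype.split (rshift m j) = inr j by exact: (unsplitK (inr j)).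
rewrite /H /c''.
under eq_bigr do rewrite sl; under [X in _ + X]eq_bigr do rewrite sr.
move=> ->; congr (_ + _); apply: eq_bigr => j _; first by rewrite sl.
by rewrite sr.
Qed.

Lemma dint0 : dint 0 = 0.
Proof.
have := dintD (@supp_compact0 R n M) (@supp_compact0 R n M).
by rewrite addr0 => /eqP; rewrite -subr_eq0 opprD addrA subrr sub0r oppr_eq0 => /eqP.
Qed.

Lemma dintN f : compact (supp f) -> dint (- f) = - dint f.
Proof.
move=> cf; apply/eqP; rewrite -subr_eq0 opprK addrC -dintD ?subrr ?dint0 //.
exact: supp_compactN.
Qed.

Lemma dint_sum (I : Type) (s : seq I) (F : I -> C^oo(M)) : (forall i, compact (supp (F i))) ->
  dint (\sum_(i <- s) F i) = \sum_(i <- s) dint (F i).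
Proof.
move=> cF; elim: s => [|i s IH]; first by rewrite !big_nil dint0.
by rewrite !big_cons -IH dintD //; apply: supp_compact_sum => j _; exact: cF.
Qed.

Hypothesis rho_neq0 : forall c x, dom c x -> rho c x != 0.

Lemma density_smooth c : smooth_in c (rho c).
Proof. by have [h _ _] := rhoP; exact: h. Qed.

Lemma density_out c x : ~ dom c x -> rho c x = 0.
Proof. by have [_ h _] := rhoP; exact: h. Qed.

(* Tested against [u = chi^2 f rho_c], the integrand is a square. *)
Lemma dint_nondeg f : (forall u, compact (supp u) -> dint (u * f) = 0) -> f = 0.
Proof.
move=> H; apply: cooP => x; rewrite coo0; apply: contrapT => fx0.
have [c cx] := dom_cover x.
have [chi [h1 h2 h3]] := cutoff (@dom_open _ _ M c) cx.
have [spc rc] : smooth_in c chi /\ smooth_in c (rho c) by split; [exact: coo_chart|exact: density_smooth].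
pose p z := chi z * chi z * f z * rho c z.
have p0 z : ~ supp chi z -> p z = 0 by move=> /supp_out h; rewrite /p h !mul0r.
have sp : smooth_in c p.
  by apply: smooth_inM => //; apply: smooth_inM; [exact: smooth_inM|exact: coo_chart].
pose u := mkcoo (smooth_ext0 h1 h2 sp p0).
have [cu su] := suppP (f := u) h1 p0.
have cuf : chart_supported c (u * f) by apply: chart_supportedM; split => // z /su/h2.
have := H u cu; rewrite (dint_chart cuf) chart_integralE /coord_integral.
set F := coord_integrand _ _.
have ccF : cc F.
  apply: coord_integrand_cc; apply: in_chart_mul => //; apply: in_chart_coo; last exact: cuf.2.
  exact: cuf.1.
have FE z : dom c z -> F (coord c z) = (chi z * f z * rho c z) ^+ 2.
  move=> cz; rewrite /F /coord_integrand mem_set; last exact: img_coord.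
  by rewrite paramK // cooM -[u z]/(p z) /p; ring.
suff : 0 < integral_Rn F by move=> h e; rewrite e ltxx in h.
apply: (@integral_gt0 _ _ _ (coord c x)) => //.
  move=> w; have [/img_coordK[cw <-]|nw] := pselect ((coord c @` dom c) w).
    by rewrite FE // sqr_ge0.
  by rewrite /F /coord_integrand memNset.
rewrite FE // lt_neqAle sqr_ge0 andbT eq_sym expf_eq0 /= (nbhs_singleton h3) mul1r.
by rewrite mulf_neq0 ?rho_neq0 //; apply/eqP.
Qed.

End OneDensity.

(** Function coefficients of a density may be moved onto the integrand; this is how formal densities
    are reduced to one fixed density. *)
Lemma dint_density_sum (rho : predensity M) (I : Type) (s : seq I) (phi : I -> C^oo(M))
    (sigma : I -> predensity M) f : is_density rho -> (forall i, is_density (sigma i)) ->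
  (forall c x, rho c x = \sum_(i <- s) phi i x * sigma i c x) -> compact (supp f) ->
  density_integral rho f = \sum_(i <- s) density_integral (sigma i) (phi i * f).
Proof.
move=> rhoP sP rhoE /decomposition[m [c [F [cF ->]]]].
rewrite (density_integralE rhoP cF).
transitivity (\sum_(j < m) \sum_(i <- s) chart_integral (sigma i) (c j) (phi i * F j)).
  apply: eq_bigr => j _.
  have cp i : in_chart (c j) (fun x => (phi i * F j) x * sigma i (c j) x).
    apply: in_chart_mul; last by have [h _ _] := sP i; exact: h.
    have [h1 h2] := chart_supportedM (phi i) (cF j).
    by rewrite mulrC; exact: in_chart_coo.
  rewrite chart_integralE -(coord_integral_sum s cp).2; congr coord_integral.
  by apply/funext => x; rewrite rhoE mulr_sumr; apply: eq_bigr => i _; rewrite cooM; ring.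
rewrite exchange_big; apply: eq_bigr => i _; rewrite mulr_sumr.
rewrite (density_integralE (sP i) (c := c)) // => j.
by rewrite mulrC; exact: chart_supportedM.
Qed.

End DensityIntegral.

(** * Differential operators and their transposes *)

Section ChartOperators.
Variables (R : realType) (n : nat) (M : manifold R n).
Local Notation coord := Defs.coord.
Implicit Types (c d : chart M) (f g h u v : C^oo(M)) (x y z : M) (K W : set M) (I J : seq 'I_n).
Implicit Types (p q : M -> R).

(* Set to 0 off the domain of the chart, where [coord c] is meaningless. *)
Definition cder c (i : 'I_n) p : M -> R :=
  fun z => if z \in dom c then pderiv i (p \o param c) (coord c z) else 0.

Definition cders c I p := foldr (cder c) p I.

Lemma cderE c i p z : dom c z -> cder c i p z = pderiv i (p \o param c) (coord c z).
Proof. by move=> cz; rewrite /cder mem_set. Qed.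

Lemma cder_out c i p z : ~ dom c z -> cder c i p z = 0.
Proof. by move=> cz; rewrite /cder memNset. Qed.

Lemma cder_param c i p w : (coord c @` dom c) w -> (cder c i p \o param c) w = pderiv i (p \o param c) w.
Proof. by move=> /img_coordK[cw wE] /=; rewrite cderE // wE. Qed.

Lemma cder_near c i p q z : (\forall y \near z, p y = q y) -> cder c i p z = cder c i q z.
Proof.
move=> pq; rewrite /cder; case: ifPn => // /set_mem cz.
have : nbhs (param c (coord c z)) [set y | p y = q y] by rewrite paramK.
move=> nz; apply: near_eq_derive.
have n1 : nbhs (coord c z) (param c @^-1` [set y | p y = q y]).
  exact: (param_cont (img_coord cz) nz).
by apply: filterS n1.
Qed.

Lemma near_dom c z : dom c z -> \forall y \near z, dom c y.
Proof. by move=> cz; apply: open_nbhs_nbhs; split => //; exact: dom_open. Qed.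

Lemma cder_eq c i p q : (forall z, dom c z -> p z = q z) -> cder c i p = cder c i q.
Proof.
move=> pq; apply/funext => z; have [cz|cz] := pselect (dom c z); last by rewrite !cder_out.
by apply: cder_near; apply: filterS (near_dom cz) => y /pq.
Qed.

Lemma smooth_cder c i p : smooth_in c p -> smooth_in c (cder c i p).
Proof.
move=> sp k; apply: (@Ck_eq _ _ _ _ (pderiv i (p \o param c))); first exact: img_open.
  by move=> w iw; rewrite cder_param.
exact: smooth_pderiv.
Qed.

Lemma smooth_cders c I p : smooth_in c p -> smooth_in c (cders c I p).
Proof. by move=> sp; elim: I => //= i I; exact: smooth_cder. Qed.

Let deriv_at c i p z : smooth_in c p -> dom c z -> derivable (p \o param c) (coord c z) (delta_mx 0 i).
Proof. by move=> sp cz; have [_ /(_ i)[d _]] := sp 1%N; apply: d; exact: img_coord. Qed.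

Lemma cderD c i p q z : smooth_in c p -> smooth_in c q ->
  cder c i (fun x => p x + q x) z = cder c i p z + cder c i q z.
Proof.
move=> sp sq; have [cz|cz] := pselect (dom c z); last by rewrite !cder_out // addr0.
by rewrite !cderE //; apply: deriveD; exact: deriv_at.
Qed.

Lemma cderM c i p q z : smooth_in c p -> smooth_in c q ->
  cder c i (fun x => p x * q x) z = cder c i p z * q z + p z * cder c i q z.
Proof.
move=> sp sq; have [cz|cz] := pselect (dom c z); last by rewrite !cder_out // mulr0 mul0r addr0.
rewrite !cderE //.
have := deriveM (@deriv_at c i p z sp cz) (@deriv_at c i q z sq cz).
by rewrite /= paramK // -![_ *: _]/(_ * _) addrC [q z * _]mulrC.
Qed.

Lemma cder_cst c i (a : R) z : cder c i (fun=> a) z = 0.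
Proof.
have [cz|cz] := pselect (dom c z); last by rewrite cder_out.
by rewrite cderE //; exact: derive_cst.
Qed.

Lemma cderZ c i (a : R) p z : smooth_in c p -> cder c i (fun x => a * p x) z = a * cder c i p z.
Proof. by move=> sp; rewrite cderM ?cder_cst ?mul0r ?add0r //; exact: smooth_in_cst. Qed.

Lemma chart_pderivsE c I f z : dom c z -> chart_pderivs c I f z = cders c I f z.
Proof.
elim: I z => [|i I IH] z cz; first by rewrite /chart_pderivs /= paramK.
rewrite [RHS]/= cderE // /chart_pderivs /=; apply: near_eq_derive.
apply: filterS (open_nbhs_nbhs (conj (@img_open _ _ M c) (img_coord cz))) => w /img_coordK[cw wE] /=.
by rewrite -IH // /chart_pderivs wE.
Qed.

Lemma in_chart_cder c i p : in_chart c p -> in_chart c (cder c i p).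
Proof.
move=> [sp [K [cK Kc p0]]]; split; first exact: smooth_cder.
exists K; split => // z nK; rewrite -[RHS](cder_cst c i 0 z); apply: cder_near.
by apply: filterS (open_nbhs_nbhs (conj (closed_openC (compact_closedM cK)) nK)) => y; exact: p0.
Qed.

Lemma in_chart_eq c p q : p = q -> in_chart c p -> in_chart c q.
Proof. by move=> ->. Qed.

Lemma coord_integral_cder c i p : in_chart c p -> coord_integral c (cder c i p) = 0.
Proof.
move=> cp; have scp := coord_integrand_smooth cp.
have [sp [K [cK Kc p0]]] := cp.
have [_ /(_ i)[d _]] := scp 1%N; have [_ /(_ i)[_ [dc _]]] := scp 1%N.
rewrite -(integral_pderiv (i := i) (coord_integrand_cc cp)); [|by move=> x; exact: d|by move=> x; exact: dc].
congr integral_Rn; apply/funext => w; rewrite {1}/coord_integrand.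
case: ifPn => [/set_mem iw|/negP niw].
  rewrite -[LHS]/((cder c i p \o param c) w) cder_param //; apply: near_eq_derive.
  apply: filterS (open_nbhs_nbhs (conj (@img_open _ _ M c) iw)) => y iy.
  by rewrite /coord_integrand mem_set.
have cl : closed (coord c @` K).
  by apply: compact_closed; [exact: norm_hausdorff|exact: compact_coord_img].
rewrite /pderiv -[LHS](@derive_cst R _ R 0 w (delta_mx 0 i)); apply: near_eq_derive.
have nw : (~` (coord c @` K)) w.
  by move=> [x /Kc cx xw]; apply: niw; rewrite mem_set //; exists x.
apply: filterS (open_nbhs_nbhs (conj (closed_openC cl) nw)) => y ny.
by rewrite (coord_integrand_out p0 ny).
Qed.

Definition one_in_chart c p q := [/\ smooth_in c p, smooth_in c q & in_chart c p \/ in_chart c q].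

Lemma one_in_chartM c p q : one_in_chart c p q -> in_chart c (fun x => p x * q x).
Proof.
move=> [sp sq [cp|cq]]; first exact: in_chart_mul.
by apply: (in_chart_eq _ (in_chart_mul cq sp)); apply/funext => x; rewrite mulrC.
Qed.

Lemma coord_integralN c p : in_chart c p -> coord_integral c (fun x => - p x) = - coord_integral c p.
Proof.
move=> cp; have cNp : in_chart c (fun x => - p x).
  apply: (in_chart_eq _ (in_chart_mul cp (smooth_in_cst c (-1)))).
  by apply/funext => x; rewrite mulrN1.
apply/eqP; rewrite -subr_eq0 opprK -coord_integralD //.
by under eq_fun do rewrite addNr; rewrite coord_integral0.
Qed.

Lemma by_parts c i p q : one_in_chart c p q ->
  coord_integral c (fun x => cder c i p x * q x) = coord_integral c (fun x => p x * - cder c i q x).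
Proof.
move=> pq; have [sp sq h] := pq.
have c1 : in_chart c (fun x => cder c i p x * q x).
  apply: one_in_chartM; split => //; first exact: smooth_cder.
  by case: h => h; [left; exact: in_chart_cder|right].
have c2 : in_chart c (fun x => p x * cder c i q x).
  apply: one_in_chartM; split => //; first exact: smooth_cder.
  by case: h => h; [left|right; exact: in_chart_cder].
have := coord_integral_cder i (one_in_chartM pq).
have -> : cder c i (fun x => p x * q x) = (fun x => cder c i p x * q x + p x * cder c i q x).
  by apply/funext => x; rewrite cderM.
rewrite coord_integralD // => /eqP; rewrite addr_eq0 => /eqP ->.
by rewrite -coord_integralN //; under [in RHS]eq_fun do rewrite mulrN.
Qed.

(** The formal adjoint of [cders c I] for Lebesgue measure in the coordinates: each derivative
    changes sign and the order is reversed. *)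
Fixpoint cadj c I q : M -> R :=
  if I is i :: I' then cadj c I' (fun x => - cder c i q x) else q.

Lemma by_parts_cders c I p q : one_in_chart c p q ->
  coord_integral c (fun x => cders c I p x * q x) = coord_integral c (fun x => p x * cadj c I q x).
Proof.
elim: I q => [//|i I IH] q [sp sq h] /=.
have sI := smooth_cders I sp.
have cI : in_chart c p -> in_chart c (cders c I p).
  by move=> cp; elim: I {IH sI} => //= j I; exact: in_chart_cder.
rewrite by_parts; last by split => //; case: h => [/cI|]; [left|right].
apply: IH; split => //; first exact/smooth_inN/smooth_cder.
case: h => [|cq]; first by left.
right; apply: (in_chart_eq _ (in_chart_mul (in_chart_cder i cq) (smooth_in_cst c (-1)))).
by apply/funext => x; rewrite mulrN1.
Qed.

(** Local operators of order at most [N], presented as finite sums of terms with lists of directions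
    in any order, so that derivation and composition become inductions on the terms. [ldoE] discards
    the values off [dom c]. *)
Inductive ldo c : nat -> (C^oo(M) -> M -> R) -> Prop :=
| ldo0 N : ldo c N (fun _ _ => 0)
| ldoS N a I L : smooth_in c a -> (size I <= N)%N -> ldo c N L ->
    ldo c N (fun f z => a z * cders c I f z + L f z)
| ldoE N L L' : (forall f z, dom c z -> L f z = L' f z) -> ldo c N L -> ldo c N L'.

Inductive bldo c : nat -> (C^oo(M) -> C^oo(M) -> M -> R) -> Prop :=
| bldo0 N : bldo c N (fun _ _ _ => 0)
| bldoS N a I J L : smooth_in c a -> (size I <= N)%N -> (size J <= N)%N -> bldo c N L ->
    bldo c N (fun f g z => a z * cders c I f z * cders c J g z + L f g z)
| bldoE N L L' : (forall f g z, dom c z -> L f g z = L' f g z) -> bldo c N L -> bldo c N L'.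

Lemma ldoW c N N' L : (N <= N')%N -> ldo c N L -> ldo c N' L.
Proof.
move=> NN' dL; elim: dL N' NN' => {N L} [N|N a I L sa IN _ IH|N L L' LL' _ IH] N' NN'.
- exact: ldo0.
- by apply: ldoS => //; [exact: leq_trans NN'|exact: IH].
- by apply: (ldoE LL'); exact: IH.
Qed.

Lemma bldoW c N N' L : (N <= N')%N -> bldo c N L -> bldo c N' L.
Proof.
move=> NN' dL; elim: dL N' NN' => {N L} [N|N a I J L sa IN JN _ IH|N L L' LL' _ IH] N' NN'.
- exact: bldo0.
- by apply: bldoS => //; [exact: leq_trans NN'|exact: leq_trans NN'|exact: IH].
- by apply: (bldoE LL'); exact: IH.
Qed.

Lemma ldoD c N L L' : ldo c N L -> ldo c N L' -> ldo c N (fun f z => L f z + L' f z).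
Proof.
move=> dL dL'; elim: dL L' dL' => {N L} [N|N a I L sa IN _ IH|N L L1 LL' _ IH] L' dL'.
- by apply: ldoE dL' => f z _; rewrite add0r.
- by apply: ldoE (ldoS sa IN (IH _ dL')) => f z _; rewrite addrA.
- by apply: ldoE (IH _ dL') => f z cz; rewrite LL'.
Qed.

Lemma bldoD c N L L' : bldo c N L -> bldo c N L' -> bldo c N (fun f g z => L f g z + L' f g z).
Proof.
move=> dL dL'; elim: dL L' dL' => {N L} [N|N a I J L sa IN JN _ IH|N L L1 LL' _ IH] L' dL'.
- by apply: bldoE dL' => f g z _; rewrite add0r.
- by apply: bldoE (bldoS sa IN JN (IH _ dL')) => f g z _; rewrite addrA.
- by apply: bldoE (IH _ dL') => f g z cz; rewrite LL'.
Qed.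

Lemma ldo1 c N a I : smooth_in c a -> (size I <= N)%N -> ldo c N (fun f z => a z * cders c I f z).
Proof. by move=> sa IN; apply: ldoE (ldoS sa IN (ldo0 c N)) => f z _; rewrite addr0. Qed.

Lemma bldo1 c N a I J : smooth_in c a -> (size I <= N)%N -> (size J <= N)%N ->
  bldo c N (fun f g z => a z * cders c I f z * cders c J g z).
Proof. by move=> sa IN JN; apply: bldoE (bldoS sa IN JN (bldo0 c N)) => f g z _; rewrite addr0. Qed.

Lemma ldo_sum c N (T : Type) (s : seq T) (F : T -> C^oo(M) -> M -> R) :
  (forall i, ldo c N (F i)) -> ldo c N (fun f z => \sum_(i <- s) F i f z).
Proof.
move=> dF; elim: s => [|i s IH]; first by apply: ldoE (ldo0 c N) => f z _; rewrite big_nil.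
by apply: ldoE (ldoD (dF i) IH) => f z _; rewrite big_cons.
Qed.

Lemma bldo_sum c N (T : Type) (s : seq T) (F : T -> C^oo(M) -> C^oo(M) -> M -> R) :
  (forall i, bldo c N (F i)) -> bldo c N (fun f g z => \sum_(i <- s) F i f g z).
Proof.
move=> dF; elim: s => [|i s IH]; first by apply: bldoE (bldo0 c N) => f g z _; rewrite big_nil.
by apply: bldoE (bldoD (dF i) IH) => f g z _; rewrite big_cons.
Qed.

Lemma ldoM c N a L : smooth_in c a -> ldo c N L -> ldo c N (fun f z => a z * L f z).
Proof.
move=> sa; elim=> {N L} [N|N b I L sb IN _ IH|N L L' LL' _ IH].
- by apply: ldoE (ldo0 c N) => f z _; rewrite mulr0.
- by apply: ldoE (ldoS (smooth_inM sa sb) IN IH) => f z _; rewrite mulrDr !mulrA.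
- by apply: ldoE IH => f z cz; rewrite LL'.
Qed.

Lemma bldoM c N a L : smooth_in c a -> bldo c N L -> bldo c N (fun f g z => a z * L f g z).
Proof.
move=> sa; elim=> {N L} [N|N b I J L sb IN JN _ IH|N L L' LL' _ IH].
- by apply: bldoE (bldo0 c N) => f g z _; rewrite mulr0.
- by apply: bldoE (bldoS (smooth_inM sa sb) IN JN IH) => f g z _; rewrite mulrDr !mulrA.
- by apply: bldoE IH => f g z cz; rewrite LL'.
Qed.

Lemma ldo_smooth c N L f : ldo c N L -> smooth_in c (L f).
Proof.
elim=> {N L} [N|N b I L sb IN _ IH|N L L' LL' _ IH]; first exact: smooth_in_cst.
  by apply: smooth_inD => //; apply: smooth_inM => //; apply: smooth_cders; exact: coo_chart.
by apply: smooth_in_eq IH => z; exact: LL'.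
Qed.

Lemma bldo_smooth c N L f g : bldo c N L -> smooth_in c (L f g).
Proof.
elim=> {N L} [N|N b I J L sb IN JN _ IH|N L L' LL' _ IH]; first exact: smooth_in_cst.
  apply: smooth_inD => //; apply: smooth_inM; last by apply: smooth_cders; exact: coo_chart.
  by apply: smooth_inM => //; apply: smooth_cders; exact: coo_chart.
by apply: smooth_in_eq IH => z; exact: LL'.
Qed.

Lemma ldo_der c N L i : ldo c N L -> ldo c N.+1 (fun f => cder c i (L f)).
Proof.
move=> dL; elim: dL => {N L} [N|N a I L sa IN dL IH|N L L' LL' _ IH].
- by apply: ldoE (ldo0 c N.+1) => f z _; rewrite cder_cst.
- have sI f : smooth_in c (cders c I f) by apply: smooth_cders; exact: coo_chart.
  have h1 := ldo1 (I := I) (smooth_cder i sa) (leqW IN).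
  have h2 := ldo1 (I := i :: I) (N := N.+1) sa IN.
  apply: ldoE (ldoD (ldoD h1 h2) IH) => f z _.
  by rewrite cderD ?cderM //; [exact: smooth_inM|exact: ldo_smooth dL].
- by apply: ldoE IH => f z cz; rewrite (cder_eq i (LL' f)).
Qed.

Lemma bldo_der c N L i : bldo c N L -> bldo c N.+1 (fun f g => cder c i (L f g)).
Proof.
move=> dL; elim: dL => {N L} [N|N a I J L sa IN JN dL IH|N L L' LL' _ IH].
- by apply: bldoE (bldo0 c N.+1) => f g z _; rewrite cder_cst.
- have sI (K : seq 'I_n) f : smooth_in c (cders c K f) by apply: smooth_cders; exact: coo_chart.
  have h1 := bldo1 (I := I) (J := J) (smooth_cder i sa) (leqW IN) (leqW JN).
  have h2 := bldo1 (I := i :: I) (J := J) (N := N.+1) sa IN (leqW JN).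
  have h3 := bldo1 (I := I) (J := i :: J) (N := N.+1) sa (leqW IN) JN.
  apply: bldoE (bldoD (bldoD (bldoD h1 h2) h3) IH) => f g z _.
  have sa' := smooth_inM sa (sI I f).
  rewrite cderD ?cderM //; [by rewrite mulrDl|exact: smooth_inM|exact: bldo_smooth dL].
- by apply: bldoE IH => f g z cz; rewrite (cder_eq i (LL' f g)).
Qed.

Lemma ldo_ders c N L I : ldo c N L -> ldo c (size I + N) (fun f => cders c I (L f)).
Proof. by move=> dL; elim: I => //= i I; exact: ldo_der. Qed.

Lemma ldo_comp c N N' L (A : C^oo(M) -> C^oo(M)) : ldo c N L -> ldo c N' (fun f z => A f z) ->
  ldo c (N + N') (fun f => L (A f)).
Proof.
move=> dL dA; elim: dL => {N L} [N|N a I L sa IN dL IH|N L L' LL' _ IH].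
- exact: ldo0.
- apply: ldoD => //; apply: ldoM => //.
  by apply: ldoW (ldo_ders I dA); rewrite leq_add2r.
- by apply: ldoE IH => f z cz; exact: LL'.
Qed.

Lemma bldo_cadj c N L I : bldo c N L -> bldo c (size I + N) (fun f g => cadj c I (L f g)).
Proof.
elim: I N L => [//|i I IH] N L dL /=; rewrite addSnnS.
apply: IH; apply: bldoE (bldoM (smooth_in_cst c (-1)) (bldo_der i dL)) => f g z _.
by rewrite mulN1r.
Qed.

Lemma bldo_ldol c N L g : bldo c N L -> ldo c N (fun f => L f g).
Proof.
elim=> {N L} [N|N a I J L sa IN JN dL IH|N L L' LL' _ IH].
- exact: ldo0.
- have sJ : smooth_in c (fun z => a z * cders c J g z).
    by apply: smooth_inM => //; apply: smooth_cders; exact: coo_chart.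
  by apply: ldoE (ldoS sJ IN IH) => f z _; rewrite mulrAC.
- by apply: ldoE IH => f z cz; exact: LL'.
Qed.

Lemma bldo_ldor c N L f : bldo c N L -> ldo c N (fun g => L f g).
Proof.
elim=> {N L} [N|N a I J L sa IN JN dL IH|N L L' LL' _ IH].
- exact: ldo0.
- have sI : smooth_in c (fun z => a z * cders c I f z).
    by apply: smooth_inM => //; apply: smooth_cders; exact: coo_chart.
  by apply: ldoE (ldoS sI JN IH) => g z _.
- by apply: ldoE IH => g z cz; exact: LL'.
Qed.

Lemma cders_near c I p q z : (\forall y \near z, p y = q y) -> cders c I p z = cders c I q z.
Proof.
move=> pq; suff h : \forall y \near z, cders c I p y = cders c I q y by exact: nbhs_singleton h.
elim: I => //= i I IH.
have := nbhs_interior IH.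
by apply: filterS => y; exact: cder_near.
Qed.

Lemma cders0 c I z : cders c I (fun=> 0) z = 0.
Proof.
elim: I z => //= i I IH z; rewrite -[RHS](cder_cst c i 0 z); congr cder; exact/funext.
Qed.

Lemma cdersD c I p q : smooth_in c p -> smooth_in c q ->
  cders c I (fun x => p x + q x) = (fun z => cders c I p z + cders c I q z).
Proof.
move=> sp sq; elim: I => //= i I ->; apply/funext => z.
by rewrite cderD //; exact: smooth_cders.
Qed.

Lemma cdersZ c I (a : R) p : smooth_in c p ->
  cders c I (fun x => a * p x) = (fun z => a * cders c I p z).
Proof.
move=> sp; elim: I => //= i I ->; apply/funext => z.
by rewrite cderZ //; exact: smooth_cders.
Qed.

Lemma ldo_local c N L f z : ldo c N L -> dom c z -> (\forall y \near z, f y = 0) -> L f z = 0.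
Proof.
move=> dL cz f0; elim: dL => {N L} [//|N a I L sa IN dL IH|N L L' LL' _ IH].
  by rewrite IH addr0 (cders_near _ _ f0) cders0 mulr0.
by rewrite -LL'.
Qed.

Lemma ldo_linear c N L (a : R) f g z : ldo c N L -> dom c z ->
  L (a *: f + g) z = a * L f z + L g z.
Proof.
move=> dL cz; elim: dL => {N L} [N|N b I L sb IN dL IH|N L L' LL' _ IH].
- by rewrite mulr0 addr0.
- rewrite IH; have -> : cders c I (a *: f + g) z = a * cders c I f z + cders c I g z.
    rewrite -[LHS]/(cders c I (fun x => (fun y => a * f y) x + g x) z) cdersD.
    + by rewrite cdersZ //; exact: coo_chart.
    + by apply: smooth_inM; [exact: smooth_in_cst|exact: coo_chart].
    + exact: coo_chart.
  by ring.
- by rewrite -!LL'.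
Qed.

(** Places a single term in the coefficient array of [diffop], whose lists are grouped by length. *)
Lemma sum_tuple_pick N (F : seq 'I_n -> R) I : (size I <= N)%N ->
  \sum_(k < N.+1) \sum_(K : k.-tuple 'I_n) (if (K : seq 'I_n) == I then F K else 0) = F I.
Proof.
move=> IN; rewrite (bigD1 (Ordinal (IN : (size I < N.+1)%N))) //= (bigD1 (in_tuple I)) //= eqxx.
rewrite big1 ?addr0; last first.
  move=> K KI; case: eqP => // h; move: KI; rewrite (_ : K = in_tuple I) ?eqxx //.
  exact/val_inj.
rewrite big1 ?addr0 // => k kI; apply: big1 => K _; case: eqP => // h.
by move: kI; rewrite -val_eqE /= -h size_tuple eqxx.
Qed.

Definition ldiff (A : C^oo(M) -> C^oo(M)) := exists N, forall c, ldo c N (fun f z => A f z).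
Definition bldiff (B : C^oo(M) -> C^oo(M) -> C^oo(M)) :=
  exists N, forall c, bldo c N (fun f g z => B f g z).

Lemma diffopP A : diffop A <-> ldiff A.
Proof.
split=> [[N AP]|[N AP]]; exists N => c.
  have [a [sa aE]] := AP c.
  have h : ldo c N (fun f z => \sum_(k < N.+1) \sum_(I : k.-tuple 'I_n) a I z * cders c I f z).
    apply: ldo_sum => k; apply: ldo_sum => I; apply: ldo1 => //.
    by rewrite size_tuple -ltnS.
  apply: ldoE h => f z cz; rewrite aE //; apply: eq_bigr => k _; apply: eq_bigr => I _.
  by rewrite chart_pderivsE.
suff main L : ldo c N L -> exists a : seq 'I_n -> M -> R, (forall I, smooth_in c (a I)) /\
    forall f z, dom c z -> L f z = \sum_(k < N.+1) \sum_(I : k.-tuple 'I_n) a I z * cders c I f z.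
  have [a [sa aE]] := main _ (AP c).
  exists a; split => // f z cz; rewrite aE //; apply: eq_bigr => k _; apply: eq_bigr => I _.
  by rewrite chart_pderivsE.
elim=> {N AP L} [N|N b I L sb IN _ [a [sa aE]]|N L L' LL' _ [a [sa aE]]].
- exists (fun _ _ => 0); split; first by move=> I; exact: smooth_in_cst.
  by move=> f z _; rewrite big1 // => k _; rewrite big1 // => I _; rewrite mul0r.
- exists (fun J z => (if J == I then b z else 0) + a J z); split.
    move=> J; apply: (smooth_inD (p := fun z => if J == I then b z else 0)); last exact: sa.
    by case: (J == I); [exact: sb|exact: smooth_in_cst].
  move=> f z cz; rewrite aE // -{1}(sum_tuple_pick (fun I => b z * cders c I f z) IN).
  rewrite -big_split; apply: eq_bigr => k _; rewrite -big_split; apply: eq_bigr => J _ /=.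
  by rewrite mulrDl; case: ifP => // _; rewrite mul0r.
- by exists a; split => // f z cz; rewrite -LL' // aE.
Qed.

Lemma bidiffopP B : bidiffop B -> bldiff B.
Proof.
move=> [N BP]; exists N => c; have [b [sb bE]] := BP c.
have h : bldo c N (fun f g z => \sum_(k < N.+1) \sum_(I : k.-tuple 'I_n)
   \sum_(l < N.+1) \sum_(J : l.-tuple 'I_n) b I J z * cders c I f z * cders c J g z).
  apply: bldo_sum => k; apply: bldo_sum => I; apply: bldo_sum => l; apply: bldo_sum => J.
  by apply: bldo1 => //; rewrite size_tuple -ltnS.
apply: bldoE h => f g z cz; rewrite bE //.
apply: eq_bigr => k _; apply: eq_bigr => I _; apply: eq_bigr => l _; apply: eq_bigr => J _.
by rewrite !chart_pderivsE.
Qed.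

Lemma ldiff_linear A (a : R) f g : ldiff A -> A (a *: f + g) = a *: A f + A g.
Proof.
move=> [N AP]; apply: cooP => z; have [c cz] := dom_cover z.
by rewrite (ldo_linear a f g (AP c) cz).
Qed.

Lemma ldiffD A f g : ldiff A -> A (f + g) = A f + A g.
Proof. by move=> dA; have := ldiff_linear 1 f g dA; rewrite !scale1r. Qed.

Lemma ldiff0 A : ldiff A -> A 0 = 0.
Proof.
by move=> dA; have := ldiff_linear (-1) 0 0 dA; rewrite !scaleN1r !addNr.
Qed.

Lemma ldiffZ A (a : R) f : ldiff A -> A (a *: f) = a *: A f.
Proof. by move=> dA; have := ldiff_linear a f 0 dA; rewrite !addr0 ldiff0 // addr0. Qed.

Lemma ldiff_sum A (T : Type) (s : seq T) (P : pred T) (F : T -> C^oo(M)) : ldiff A ->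
  A (\sum_(i <- s | P i) F i) = \sum_(i <- s | P i) A (F i).
Proof.
move=> dA; elim/big_rec2: _ => [|i f g _ <-]; first exact: ldiff0.
exact: ldiffD.
Qed.

Lemma ldiff_near A f g z : ldiff A -> (\forall y \near z, f y = g y) -> A f z = A g z.
Proof.
move=> dA fg; have [N AP] := dA; have [c cz] := dom_cover z.
have h : A (f - g) z = 0.
  apply: (ldo_local (AP c)) => //; apply: filterS fg => y e.
  by rewrite cooD cooN e subrr.
rewrite -[f](subrK g) ldiffD // cooD h add0r //.
Qed.

Lemma ldiff_supp A f : ldiff A -> compact (supp f) -> compact (supp (A f)) /\ supp (A f) `<=` supp f.
Proof.
move=> dA cf; apply: suppP => // z nz.
rewrite (ldiff_near (g := 0) dA) ?ldiff0 //.
apply: filterS (open_nbhs_nbhs (conj (closed_openC (compact_closedM cf)) nz)) => y.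
exact: supp_out.
Qed.

Lemma ldiff_comp A B : ldiff A -> ldiff B -> ldiff (A \o B).
Proof. by move=> [N AP] [N' BP]; exists (N + N')%N => c; exact: ldo_comp (AP c) (BP c). Qed.

Lemma ldiff_add A B : ldiff A -> ldiff B -> ldiff (fun f => A f + B f).
Proof.
move=> [N AP] [N' BP]; exists (maxn N N') => c.
apply: ldoE (ldoD (ldoW (leq_maxl N N') (AP c)) (ldoW (leq_maxr N N') (BP c))) => f z _.
by rewrite cooD.
Qed.

Lemma ldiff_zero : ldiff (fun=> 0).
Proof. by exists 0%N => c; exact: ldo0. Qed.

Lemma ldiff_opp A : ldiff A -> ldiff (fun f => - A f).
Proof.
move=> [N AP]; exists N => c; apply: ldoE (ldoM (smooth_in_cst c (-1)) (AP c)) => f z _.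
by rewrite mulN1r.
Qed.

Lemma ldiff_bigsum (T : Type) (s : seq T) (P : pred T) (A : T -> C^oo(M) -> C^oo(M)) :
  (forall i, P i -> ldiff (A i)) -> ldiff (fun f => \sum_(i <- s | P i) A i f).
Proof.
move=> dA; elim: s => [|i s IH].
  by under eq_fun do rewrite big_nil; exact: ldiff_zero.
case Pi : (P i); last by under eq_fun do rewrite big_cons Pi.
by under eq_fun do rewrite big_cons Pi; apply: ldiff_add => //; exact: dA.
Qed.

Lemma ldiff_mul g : ldiff (fun f => g * f).
Proof.
exists 0%N => c; have := ldo1 (I := [::]) (N := 0%N) (@coo_chart _ _ _ c g) isT.
exact.
Qed.

Lemma ldiff_id : ldiff id.
Proof.
exists 0%N => c; apply: ldoE (ldo1 (I := [::]) (N := 0%N) (smooth_in_cst c 1) isT) => f z _.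
by rewrite mul1r.
Qed.

Lemma bldiff_l B g : bldiff B -> ldiff (fun f => B f g).
Proof. by move=> [N BP]; exists N => c; have := bldo_ldol g (BP c). Qed.

Lemma bldiff_r B f : bldiff B -> ldiff (B f).
Proof. by move=> [N BP]; exists N => c; have := bldo_ldor f (BP c). Qed.

(** Turns an operator into a bidifferential one, so that its transpose comes from the bidifferential
    case at [g = 1]. *)
Lemma bldiff_mulr A : ldiff A -> bldiff (fun f g => A f * g).
Proof.
move=> [N AP]; exists N => c.
suff main L : ldo c N L -> bldo c N (fun f g z => L f z * g z) by exact: main (AP c).
elim=> {AP N L} [N|N a I L sa IN _ IH|N L L' LL' _ IH].
- by apply: bldoE (bldo0 c N) => f g z _; rewrite mul0r.
- by apply: bldoE (bldoS (J := [::]) sa IN (leq0n N) IH) => f g z _ /=; rewrite mulrDl.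
- by apply: bldoE IH => f g z cz; rewrite LL'.
Qed.

End ChartOperators.

(** * Transposition of bidifferential operators against one density *)

Section Transpose.
Variables (R : realType) (n : nat) (M : manifold R n).
Variable rho : predensity M.
Hypothesis rhoP : is_density rho.
Hypothesis rho_neq0 : forall c x, dom c x -> rho c x != 0.
Implicit Types (c d : chart M) (f g h u v : C^oo(M)) (x y z : M) (K W : set M) (I J : seq 'I_n).
Local Notation dint := (density_integral rho).

Lemma ldo_in_chart c N L u : ldo c N L -> in_chart c u -> in_chart c (fun x => L u x * rho c x).
Proof.
move=> dL [su [K [cK Kc u0]]]; split.
  by apply: smooth_inM; [exact: ldo_smooth dL|exact: density_smooth].
exists K; split => // z nK; have [cz|cz] := pselect (dom c z); last first.
  by rewrite (density_out rhoP) // mulr0.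
rewrite (ldo_local dL cz) ?mul0r //.
by apply: filterS (open_nbhs_nbhs (conj (closed_openC (compact_closedM cK)) nK)) => y; exact: u0.
Qed.

Lemma bldo_in_chart_l c N L u f v : bldo c N L -> [\/ in_chart c u, in_chart c f | in_chart c v] ->
  in_chart c (fun x => L u f x * v x * rho c x).
Proof.
move=> dL [cu|cf|cv].
- apply: (in_chart_eq _ (in_chart_mul (ldo_in_chart (bldo_ldol f dL) cu) (@coo_chart _ _ _ c v))).
  by apply/funext => x; rewrite mulrAC.
- apply: (in_chart_eq _ (in_chart_mul (ldo_in_chart (bldo_ldor u dL) cf) (@coo_chart _ _ _ c v))).
  by apply/funext => x; rewrite mulrAC.
- apply: (in_chart_eq _ (in_chart_mul cv (smooth_inM (bldo_smooth u f dL) (density_smooth rhoP c)))).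
  by apply/funext => x; ring.
Qed.

Lemma bldo_in_chart_r c N L u f v : bldo c N L -> [\/ in_chart c u, in_chart c f | in_chart c v] ->
  in_chart c (fun x => u x * L f v x * rho c x).
Proof.
move=> dL [cu|cf|cv].
- apply: (in_chart_eq _ (in_chart_mul cu (smooth_inM (bldo_smooth f v dL) (density_smooth rhoP c)))).
  by apply/funext => x; rewrite mulrA.
- apply: (in_chart_eq _ (in_chart_mul (ldo_in_chart (bldo_ldol v dL) cf) (@coo_chart _ _ _ c u))).
  by apply/funext => x; ring.
- apply: (in_chart_eq _ (in_chart_mul (ldo_in_chart (bldo_ldor f dL) cv) (@coo_chart _ _ _ c u))).
  by apply/funext => x; ring.
Qed.

Lemma in_chart_cders c I p : in_chart c p -> in_chart c (cders c I p).
Proof. by move=> cp; elim: I => //= j I; exact: in_chart_cder. Qed.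

(** A term [a * D^I u * D^J f] contributes [(1 / rho) * adj_I (a * rho * D^J f * v)]. This is
    bidifferential in [f] and [v], and since up to [N] further derivatives fall on [D^J f] the order
    is bounded by [N + N]. *)
Lemma bldo_transpose c N L : bldo c N L -> exists2 Lt, bldo c (N + N) Lt &
  forall u f v, [\/ in_chart c u, in_chart c f | in_chart c v] ->
    coord_integral c (fun x => L u f x * v x * rho c x) =
    coord_integral c (fun x => u x * Lt f v x * rho c x).
Proof.
elim=> {N L} [N|N a I J L sa IN JN dL [Lt dLt LtP]|N L L' LL' _ [Lt dLt LtP]].
- exists (fun _ _ _ => 0) => [|u f v _]; first exact: bldo0.
  by congr coord_integral; apply/funext => x; rewrite mulr0 !mul0r.
- have sr := density_smooth rhoP c.
  pose q f v x := a x * rho c x * cders c J f x * cders c [::] v x.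
  have dq : bldo c N q by apply: bldo1 => //; exact: smooth_inM.
  pose L1 f v x := (rho c x)^-1 * cadj c I (q f v) x.
  have dL1 : bldo c (N + N) L1.
    apply: bldoM; first by apply: smooth_inV => // x; exact: rho_neq0.
    by apply: bldoW (bldo_cadj I dq); rewrite leq_add2r.
  exists (fun f v x => L1 f v x + Lt f v x); first exact: bldoD.
  move=> u f v uv; have dt := bldo1 (I := I) (J := J) sa IN JN.
  have -> : (fun x => (a x * cders c I u x * cders c J f x + L u f x) * v x * rho c x) =
      (fun x => a x * cders c I u x * cders c J f x * v x * rho c x + L u f x * v x * rho c x).
    by apply/funext => x; ring.
  rewrite coord_integralD; [|exact: bldo_in_chart_l dt uv|exact: bldo_in_chart_l dL uv].
  have -> : (fun x => u x * (L1 f v x + Lt f v x) * rho c x) =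
      (fun x => u x * L1 f v x * rho c x + u x * Lt f v x * rho c x).
    by apply/funext => x; ring.
  rewrite coord_integralD; [|exact: bldo_in_chart_r dL1 uv|exact: bldo_in_chart_r dLt uv].
  rewrite LtP //; congr (_ + _).
  have -> : (fun x => a x * cders c I u x * cders c J f x * v x * rho c x) =
      (fun x => cders c I u x * q f v x) by apply/funext => x; rewrite /q /=; ring.
  rewrite by_parts_cders; last first.
    split; [exact: coo_chart|exact: bldo_smooth dq|case: uv => h; [by left|right|right]].
      apply: (in_chart_eq _ (in_chart_mul (in_chart_cders J h) (_ : smooth_in c (fun x => a x * rho c x * v x)))).
        by apply/funext => x; rewrite /q /=; ring.
      by apply: smooth_inM; [exact: smooth_inM|exact: coo_chart].
    apply: (in_chart_eq _ (in_chart_mul h (_ : smooth_in c (fun x => a x * rho c x * cders c J f x)))).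
      by apply/funext => x; rewrite /q /=; ring.
    by apply: smooth_inM; [exact: smooth_inM|apply: smooth_cders; exact: coo_chart].
  apply: eq_coord_integral => x cx; rewrite /L1.
  by field; exact: rho_neq0.
- exists Lt => // u f v uv; rewrite -LtP //; apply: eq_coord_integral => x cx.
  by rewrite LL'.
Qed.

Lemma chart_supportedC c f g : chart_supported c g -> chart_supported c (f * g).
Proof. by rewrite mulrC; exact: chart_supportedM. Qed.

Lemma ldiff_chart_supported c A f : ldiff A -> chart_supported c f -> chart_supported c (A f).
Proof. by move=> dA [cf fc]; have [h1 h2] := ldiff_supp dA cf; split => // x /h2/fc. Qed.

Lemma bldiff_transpose B : bldiff B -> exists2 Bt, bldiff Bt &
  forall u f v, [\/ compact (supp u), compact (supp f) | compact (supp v)] -> dint (B u f * v) = dint (u * Bt f v).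
Proof.
move=> dB; have [N BP] := dB.
have /choice[Lt LtP] : forall c, exists Lt, bldo c (N + N) Lt /\
    forall u f v, [\/ in_chart c u, in_chart c f | in_chart c v] ->
    coord_integral c (fun x => B u f x * v x * rho c x) =
    coord_integral c (fun x => u x * Lt f v x * rho c x).
  by move=> c; have [Lt h1 h2] := bldo_transpose (BP c); exists Lt.
(* Cut off by [chi] near [x], both local transposes pair with every compactly supported [u] to the
   integral of [B (u * chi) f * v]; nondegeneracy makes them equal. *)
have agree c d f v x : dom c x -> dom d x -> Lt c f v x = Lt d f v x.
  move=> cx dx.
  have oW : open (dom c `&` dom d) by apply: openI; exact: dom_open.
  have [chi [h1 h2 h3]] := cutoff oW (conj cx dx).
  have local e : supp chi `<=` dom e -> exists p : C^oo(M),
      [/\ forall z, p z = chi z * Lt e f v z, chart_supported e p &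
      forall u, compact (supp u) -> dint (u * p) = dint (B (u * chi) f * v)].
    move=> se; have p0 z : ~ supp chi z -> chi z * Lt e f v z = 0.
      by move=> /supp_out ->; rewrite mul0r.
    have sp : smooth_in e (fun z => chi z * Lt e f v z).
      by apply: smooth_inM; [exact: coo_chart|exact: bldo_smooth (LtP e).1].
    pose p := mkcoo (smooth_ext0 h1 se sp p0).
    have [cp sup] := suppP (f := p) h1 p0.
    have csp : chart_supported e p by split => // z /sup/se.
    exists p; split => // u cu.
    have cuchi : chart_supported e (u * chi) by apply: chart_supportedC.
    have cB : chart_supported e (B (u * chi) f * v).
      by apply: chart_supportedM; exact: (ldiff_chart_supported (bldiff_l f dB) cuchi).
    rewrite (dint_chart rhoP (chart_supportedC u csp)) (dint_chart rhoP cB).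
    rewrite !chart_integralE [RHS]((LtP e).2 (u * chi) f v); last first.
      by constructor 1; apply: in_chart_coo; have [] := cuchi.
    congr coord_integral; apply/funext => z; rewrite !cooM -[p z]/(chi z * Lt e f v z).
    by rewrite mulrA.
  have [p [pE cp pP]] := local c (fun _ sz => (h2 _ sz).1).
  have [q [qE cq qP]] := local d (fun _ sz => (h2 _ sz).2).
  have pq : p - q = 0.
    apply: (dint_nondeg rhoP rho_neq0) => u cu.
    rewrite mulrBr dintD //; last first.
    - by apply: supp_compactN; exact: (suppM_l q cu).1.
    - exact: (suppM_l p cu).1.
    by rewrite dintN ?pP ?qP ?subrr //; exact: (suppM_l q cu).1.
  have : p x = q x by have /subr0_eq -> := pq.
  by rewrite pE qE (nbhs_singleton h3) !mul1r.
have [cx cxP] : exists cx : M -> chart M, forall x, dom (cx x) x.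
  by have /choice[cx ?] := @dom_cover _ _ M; exists cx.
have sm f v : smooth (fun x => Lt (cx x) f v x).
  apply: smooth_local => x; exists (cx x); exists (dom (cx x)).
  split => //; first exact: dom_open.
  apply: (@smooth_in_eq _ _ _ (cx x) (Lt (cx x) f v)) => [z cz|]; first exact: agree.
  exact: bldo_smooth (LtP _).1.
pose Bt f v := mkcoo (sm f v).
have dBt : bldiff Bt.
  by exists (N + N)%N => c; apply: bldoE (LtP c).1 => f v z cz; exact: agree.
exists Bt => // u f v uv.
have key c u' f' v' : [\/ chart_supported c u', chart_supported c f' | chart_supported c v'] ->
    dint (B u' f' * v') = dint (u' * Bt f' v').
  move=> uv'.
  have c1 : chart_supported c (B u' f' * v').
    case: uv' => h; [| |exact: chart_supportedC]; apply: chart_supportedM.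
      exact: (ldiff_chart_supported (bldiff_l f' dB) h).
    exact: (ldiff_chart_supported (bldiff_r u' dB) h).
  have c2 : chart_supported c (u' * Bt f' v').
    case: uv' => h; [exact: chart_supportedM| |]; apply: chart_supportedC.
      exact: (ldiff_chart_supported (bldiff_l v' dBt) h).
    exact: (ldiff_chart_supported (bldiff_r f' dBt) h).
  rewrite (dint_chart rhoP c1) (dint_chart rhoP c2) !chart_integralE.
  rewrite [LHS]((LtP c).2 u' f' v'); last first.
    by case: uv' => -[h1 h2]; [constructor 1|constructor 2|constructor 3]; exact: in_chart_coo.
  by apply: eq_coord_integral => x cx'; rewrite cooM; congr (_ * _ * _); exact: agree.
(* Whichever argument has compact support is decomposed into pieces supported in charts, where [key]
   applies. *)
case: uv => [/decomposition|/decomposition|/decomposition] [m [c [F [cF ->]]]].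
- rewrite (ldiff_sum _ _ _ (bldiff_l f dB)) !mulr_suml !dint_sum //.
  + by apply: eq_bigr => i _; apply: (key (c i)); constructor 1.
  + by move=> i; exact: (chart_supportedM _ (cF i)).1.
  + by move=> i; exact: (chart_supportedM _ (ldiff_chart_supported (bldiff_l f dB) (cF i))).1.
- rewrite (ldiff_sum _ _ _ (bldiff_r u dB)) (ldiff_sum _ _ _ (bldiff_l v dBt)).
  rewrite mulr_suml mulr_sumr !dint_sum //.
  + by apply: eq_bigr => i _; apply: (key (c i)); constructor 2.
  + by move=> i; exact: (chart_supportedC _ (ldiff_chart_supported (bldiff_l v dBt) (cF i))).1.
  + by move=> i; exact: (chart_supportedM _ (ldiff_chart_supported (bldiff_r u dB) (cF i))).1.
- rewrite (ldiff_sum _ _ _ (bldiff_r f dBt)) !mulr_sumr !dint_sum //.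
  + by apply: eq_bigr => i _; apply: (key (c i)); constructor 3.
  + by move=> i; exact: (chart_supportedC _ (ldiff_chart_supported (bldiff_r f dBt) (cF i))).1.
  + by move=> i; exact: (chart_supportedC _ (cF i)).1.
Qed.

End Transpose.

(** * Formal operators *)

Section TriangularSums.
Variable V : zmodType.
Implicit Types (r : nat).

Lemma conv_sym (F : nat -> nat -> V) r :
  \sum_(i < r.+1) F i (r - i)%N = \sum_(i < r.+1) F (r - i)%N i.
Proof.
rewrite [RHS](reindex_inj rev_ord_inj) /=; apply: eq_bigr => i _.
by rewrite subSS subKn // -ltnS.
Qed.

(** Triples of indices with sum [r], regrouped by the sum of the first two; this is the
    associativity of all the Cauchy products below. *)
Lemma conv_assoc (F : nat -> nat -> nat -> V) r :
  \sum_(i < r.+1) \sum_(j < (r - i).+1) F i j (r - i - j)%N =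
  \sum_(k < r.+1) \sum_(i < k.+1) F i (k - i)%N (r - k)%N.
Proof.
transitivity (\sum_(i < r.+1) \sum_(k < r.+1 | (i <= k)%N) F i (k - i)%N (r - k)%N).
  apply: eq_bigr => i _; have ir : (i <= r)%N by rewrite -ltnS.
  rewrite -(big_mkord xpredT (fun j => F i j (r - i - j)%N)).
  rewrite -(big_mkord (fun k => (i <= k)%N) (fun k => F i (k - i)%N (r - k)%N)).
  rewrite [RHS](@big_cat_nat _ _ _ i) //=; last exact: leqW.
  rewrite [X in _ = X + _]big_nat_cond [X in _ = X + _]big1 ?add0r; last first.
    by move=> k /andP[/andP[_ ki] ik]; move: ki; rewrite ltnNge ik.
  have -> : \sum_(i <= k < r.+1 | (i <= k)%N) F i (k - i)%N (r - k)%N =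
      \sum_(0 + i <= k < r.+1 | (i <= k)%N) F i (k - i)%N (r - k)%N by rewrite add0n.
  rewrite big_addn subSn //.
  rewrite [LHS]big_nat_cond [RHS]big_nat_cond; apply: eq_big => [j|j _].
    by rewrite leq_addl andbT.
  by rewrite addnK subnDA subnAC.
rewrite (exchange_big_dep xpredT) //=; apply: eq_bigr => k _.
by rewrite (big_ord_widen_cond r.+1 xpredT (fun i => F i (k - i)%N (r - k)%N)) //=.
Qed.

Lemma conv_swap (F : nat -> nat -> nat -> V) r :
  \sum_(i < r.+1) \sum_(j < (r - i).+1) F i j (r - i - j)%N =
  \sum_(j < r.+1) \sum_(i < (r - j).+1) F i j (r - j - i)%N.
Proof.
rewrite conv_assoc (conv_assoc (fun j i k => F i j k)); apply: eq_bigr => k _.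
exact: (conv_sym (fun i j => F i j (r - k)%N)).
Qed.

Lemma conv_rot (F : nat -> nat -> nat -> V) r :
  \sum_(i < r.+1) \sum_(j < (r - i).+1) F i j (r - i - j)%N =
  \sum_(i < r.+1) \sum_(k < (r - i).+1) F i (r - i - k)%N k.
Proof. by apply: eq_bigr => i _; exact: (conv_sym (fun j k => F i j k)). Qed.

End TriangularSums.

(** The recursion behind equations solved order by order in nu. *)
Lemma strong_recursion (T : Type) (step : seq T -> T) :
  exists b : nat -> T, forall r, b r = step (mkseq b r).
Proof.
pose h r := iter r (fun s => rcons s (step s)) [::].
exists (fun r => step (h r)) => r; congr step.
by elim: r => // r IH; rewrite mkseqS -IH.
Qed.

(** * Formal differential operators and their inverses *)

Section FormalOperators.
Variables (R : realType) (n : nat) (M : manifold R n).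
Implicit Types (f g : C^oo(M)) (u v w : formal M) (a b : nat -> C^oo(M) -> C^oo(M)).

Definition fop a : formal M -> formal M := fun u r => \sum_(i < r.+1) a i (u (r - i)%N).

Definition ldiffs a := forall r, ldiff (a r).

Lemma formalP u v : (forall r, u r = v r) -> u = v.
Proof. by move=> uv; apply/funext. Qed.

Lemma formalD u v r : (u + v) r = u r + v r. Proof. by []. Qed.

Lemma fdiffopP (A : formal M -> formal M) : fdiffop A <-> exists2 a, ldiffs a & A = fop a.
Proof.
split=> [[a da AE]|[a da ->]]; exists a => //.
- by move=> r; apply/diffopP.
- by apply/funext => u; apply/funext => r; exact: AE.
- by move=> r; apply/diffopP.
Qed.

Lemma fdiffop_fop a : ldiffs a -> fdiffop (fop a).
Proof. by move=> da; apply/fdiffopP; exists a. Qed.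

Lemma fop_comp a b : ldiffs a ->
  fop a \o fop b = fop (fun s f => \sum_(i < s.+1) a i (b (s - i)%N f)).
Proof.
move=> da; apply/funext => u; apply: formalP => r; rewrite /fop /=.
under eq_bigr do rewrite ldiff_sum //.
exact: (conv_assoc (fun i j k => a i (b j (u k)))).
Qed.

Lemma fdiffop_comp (A B : formal M -> formal M) : fdiffop A -> fdiffop B -> fdiffop (A \o B).
Proof.
move=> /fdiffopP[a da ->] /fdiffopP[b db ->]; rewrite fop_comp //; apply: fdiffop_fop => s.
by apply: ldiff_bigsum => i _; exact: ldiff_comp.
Qed.

Lemma fdiffopD (A : formal M -> formal M) u v : fdiffop A -> A (u + v) = A u + A v.
Proof.
move=> /fdiffopP[a da ->]; apply: formalP => r; rewrite formalD /fop -big_split.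
by apply: eq_bigr => i _; exact: ldiffD.
Qed.

Lemma fdiffop_scale (A : formal M -> formal M) (t : nat -> R) u : fdiffop A ->
  A (fscale t u) = fscale t (A u).
Proof.
move=> /fdiffopP[a da ->]; apply: formalP => r; rewrite /fop /fscale.
under eq_bigr do rewrite ldiff_sum //.
under [RHS]eq_bigr do rewrite scaler_sumr.
rewrite (conv_swap (fun i j k => a i (t j *: u k))).
by apply: eq_bigr => i _; apply: eq_bigr => j _; exact: ldiffZ.
Qed.

Lemma fdiffop_near (A : formal M -> formal M) u v x : fdiffop A ->
  (forall i, \forall y \near x, u i y = v i y) -> forall r, A u r x = A v r x.
Proof.
move=> /fdiffopP[a da ->] uv r; rewrite /fop !coo_sum.
by apply: eq_bigr => i _; exact: ldiff_near.
Qed.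

(** The coefficients can be read off functions free of nu: order [r] of [A (fconst f)] is
    [a r f]. *)
Lemma fdiffop_eq (A B : formal M -> formal M) : fdiffop A -> fdiffop B ->
  (forall f, A (fconst f) = B (fconst f)) -> A = B.
Proof.
move=> /fdiffopP[a da ->] /fdiffopP[b db ->] ab.
have E c r f : ldiffs c -> fop c (fconst f) r = c r f.
  move=> dc; rewrite /fop big_ord_recr /= subnn big1 ?add0r // => i _.
  by rewrite /fconst subn_eq0 leqNgt ltn_ord /= ldiff0.
apply/funext => u; apply: formalP => r; apply: eq_bigr => i _.
by rewrite -!E // ab.
Qed.

Lemma fdiffop_compact (A : formal M -> formal M) u : fdiffop A -> fcompact u -> fcompact (A u).
Proof.
move=> /fdiffopP[a da ->] cu r; apply: supp_compact_sum => i _.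
exact: (ldiff_supp (da i) (cu _)).1.
Qed.

Lemma fop_id a : (forall r f, a r f = if r == 0%N then f else 0) -> fop a = id.
Proof.
move=> aE; apply/funext => u; apply: formalP => r; rewrite /fop big_ord_recl aE /= subn0.
by rewrite big1 ?addr0 // => i _; rewrite aE.
Qed.

Lemma fop_right_inverse a : ldiffs a -> a 0%N = id ->
  exists b, [/\ ldiffs b, b 0%N = id & fop a \o fop b = id].
Proof.
move=> da a0.
(* Order [r.+1] of the equation reads [b r.+1 = - \sum_i a i.+1 (b (r - i))]; when [s] lists [b 0]
   to [b r], its entry at [size s - i.+1] is [b (r - i)]. *)
have [b bE] := strong_recursion (fun s : seq (C^oo(M) -> C^oo(M)) =>
  fun f => if s is [::] then f else - \sum_(i < size s) a i.+1 (nth id s (size s - i.+1)%N f)).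
have b0 : b 0%N = id by rewrite bE.
have bS r f : b r.+1 f = - \sum_(i < r.+1) a i.+1 (b (r - i)%N f).
  rewrite bE size_mkseq; case E : (mkseq b r.+1) => [|h t]; first by move: (congr1 size E); rewrite size_mkseq.
  rewrite -E; congr (- _); apply: eq_bigr => i _; rewrite nth_mkseq subSS //.
  by rewrite ltnS leq_subr.
exists b; split => //; last first.
  rewrite fop_comp //; apply: fop_id => -[|r] f; first by rewrite big_ord1 a0 b0.
  by rewrite big_ord_recl a0 subn0 bS /= addNr.
move=> r; elim/ltn_ind: r => -[_|r IH]; first by rewrite b0; exact: ldiff_id.
have -> : b r.+1 = (fun f => - \sum_(i < r.+1) (a i.+1 \o b (r - i)%N) f) by apply/funext => f; exact: bS.
apply: ldiff_opp; apply: ldiff_bigsum => i _; apply: (@ldiff_comp _ _ _ (a i.+1) (b (r - i)%N)); first exact: da.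
by apply: IH; rewrite ltnS leq_subr.
Qed.

(** The right inverse has a right inverse in turn, which must be the original operator. *)
Lemma fop_inverse a : ldiffs a -> a 0%N = id ->
  exists b, [/\ ldiffs b, b 0%N = id, fop a \o fop b = id & fop b \o fop a = id].
Proof.
move=> da a0; have [b [db b0 ab]] := fop_right_inverse da a0.
have [a' [da' a'0 ba']] := fop_right_inverse db b0.
exists b; split => //; suff <- : fop a' = fop a by [].
by rewrite -[fop a']/(id \o fop a') -ab -compA ba'.
Qed.

Lemma fdiffop_invP (A B : formal M -> formal M) : fdiffop B -> A \o B = id -> B \o A = id ->
  fdiffop_inv A = B.
Proof.
move=> dB AB BA; apply: xget_unique => // B' [dB' AB' B'A].
by rewrite -[B']/(B' \o id) -AB compA B'A.
Qed.

Lemma fmulC u v : fmul u v = fmul v u.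
Proof.
apply: formalP => r; rewrite /fmul (conv_sym (fun i j => u i * v j)).
by apply: eq_bigr => i _; rewrite mulrC.
Qed.

Lemma fmulA u v w : fmul u (fmul v w) = fmul (fmul u v) w.
Proof.
apply: formalP => r; rewrite /fmul.
under eq_bigr do rewrite mulr_sumr.
under [RHS]eq_bigr do rewrite mulr_suml.
rewrite (conv_assoc (fun i j k => u i * (v j * w k))).
by apply: eq_bigr => i _; apply: eq_bigr => j _; rewrite mulrA.
Qed.

Lemma fmul_fconst f u r : fmul (fconst f) u r = f * u r.
Proof.
rewrite /fmul big_ord_recl /= subn0 big1 ?addr0 // => i _.
by rewrite /fconst /= mul0r.
Qed.

Lemma fmul1 u : fmul u (fone M) = u.
Proof. by rewrite fmulC; apply: formalP => r; rewrite fmul_fconst mul1r. Qed.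

Lemma fconst_compact f : compact (supp f) -> fcompact (fconst f).
Proof. by move=> cf r; rewrite /fconst; case: ifP => // _; exact: supp_compact0. Qed.

Definition fmulop u : nat -> C^oo(M) -> C^oo(M) := fun r f => u r * f.

Lemma fmulopE u v : fmul u v = fop (fmulop u) v. Proof. by []. Qed.

Lemma ldiffs_mul u : ldiffs (fmulop u). Proof. by move=> r; exact: ldiff_mul. Qed.

Lemma fmul_compact_r u v : fcompact v -> fcompact (fmul u v).
Proof. by rewrite fmulopE; apply: fdiffop_compact; exact/fdiffop_fop/ldiffs_mul. Qed.

Lemma fmul_compact_l u v : fcompact u -> fcompact (fmul u v).
Proof. by rewrite fmulC; exact: fmul_compact_r. Qed.

End FormalOperators.

(** * Quotients and multiples of densities *)

Section DensityRatio.
Variables (R : realType) (n : nat) (M : manifold R n).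

(** Both coefficients change by the same Jacobian factor between charts, so their quotient is a
    global function. *)
Lemma density_ratio (sigma tau : predensity M) : is_density sigma ->
  (forall c x, dom c x -> sigma c x != 0) -> is_density tau ->
  exists phi : C^oo(M), forall c x, tau c x = phi x * sigma c x.
Proof.
move=> sP s0 tP.
have /choice[cx cxP] := @dom_cover _ _ M.
have agree c d x : dom c x -> dom d x -> tau c x / sigma c x = tau d x / sigma d x.
  move=> cx' dx; have [_ _ str] := sP; have [_ _ ttr] := tP.
  have := s0 c x cx'; rewrite (str c d x) // (ttr c d x) // mulf_eq0 negb_or => /andP[J0 sd].
  by field; rewrite sd J0.
have sm : smooth (fun x => tau (cx x) x / sigma (cx x) x).
  apply: smooth_local => x; exists (cx x); exists (dom (cx x)).
  split => //; first exact: dom_open.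
  apply: (@smooth_in_eq _ _ _ (cx x) (fun z => tau (cx x) z / sigma (cx x) z)) => [z cz|].
    exact: agree.
  apply: smooth_inM; first exact: density_smooth.
  by apply: smooth_inV; [exact: s0|exact: density_smooth].
exists (mkcoo sm) => c x; have [cx'|ncx] := pselect (dom c x).
  by rewrite -[mkcoo sm x]/(tau (cx x) x / sigma (cx x) x) (agree _ c) // divfK // s0.
by rewrite (density_out tP) // (density_out sP) // mulr0.
Qed.

Lemma density_scale_one (sigma : predensity M) (phi : C^oo(M)) : is_density sigma ->
  is_density (fun c x => phi x * sigma c x).
Proof.
move=> [s1 s2 s3]; split=> [c|c x|c d x cx dx].
- by apply: smooth_inM => //; exact: coo_chart.
- by move=> /s2 ->; rewrite mulr0.
- by rewrite (s3 c d) //; ring.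
Qed.

Lemma density_add (sigma tau : predensity M) : is_density sigma -> is_density tau ->
  is_density (fun c x => sigma c x + tau c x).
Proof.
move=> [s1 s2 s3] [t1 t2 t3]; split=> [c|c x ncx|c d x cx dx].
- exact: smooth_inD.
- by rewrite s2 // t2 // addr0.
- by rewrite (s3 c d) // (t3 c d) // mulrDr.
Qed.

Lemma density_zero : is_density (fun (_ : chart M) (_ : M) => 0 : R).
Proof. by split=> [c|//|c d x _ _]; [exact: smooth_in_cst|rewrite mulr0]. Qed.

Lemma density_sum (T : Type) (s : seq T) (sigma : T -> predensity M) :
  (forall i, is_density (sigma i)) -> is_density (fun c x => \sum_(i <- s) sigma i c x).
Proof.
move=> sP; elim: s => [|i s IH].
  have -> : (fun c x => \sum_(i <- [::]) sigma i c x) = (fun _ _ => 0).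
    by apply/funext => c; apply/funext => x; rewrite big_nil.
  exact: density_zero.
have -> : (fun c x => \sum_(j <- i :: s) sigma j c x) =
    (fun c x => sigma i c x + \sum_(j <- s) sigma j c x).
  by apply/funext => c; apply/funext => x; rewrite big_cons.
exact: density_add.
Qed.

Lemma density_scaleP (phi : formal M) (rho : formal_density M) :
  (forall r, is_density (rho r)) -> forall r, is_density (density_scale phi rho r).
Proof. by move=> rP r; apply: density_sum => i; exact: density_scale_one. Qed.

Lemma coo_inverse (f : C^oo(M)) : (forall x, f x != 0) -> exists g : C^oo(M), f * g = 1.
Proof.
move=> f0; have sm : smooth (fun x => (f x)^-1).
  by move=> c; apply: smooth_inV => //; exact: coo_chart.
by exists (mkcoo sm); apply: cooP => x; rewrite cooM divff.
Qed.

End DensityRatio.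

(** * Transposition against a formal density *)

Section FormalTranspose.
Variables (R : realType) (n : nat) (M : manifold R n).
Variable rho : formal_density M.
Hypothesis rhoP : nonvanishing_density rho.
Implicit Types (f g : C^oo(M)) (u v w : formal M) (a b : nat -> C^oo(M) -> C^oo(M)).

Let sigma := rho 0%N.
Let sP : is_density sigma. Proof. by have [h _] := rhoP; exact: h. Qed.
Let s0 c x : dom c x -> sigma c x != 0. Proof. by have [_ h] := rhoP; exact: h. Qed.
Local Notation dint := (density_integral sigma).

Lemma theta_exists : exists2 theta : formal M, theta 0%N = 1 &
  forall r c x, rho r c x = theta r x * sigma c x.
Proof.
have /choice[theta thetaP] : forall r, exists phi : C^oo(M), forall c x, rho r c x = phi x * sigma c x.
  by move=> r; apply: density_ratio => //; have [h _] := rhoP.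
exists theta => //; apply: cooP => x; have [c cx] := dom_cover x.
by apply: (mulIf (s0 cx)); rewrite -thetaP mul1r.
Qed.

Section Theta.
Variable theta : formal M.
Hypotheses (theta0 : theta 0%N = 1) (thetaP : forall r c x, rho r c x = theta r x * sigma c x).

(** All orders of [rho] are absorbed in the formal function [theta], and only the leading density is
    integrated against. *)
Lemma fintegralE u r : fcompact u -> fintegral rho u r = dint (fmul u theta r).
Proof.
move=> cu; rewrite /fintegral /fmul dint_sum //; last by move=> i; exact: (suppM_l _ (cu i)).1.
apply: eq_bigr => i _.
have [rP _] := rhoP.
rewrite (dint_density_sum (s := [:: tt]) (phi := fun=> theta (r - i)%N) (sigma := fun=> sigma)) //.
  by rewrite big_seq1 mulrC.
by move=> c x; rewrite big_seq1.
Qed.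

Lemma fmul_fop_transpose a b u w r :
  (forall t j l, dint (a t (u j) * w l) = dint (u j * b t (w l))) ->
  (forall t j l, compact (supp (a t (u j) * w l)) /\ compact (supp (u j * b t (w l)))) ->
  dint (fmul (fop a u) w r) = dint (fmul u (fop b w) r).
Proof.
move=> ab cab; rewrite /fmul /fop.
under eq_bigr do rewrite mulr_suml.
under [X in _ = dint X]eq_bigr do rewrite mulr_sumr.
rewrite -(conv_assoc (fun j k l => a j (u k) * w l)).
rewrite (conv_swap (fun j k l => a j (u k) * w l)).
rewrite !dint_sum //.
- apply: eq_bigr => k _; rewrite !dint_sum //.
  + by apply: eq_bigr => j _; rewrite ab // subnAC.
  + by move=> j; exact: (cab _ _ _).2.
  + by move=> j; exact: (cab _ _ _).1.
- by move=> k; apply: supp_compact_sum => j _; exact: (cab _ _ _).2.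
- by move=> k; apply: supp_compact_sum => j _; exact: (cab _ _ _).1.
Qed.

Let theta_inv : exists m, [/\ ldiffs m, m 0%N = id, fop (fmulop theta) \o fop m = id &
  fop m \o fop (fmulop theta) = id].
Proof.
apply: fop_inverse; first exact: ldiffs_mul.
by apply/funext => f; rewrite /fmulop theta0 mul1r.
Qed.

Lemma fintegral_inj w w' :
  (forall f, compact (supp f) ->
    fintegral rho (fmul (fconst f) w) = fintegral rho (fmul (fconst f) w')) -> w = w'.
Proof.
move=> H; have [m [dm m0 mt tm]] := theta_inv.
have E : fmul theta w = fmul theta w'.
  apply: formalP => r; apply: subr0_eq.
  apply: (dint_nondeg sP s0) => u cu; rewrite mulrBr.
  have := H _ cu => /(congr1 (fun F => F r)).
  have cc1 z : fcompact (fmul (fconst u) z) by apply: fmul_compact_l; exact: fconst_compact.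
  rewrite !fintegralE // -!fmulA !fmul_fconst ![fmul _ theta]fmulC => E.
  have cz z : compact (supp (u * z)) by exact: (suppM_l z cu).1.
  rewrite dintD ?dintN ?E ?subrr //; exact: supp_compactN.
have inv v : fop m (fmul theta v) = v by exact: (congr1 (fun T => T v) tm).
by rewrite -(inv w) E inv.
Qed.

(** If [b] is the coefficientwise transpose for [sigma], the transpose for [theta * sigma] is the
    conjugate [theta^-1 b theta], with [m] the inverse of multiplication by [theta]. *)
Lemma fop_transpose a : ldiffs a -> exists2 B, fdiffop B & forall u v, fcompact u \/ fcompact v ->
  fintegral rho (fmul (fop a u) v) = fintegral rho (fmul u (B v)).
Proof.
move=> da; have [m [dm m0 mt tm]] := theta_inv.
have /choice[b bP] : forall t, exists bt : C^oo(M) -> C^oo(M), ldiff bt /\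
    forall f g, compact (supp f) \/ compact (supp g) -> dint (a t f * g) = dint (f * bt g).
  move=> t; have [Bt dBt BtP] := bldiff_transpose sP s0 (bldiff_mulr (da t)).
  exists (Bt 1); split; first exact: bldiff_r.
  by move=> f g fg; rewrite -BtP ?mulr1 //; case: fg => h; [constructor 1|constructor 3].
have db : ldiffs b by move=> t; exact: (bP t).1.
exists (fop m \o (fop b \o fop (fmulop theta))).
  apply: fdiffop_comp; first exact: fdiffop_fop.
  by apply: fdiffop_comp; apply: fdiffop_fop => //; exact: ldiffs_mul.
move=> u v uv; apply/funext => r.
have c1 : fcompact (fmul (fop a u) v).
  case: uv => h; [apply: fmul_compact_l|exact: fmul_compact_r].
  by apply: fdiffop_compact => //; exact: fdiffop_fop.
set Bv := (_ \o _) v.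
have tB : fmul theta Bv = fop b (fmul theta v).
  by rewrite fmulopE -[LHS]/((fop (fmulop theta) \o fop m) (fop b (fop (fmulop theta) v))) mt.
have c2 : fcompact (fmul u Bv).
  case: uv => h; [exact: fmul_compact_l|apply: fmul_compact_r].
  apply: (@fdiffop_compact _ _ _ (fop m \o (fop b \o fop (fmulop theta)))) => //.
  apply: fdiffop_comp; first exact: fdiffop_fop.
  by apply: fdiffop_comp; apply: fdiffop_fop => //; exact: ldiffs_mul.
rewrite !fintegralE // -!fmulA [fmul Bv _]fmulC tB [fmul v _]fmulC.
have uw : fcompact u \/ fcompact (fmul theta v) by case: uv => h; [left|right; exact: fmul_compact_r].
apply: fmul_fop_transpose => t j l.
  by apply: (bP t).2; case: uw => h; [left|right].
case: uw => h; split.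
- exact: (suppM_l _ (ldiff_supp (da t) (h j)).1).1.
- exact: (suppM_l _ (h j)).1.
- exact: (suppM_r _ (h l)).1.
- exact: (suppM_r _ (ldiff_supp (db t) (h l)).1).1.
Qed.

End Theta.

Lemma pairing_inj_const w w' :
  (forall f, compact (supp f) ->
    fintegral rho (fmul (fconst f) w) = fintegral rho (fmul (fconst f) w')) -> w = w'.
Proof. by have [theta t0 tP] := theta_exists; exact: (fintegral_inj t0 tP). Qed.

Lemma pairing_inj w w' :
  (forall u, fcompact u -> fintegral rho (fmul u w) = fintegral rho (fmul u w')) -> w = w'.
Proof. by move=> H; apply: pairing_inj_const => f cf; apply/H/fconst_compact. Qed.

(** The definition of [transpose] tests compactly supported [v] only. The operator constructed also
    has the property for compactly supported [u], and uniqueness hands it on to the chosen one. *)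
Lemma transpose_spec (A : formal M -> formal M) : fdiffop A ->
  fdiffop (transpose rho A) /\ forall u v, fcompact u \/ fcompact v ->
    fintegral rho (fmul (A u) v) = fintegral rho (fmul u (transpose rho A v)).
Proof.
move=> /fdiffopP[a da ->]; have [theta t0 tP] := theta_exists.
have [B dB BP] := fop_transpose t0 tP da.
suff -> : transpose rho (fop a) = B by [].
apply: xget_unique; first by split => // u v cv; apply: BP; right.
move=> B' [dB' B'P]; apply/funext => v; apply: formalP => r; apply: cooP => x.
(* For uniqueness [v] is replaced by a compactly supported function equal to it near [x], which by
   locality changes neither value at [x]. *)
have [chi [h1 h2 h3]] := cutoff (@openT M) (I : setT x).
pose v' : formal M := fmul (fconst chi) v.
have cv' : fcompact v' by apply: fmul_compact_l; exact: fconst_compact.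
have near i : \forall y \near x, v i y = v' i y.
  by apply: filterS h3 => y e; rewrite /v' fmul_fconst cooM e mul1r.
rewrite (fdiffop_near dB' near) (fdiffop_near dB near).
suff -> : B' v' = B v' by [].
apply: pairing_inj => u cu.
by rewrite -B'P // BP //; right.
Qed.

End FormalTranspose.

(** * Equations solved order by order in nu *)

Section Solve.
Variables (R : realType) (n : nat) (M : manifold R n).

(** The unknown of each order is isolated by the leading coefficient alone, so one recursion yields
    inverses for both products and quotients of formal densities. *)
Lemma fop_solve (a : nat -> C^oo(M) -> C^oo(M)) (u g : C^oo(M)) (w : formal M) :
  (forall f, a 0%N f = u * f) -> u * g = 1 ->
  exists2 v : formal M, fop a v = w & v 0%N = g * w 0%N.
Proof.
move=> a0 ug.
have [v vE] := strong_recursion (fun s : seq C^oo(M) =>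
  g * (w (size s) - \sum_(i < size s) a i.+1 (nth 0 s (size s - i.+1)%N))).
have vr r : v r = g * (w r - \sum_(i < r) a i.+1 (v (r - i.+1)%N)).
  rewrite vE size_mkseq; congr (_ * (_ - _)); apply: eq_bigr => i _.
  rewrite nth_mkseq //; case: r i => [[]//|r i].
  by rewrite subSS ltnS leq_subr.
exists v; last by rewrite vr big_ord0 subr0.
apply: formalP => r; rewrite /fop big_ord_recl a0 subn0 {1}vr mulrA ug mul1r.
by rewrite subrK.
Qed.

Lemma finvertibleP (u : formal M) (g : C^oo(M)) : u 0%N * g = 1 -> finvertible u.
Proof.
move=> ug; have [v vE _] := @fop_solve (fmulop u) (u 0%N) g (fone M) (fun _ => erefl) ug.
by exists v.
Qed.

End Solve.

(** * The modular automorphism *)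

Section Star.
Variables (R : realType) (n : nat) (M : manifold R n).
Variables (P : C^oo(M) -> C^oo(M) -> C^oo(M)) (C : nat -> C^oo(M) -> C^oo(M) -> C^oo(M)).
Hypothesis starC : star_product C P.
Implicit Types (u v w f g : formal M) (rho : formal_density M).

Local Notation "u ** v" := (star C u v) (at level 40, left associativity).

Let cC r : bldiff (C r). Proof. by have [h _ _ _ _] := starC; exact/bidiffopP. Qed.
Let C0E (f g : C^oo(M)) : C 0%N f g = f * g. Proof. by have [_ h _ _ _] := starC. Qed.

Lemma starA u v w : (u ** v) ** w = u ** (v ** w).
Proof. by have [_ _ _ _ h] := starC. Qed.
Lemma star1u u : fone M ** u = u.
Proof. by have [_ _ _ h _] := starC; have [] := h u. Qed.
Lemma staru1 u : u ** fone M = u.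
Proof. by have [_ _ _ h _] := starC; have [] := h u. Qed.

Definition left_coef u s (g : C^oo(M)) := \sum_(i < s.+1) C i (u (s - i)%N) g.
Definition right_coef u s (g : C^oo(M)) := \sum_(i < s.+1) C i g (u (s - i)%N).

Lemma star_left u v : u ** v = fop (left_coef u) v.
Proof. by apply: formalP => r; exact: (conv_assoc (fun i j k => C i (u j) (v k))). Qed.

Lemma star_right u v : v ** u = fop (right_coef u) v.
Proof.
apply: formalP => r; rewrite /star (conv_rot (fun i j k => C i (v j) (u k))).
exact: (conv_assoc (fun i k j => C i (v j) (u k))).
Qed.

Lemma ldiffs_left u : ldiffs (left_coef u).
Proof. by move=> s; apply: ldiff_bigsum => i _; exact: bldiff_r. Qed.

Lemma ldiffs_right u : ldiffs (right_coef u).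
Proof. by move=> s; apply: ldiff_bigsum => i _; exact: bldiff_l. Qed.

Lemma fdiffop_left u : fdiffop (star C u).
Proof.
by rewrite (_ : star C u = fop (left_coef u)); [exact/fdiffop_fop/ldiffs_left|apply/funext => v; exact: star_left].
Qed.

Lemma fdiffop_right u : fdiffop (fun v => v ** u).
Proof.
rewrite (_ : (fun v => v ** u) = fop (right_coef u)); first exact/fdiffop_fop/ldiffs_right.
by apply/funext => v; exact: star_right.
Qed.

Lemma starDr u v w : u ** (v + w) = u ** v + u ** w.
Proof. exact: (fdiffopD _ _ (fdiffop_left u)). Qed.

Lemma starDl u v w : (v + w) ** u = v ** u + w ** u.
Proof. exact: (fdiffopD _ _ (fdiffop_right u)). Qed.

Lemma star_scale_r t u v : u ** fscale t v = fscale t (u ** v).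
Proof. exact: (fdiffop_scale _ _ (fdiffop_left u)). Qed.

Lemma star_scale_l t u v : fscale t v ** u = fscale t (v ** u).
Proof. exact: (fdiffop_scale _ _ (fdiffop_right u)). Qed.

Lemma star_compact_r u v : fcompact v -> fcompact (u ** v).
Proof. exact: (fdiffop_compact (fdiffop_left u)). Qed.

Lemma star_compact_l u v : fcompact u -> fcompact (u ** v).
Proof. exact: (fdiffop_compact (fdiffop_right v)). Qed.

Lemma star_0 u v : (u ** v) 0%N = u 0%N * v 0%N.
Proof. by rewrite /star !big_ord1 C0E. Qed.

Lemma star_invertibleP u : star_invertible C u <-> exists g : C^oo(M), u 0%N * g = 1.
Proof.
split=> [[v [uv _]]|[g ug]].
  by exists (v 0%N); rewrite -star_0 uv.
have lc w (f : C^oo(M)) : left_coef w 0%N f = w 0%N * f by rewrite /left_coef big_ord1 C0E.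
have [v vE v0] := fop_solve (fone M) (lc u) ug.
have vu : v 0%N * u 0%N = 1 by rewrite v0 /fone /fconst mulr1 mulrC.
(* [v] is a right inverse of [u] and has itself a right inverse [w], whence [u = w] and [v] is
   two-sided. *)
have [w wE _] := fop_solve (fone M) (lc v) vu.
have uv : u ** v = fone M by rewrite star_left.
have vw : v ** w = fone M by rewrite star_left.
have uw : u = w by rewrite -[u]staru1 -vw -starA uv star1u.
by exists v; split => //; rewrite [X in _ ** X]uw.
Qed.

Lemma star_inv_unique u v : star_inverse C u v -> star_inv C u = v.
Proof.
move=> [uv vu]; apply: xget_unique => // w [uw wu].
by rewrite -[w]star1u -vu starA uw staru1.
Qed.

Lemma star_invP u : star_invertible C u ->
  u ** star_inv C u = fone M /\ star_inv C u ** u = fone M.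
Proof. by move=> [v uv]; rewrite (star_inv_unique uv). Qed.

Lemma star_invertible_inv u : star_invertible C u -> star_invertible C (star_inv C u).
Proof. by move=> /star_invP[h1 h2]; exists u. Qed.

Lemma star_inverseM u v : star_invertible C u -> star_invertible C v ->
  star_inverse C (u ** v) (star_inv C v ** star_inv C u).
Proof.
move=> /star_invP[u1 u2] /star_invP[v1 v2]; split.
  by rewrite starA -[v ** _]starA v1 star1u u1.
by rewrite starA -[_ ** (u ** v)]starA u2 star1u v2.
Qed.

Lemma AdM u v : star_invertible C u -> star_invertible C v -> Ad C (u ** v) = Ad C u \o Ad C v.
Proof.
move=> iu iv; apply/funext => w.
by rewrite /Ad /= (star_inv_unique (star_inverseM iu iv)) !starA.
Qed.

Lemma Ad1 : Ad C (fone M) = id.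
Proof.
apply/funext => w; rewrite /Ad star1u (@star_inv_unique _ (fone M)) ?staru1 //.
by split; rewrite star1u.
Qed.

Lemma Ad_inv u : star_invertible C u -> Ad C u \o Ad C (star_inv C u) = id /\
  Ad C (star_inv C u) \o Ad C u = id.
Proof.
move=> iu; have iu' := star_invertible_inv iu; have [h1 h2] := star_invP iu.
by rewrite -!AdM // h1 h2 Ad1.
Qed.

Lemma Ad_automorphism u : star_invertible C u -> automorphism C (Ad C u).
Proof.
move=> iu; have [h1 h2] := star_invP iu; have [a1 a2] := Ad_inv iu; split.
- exists (Ad C (star_inv C u)) => w; first exact: (congr1 (fun T => T w) a2).
  exact: (congr1 (fun T => T w) a1).
- by move=> v w; rewrite /Ad starDr starDl.
- by move=> t v; rewrite /Ad star_scale_r star_scale_l.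
- by move=> v w; rewrite /Ad !starA -[star_inv C u ** (u ** _)]starA h2 star1u.
- by rewrite /Ad staru1 h1.
Qed.

Lemma inner_Ad u : star_invertible C u -> inner C (Ad C u).
Proof. by move=> iu; split; [exact: Ad_automorphism|exists u]. Qed.

(** * The modular automorphism of one density *)

Section Modular.
Variable rho : formal_density M.
Hypothesis rhoP : nonvanishing_density rho.
Local Notation int := (fintegral rho).
Local Notation J := (Jop C rho).
Local Notation Q := (Qop C rho).

Let sigma := rho 0%N.
Let sP : is_density sigma. Proof. by have [h _] := rhoP; exact: h. Qed.
Let s0 c x : dom c x -> sigma c x != 0. Proof. by have [_ h] := rhoP; exact: h. Qed.

(** [j] collects the bidifferential transposes [Ct i f theta] and divides by [theta]. This exhibits
    [J] as a formal differential operator in [f] and yields the pairing also when only [f] has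
    compact support. *)
Lemma J_spec : exists2 j, ldiffs j /\ j 0%N = id & J = fop j /\
  forall u f, fcompact u \/ fcompact f -> int (u ** f) = int (fmul u (fop j f)).
Proof.
have [theta t0 tP] := theta_exists rhoP.
have /choice[Ct CtP] : forall i, exists Bt, bldiff Bt /\
    forall u f v : C^oo(M), [\/ compact (supp u), compact (supp f) | compact (supp v)] ->
    density_integral sigma (C i u f * v) = density_integral sigma (u * Bt f v).
  by move=> i; have [Bt h1 h2] := bldiff_transpose sP s0 (cC i); exists Bt.
have dCt i : bldiff (Ct i) := (CtP i).1.
have [m [dm m0 mt _]] : exists m, [/\ ldiffs m, m 0%N = id,
    fop (fmulop theta) \o fop m = id & fop m \o fop (fmulop theta) = id].
  apply: fop_inverse; first exact: ldiffs_mul.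
  by apply/funext => f; rewrite /fmulop t0 mul1r.
pose W s (g : C^oo(M)) := \sum_(i < s.+1) Ct i g (theta (s - i)%N).
have dW : ldiffs W by move=> s; apply: ldiff_bigsum => i _; exact: bldiff_l.
pose j s (g : C^oo(M)) := \sum_(i < s.+1) m i (W (s - i)%N g).
have dj : ldiffs j.
  by move=> s; apply: ldiff_bigsum => i _; apply: (@ldiff_comp _ _ _ (m i) (W (s - i)%N)).
have tj f : fmul theta (fop j f) = fop W f.
  have -> : fop j f = fop m (fop W f) by rewrite -[RHS]/((fop m \o fop W) f) fop_comp.
  by rewrite fmulopE -[LHS]/((fop (fmulop theta) \o fop m) (fop W f)) mt.
have pair u f : fcompact u \/ fcompact f -> int (u ** f) = int (fmul u (fop j f)).
  move=> uf; apply/funext => r.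
  have c1 : fcompact (u ** f) by case: uf; [exact: star_compact_l|exact: star_compact_r].
  have c2 : fcompact (fmul u (fop j f)).
    case: uf => h; first exact: fmul_compact_l.
    by apply: fmul_compact_r; apply: fdiffop_compact h; exact: fdiffop_fop.
  rewrite !(fintegralE rhoP tP) // -!fmulA [fmul (fop j f) theta]fmulC tj star_right.
  pose b s (g : C^oo(M)) := \sum_(i < s.+1) Ct i (f (s - i)%N) g.
  have db : ldiffs b by move=> s; apply: ldiff_bigsum => i _; exact: bldiff_r.
  (* One triple sum, over [i] and the orders of [f] and [theta], read as an operator on [f] or on
     [theta]. *)
  have -> : fop W f = fop b theta.
    apply: formalP => k; rewrite /fop /W /b -(conv_assoc (fun i l p => Ct i (f p) (theta l))).
    rewrite -(conv_assoc (fun i p l => Ct i (f p) (theta l))).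
    exact: (conv_rot (fun i l p => Ct i (f p) (theta l))).
  have cterm i k l q : compact (supp (C i (u k) (f l) * theta q)) /\ compact (supp (u k * Ct i (f l) (theta q))).
    case: uf => h.
      split; last exact: (suppM_l _ (h k)).1.
      exact: (suppM_l _ (ldiff_supp (bldiff_l (f l) (cC i)) (h k)).1).1.
    split; first exact: (suppM_l _ (ldiff_supp (bldiff_r (u k) (cC i)) (h l)).1).1.
    exact: (suppM_r _ (ldiff_supp (bldiff_l (theta q) (dCt i)) (h l)).1).1.
  apply: fmul_fop_transpose => // s k q.
    rewrite /right_coef /b mulr_suml mulr_sumr !dint_sum //.
    + apply: eq_bigr => i _; apply: (CtP i).2.
      by case: uf => h; [constructor 1|constructor 2].
    + by move=> i; exact: (cterm _ _ _ _).2.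
    + by move=> i; exact: (cterm _ _ _ _).1.
  rewrite /right_coef /b mulr_suml mulr_sumr; split; apply: supp_compact_sum => i _.
    exact: (cterm _ _ _ _).1.
  exact: (cterm _ _ _ _).2.
exists j; split => //.
  (* The leading coefficient reduces to [Ct 0 f 1 = f], because [C 0] is the pointwise product and
     the pairing is nondegenerate. *)
  apply/funext => f; rewrite /j big_ord1 m0 /W big_ord1 t0; apply: subr0_eq.
  apply: (dint_nondeg sP s0) => u cu; rewrite mulrBr dintD //; last first.
  - exact/supp_compactN/(suppM_l _ cu).1.
  - exact: (suppM_l _ cu).1.
  rewrite dintN //; last exact: (suppM_l _ cu).1.
  by rewrite -(CtP 0%N).2 ?C0E ?mulr1 ?subrr //; constructor 1.
apply/funext => f; apply: (pairing_inj rhoP) => u cu.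
have [_ h] := transpose_spec rhoP (fdiffop_right f).
by rewrite /Jop -h ?fmul1 ?pair //; left.
Qed.

Lemma fdiffop_J : fdiffop J.
Proof. by have [j [dj _] [-> _]] := J_spec; exact: fdiffop_fop. Qed.

Lemma J_pairing u f : fcompact u \/ fcompact f -> int (u ** f) = int (fmul u (J f)).
Proof. by have [j _ [-> h]] := J_spec; exact: h. Qed.

Lemma J_0 f : J f 0%N = f 0%N.
Proof. by have [j [_ j0] [-> _]] := J_spec; rewrite /fop big_ord1 j0. Qed.

Local Notation K := (fdiffop_inv J).

Lemma K_spec : [/\ fdiffop K, forall u, J (K u) = u & forall u, K (J u) = u].
Proof.
have [j [dj j0] [JE _]] := J_spec; have [b [db b0 jb bj]] := fop_inverse dj j0.
rewrite JE (fdiffop_invP (fdiffop_fop db) jb bj); split; first exact: fdiffop_fop.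
  by move=> u; exact: (congr1 (fun T => T u) jb).
by move=> u; exact: (congr1 (fun T => T u) bj).
Qed.

Local Notation Jt := (transpose rho J).
Local Notation Kt := (transpose rho K).

Lemma JtKt u : Jt (Kt u) = u.
Proof.
have [dK JK KJ] := K_spec.
have [_ hJ] := transpose_spec rhoP fdiffop_J; have [_ hK] := transpose_spec rhoP dK.
apply: (pairing_inj rhoP) => v cv; have cJ := fdiffop_compact fdiffop_J cv.
by rewrite -hJ -?hK ?KJ //; left.
Qed.

Lemma KtJt u : Kt (Jt u) = u.
Proof.
have [dK JK KJ] := K_spec.
have [_ hJ] := transpose_spec rhoP fdiffop_J; have [_ hK] := transpose_spec rhoP dK.
apply: (pairing_inj rhoP) => v cv; have cK := fdiffop_compact dK cv.
by rewrite -hK -?hJ ?JK //; left.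
Qed.

Lemma modular_property u f : fcompact u -> int (u ** f) = int (Q f ** u).
Proof.
move=> cu; have [_ hJ] := transpose_spec rhoP fdiffop_J.
rewrite J_pairing; last by left.
rewrite J_pairing; last by right.
(* [J f] is [Jt (Q f)] since [Q = Kt \o J]; then [Jt] moves back across the pairing as [J] on
   [u]. *)
by rewrite fmulC -[J f]JtKt [fmul (Jt _) u]fmulC -hJ ?[fmul (J u) _]fmulC //; left.
Qed.

Lemma star_pairing_inj w w' : (forall u, fcompact u -> int (w ** u) = int (w' ** u)) -> w = w'.
Proof.
move=> H; have [dK JK KJ] := K_spec.
apply: (pairing_inj rhoP) => u cu; have cK := fdiffop_compact dK cu.
by have := H _ cK; rewrite !J_pairing ?JK ?[fmul u _]fmulC //; right.
Qed.

Lemma Q_mul f g : Q (f ** g) = Q f ** Q g.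
Proof.
apply: star_pairing_inj => u cu; rewrite -modular_property // -starA.
rewrite modular_property; last exact: star_compact_l.
by rewrite -starA modular_property ?starA //; exact: star_compact_r.
Qed.

Lemma Q_fdiffop : fdiffop Q.
Proof.
have [dK _ _] := K_spec; have [dKt _] := transpose_spec rhoP dK.
exact: fdiffop_comp dKt fdiffop_J.
Qed.

Lemma Q_bij : bijective Q.
Proof.
have [_ JK KJ] := K_spec; exists (fun u => K (Jt u)) => u; rewrite /Qop /=.
  by rewrite JtKt KJ.
by rewrite JK KtJt.
Qed.

(** By surjectivity [1 = Q z] for some [z], and multiplicativity gives [Q 1 ** Q z = Q z]. *)
Lemma Q_one : Q (fone M) = fone M.
Proof.
have [Qi _ QiK] := Q_bij; rewrite -[LHS]staru1 -{2}(QiK (fone M)) -Q_mul star1u.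
exact: QiK.
Qed.

Lemma Q_automorphism : automorphism C Q.
Proof.
split; [exact: Q_bij| | |exact: Q_mul|exact: Q_one].
- by move=> u v; exact: fdiffopD Q_fdiffop.
- by move=> t u; exact: fdiffop_scale Q_fdiffop.
Qed.

End Modular.

(** * Dependence on the density *)

Section ChangeDensity.
Variables (rho rho' : formal_density M) (phi : formal M).
Hypotheses (rhoP : nonvanishing_density rho) (rhoP' : nonvanishing_density rho').
Hypothesis rhoE : rho' = density_scale phi rho.
Local Notation psi := (fdiffop_inv (Jop C rho) phi).

Lemma fintegral_scale u : fcompact u -> fintegral rho' u = fintegral rho (fmul u phi).
Proof.
move=> cu; apply/funext => r; have [rP _] := rhoP; have [rP' _] := rhoP'.
have -> : fintegral rho' u r = \sum_(i < r.+1) \sum_(j < (r - i).+1)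
    density_integral (rho (r - i - j)%N) (phi j * u i).
  apply: eq_bigr => i _; apply: dint_density_sum => //.
  by move=> c x; rewrite rhoE.
rewrite (conv_assoc (fun i j k => density_integral (rho k) (phi j * u i))).
apply: eq_bigr => k _; rewrite /fmul dint_sum //.
  by apply: eq_bigr => i _; rewrite mulrC.
by move=> i; exact: (suppM_l _ (cu i)).1.
Qed.

Lemma finvertible_psi : finvertible phi -> star_invertible C psi.
Proof.
move=> [v pv]; apply/star_invertibleP; exists (v 0%N).
have [dK JK KJ] := K_spec rhoP.
rewrite -(J_0 rhoP) JK -[RHS]/(fone M 0%N) -pv.
by rewrite /fmul big_ord1.
Qed.

Lemma fintegral_change u : fcompact u -> fintegral rho' u = fintegral rho (u ** psi).
Proof.
move=> cu; have [dK JK KJ] := K_spec rhoP.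
by rewrite fintegral_scale // (J_pairing rhoP) ?JK //; left.
Qed.

Lemma Q_change_mul f : Qop C rho (f ** psi) = Qop C rho psi ** Qop C rho' f.
Proof.
apply: (star_pairing_inj rhoP) => u cu; rewrite -(modular_property rhoP) // -starA.
rewrite -fintegral_change; last exact: star_compact_l.
rewrite (modular_property rhoP') // fintegral_change; last exact: star_compact_r.
by rewrite (modular_property rhoP) ?starA //; exact: star_compact_r.
Qed.

Lemma Q_change : finvertible phi -> Qop C rho = Qop C rho' \o Ad C psi.
Proof.
move=> /finvertible_psi ipsi; have [h1 h2] := star_invP ipsi.
apply/funext => g; rewrite /= /Ad.
(* The identity is taken at [f = Ad psi g] and then multiplied on the left by [Q (psi^-1)], which is
   inverse to [Q psi]. *)
have := Q_change_mul ((psi ** g) ** star_inv C psi).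
rewrite starA h2 staru1 (Q_mul rhoP) => E.
have : Qop C rho (star_inv C psi) ** (Qop C rho psi ** Qop C rho g) =
  Qop C rho (star_inv C psi) ** (Qop C rho psi ** Qop C rho' (psi ** g ** star_inv C psi)).
  by rewrite E.
by rewrite -!starA -(Q_mul rhoP) h2 (Q_one rhoP) !star1u.
Qed.

End ChangeDensity.

Lemma density_quotient rho rho' : nonvanishing_density rho -> nonvanishing_density rho' ->
  exists2 phi, finvertible phi & rho' = density_scale phi rho.
Proof.
move=> rhoP rhoP'; have [rP r0] := rhoP; have [rP' r0'] := rhoP'.
have [theta t0 tP] := theta_exists rhoP.
have /choice[kappa kP] : forall r, exists k : C^oo(M), forall c x, rho' r c x = k x * rho 0%N c x.
  by move=> r; apply: density_ratio.
have t1 : theta 0%N * 1 = 1 by rewrite t0 mul1r.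
(* [theta] and [kappa] express [rho] and [rho'] over the leading density of [rho], so the quotient
   [phi] solves [theta * phi = kappa]. *)
have [phi phiE phi0] := @fop_solve _ _ _ (fmulop theta) (theta 0%N) 1 (kappa : formal M)
  (fun _ => erefl) t1.
have k0 x : kappa 0%N x != 0.
  have [c cx] := dom_cover x; have := r0' c x cx.
  by rewrite kP mulf_eq0 negb_or => /andP[].
exists phi.
  have [g kg] := coo_inverse k0; apply: (@finvertibleP _ _ _ _ g).
  by rewrite phi0 mul1r.
apply/funext => r; apply/funext => c; apply/funext => x; rewrite kP -phiE -fmulopE fmulC.
rewrite /fmul /density_scale coo_sum mulr_suml; apply: eq_bigr => i _.
by rewrite [in RHS]tP cooM mulrA.
Qed.

(** By [Q_change], [Qop C rho \o Ad chi] is [Qop C rho' \o Ad (psi ** chi)]; the densities enter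
    symmetrically, so one inclusion suffices. *)
Lemma outer_class_eq rho rho' : nonvanishing_density rho -> nonvanishing_density rho' ->
  outer_class C (Qop C rho) = outer_class C (Qop C rho').
Proof.
have half (r r' : formal_density M) : nonvanishing_density r -> nonvanishing_density r' ->
    outer_class C (Qop C r) `<=` outer_class C (Qop C r').
  move=> rP rP' _ [S [_ [chi ichi ->]] <-].
  have [phi iphi rE] := density_quotient rP rP'.
  have ipsi := finvertible_psi rP iphi.
  rewrite (Q_change rP rP' rE iphi) -compA -AdM //.
  eexists; [apply: inner_Ad|by []].
  by exists (star_inv C chi ** star_inv C (fdiffop_inv (Jop C r) phi)); exact: star_inverseM.
by move=> rP rP'; apply/seteqP; split; exact: half.
Qed.

(** The trace property makes [J] symmetric for the pairing, hence equal to its transpose, and then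
    [Q = Kt \o Jt = id]. Testing on functions free of nu suffices by [fdiffop_eq]. *)
Lemma trace_density_Q rho : nonvanishing_density rho -> trace_density C rho -> Qop C rho = id.
Proof.
move=> rhoP trP; have dJ := fdiffop_J rhoP.
have [dJt hJ] := transpose_spec rhoP dJ.
suff E : Jop C rho = transpose rho (Jop C rho).
  by apply/funext => u; rewrite /Qop /= {2}E KtJt.
apply: (fdiffop_eq dJ dJt) => f; apply: (pairing_inj_const rhoP) => g cg.
have cg' := fconst_compact cg.
rewrite -(J_pairing rhoP); last by left.
rewrite -trP // (J_pairing rhoP); last by right.
by rewrite fmulC hJ //; left.
Qed.

Lemma Q_id_trace rho : nonvanishing_density rho -> Qop C rho = id -> trace_density C rho.
Proof.
move=> rhoP Q1 u v cv.
by rewrite [RHS](modular_property rhoP) ?Q1 //; exact: fconst_compact.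
Qed.

(** For a trace density [Q_change] reads [id = Qop C rho \o Ad psi], so [Qop C rho] is conjugation
    by the star inverse of [psi]. *)
Lemma trace_density_inner rho0 rho : nonvanishing_density rho0 -> trace_density C rho0 ->
  nonvanishing_density rho -> inner C (Qop C rho).
Proof.
move=> rP0 tr0 rP; have [phi iphi rE] := density_quotient rP0 rP.
have ipsi := finvertible_psi rP0 iphi; have [h1 h2] := Ad_inv ipsi.
suff -> : Qop C rho = Ad C (star_inv C (fdiffop_inv (Jop C rho0) phi)).
  exact/inner_Ad/star_invertible_inv.
have := Q_change rP0 rP rE iphi; rewrite (trace_density_Q rP0 tr0) => E.
by rewrite -[LHS]/(Qop C rho \o id) -h1 compA -E.
Qed.

(** Here [psi = K (J chi) = chi], so [Q_change] gives [Ad chi = Q' \o Ad chi] for the modular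
    automorphism [Q'] of the new density, hence [Q' = id]. The new density does not vanish because
    [J] preserves the leading coefficient and that of [chi] is invertible. *)
Lemma inner_trace_density rho chi : nonvanishing_density rho -> star_invertible C chi ->
  Qop C rho = Ad C chi ->
  nonvanishing_density (density_scale (Jop C rho chi) rho) /\
  trace_density C (density_scale (Jop C rho chi) rho).
Proof.
move=> rP ichi QE; have [dK JK KJ] := K_spec rP.
have [g chig] := (star_invertibleP chi).1 ichi.
have Jg : Jop C rho chi 0%N * g = 1 by rewrite (J_0 rP).
have rP' : nonvanishing_density (density_scale (Jop C rho chi) rho).
  have [r1 r2] := rP; split; first exact: density_scaleP.
  move=> c x cx; rewrite /density_scale big_ord1 subn0 mulf_neq0 //; last exact: r2.
  apply/eqP => J0; have := congr1 (fun f : C^oo(M) => f x) Jg.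
  by rewrite cooM J0 mul0r coo1 => /eqP; rewrite eq_sym oner_eq0.
split => //; apply: (Q_id_trace rP').
have iphi := finvertibleP Jg.
have := Q_change rP rP' erefl iphi; rewrite KJ QE => E.
have [h1 h2] := Ad_inv ichi.
by rewrite -[LHS]/(Qop C (density_scale (Jop C rho chi) rho) \o id) -h1 compA -E.
Qed.

End Star.

Theorem mainTheorem3 (R : realType) (n : nat) (M : manifold R n)
    (P : C^oo(M) -> C^oo(M) -> C^oo(M))
    (C : nat -> C^oo(M) -> C^oo(M) -> C^oo(M))
    (poissonP : poisson_bracket P) (starC : star_product C P) :
  [/\ forall rho, nonvanishing_density rho -> automorphism C (Qop C rho),
      forall rho rho' phi,
        nonvanishing_density rho -> nonvanishing_density rho' ->
        finvertible phi -> rho' = density_scale phi rho ->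
        let psi := fdiffop_inv (Jop C rho) phi in
        star_invertible C psi /\ Qop C rho = Qop C rho' \o Ad C psi,
      forall rho rho', nonvanishing_density rho -> nonvanishing_density rho' ->
        outer_class C (Qop C rho) = outer_class C (Qop C rho'),
      (exists2 rho, nonvanishing_density rho & trace_density C rho) ->
        forall rho, nonvanishing_density rho -> inner C (Qop C rho) &
      forall rho chi, nonvanishing_density rho -> star_invertible C chi ->
        Qop C rho = Ad C chi ->
        let rho' := density_scale (Jop C rho chi) rho in
        nonvanishing_density rho' /\ trace_density C rho'].
Proof.
split.
- exact: (Q_automorphism starC).
- move=> rho rho' phi rP rP' iphi rE psi; split; first exact: (finvertible_psi starC rP iphi).
  exact: (Q_change starC rP rP' rE iphi).
- exact: (outer_class_eq starC).
- by move=> [rho0 rP0 tr0] rho; exact: (trace_density_inner starC rP0 tr0).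
- by move=> rho chi rP ichi QE; exact: (inner_trace_density starC rP ichi QE).
Qed.
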